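(* Let $f$ be either strictly convex, or strictly concave, and let $v \in H^{1/2}(\Omega) \cap L^\infty(\Omega)$ be a stable solution to $$\begin{cases} (-\Delta_N)^{1/2} v = f(v) & \text{in } \Omega,\\ \partial_\nu v=0 & \text{on } \partial \Omega,\end{cases}$$ where solutions and stability are understood as in the context. Then $v$ is constant.
   Context: Let $n\ge1$, let $\Omega\subset\mathbb{R}^n$ be a bounded domain of class $C^{4,\alpha}$ and $f\in C^{2,\alpha}(\mathbb{R})$, for some $\alpha\in(0,1)$. Put $\mathcal{C}:=\Omega\times(0,+\infty)$, with points $(x,y)$, $\partial_L\mathcal{C}:=\partial\Omega\times(0,+\infty)$, $\partial_B\mathcal{C}:=\Omega\times\{0\}$. Spectral Neumann Laplacian. Let $\{\varphi_k\}_{k\ge0}$, $\{\lambda_k\}_{k\ge0}$ be the eigenfunctions and eigenvalues of $-\Delta$ in $\Omega$ with homogeneous Neumann conditions on $\partial\Omega$, the $\varphi_k$ forming an orthonormal basis of $L^2(\Omega)$. For $w=\sum_{k}w_k\varphi_k$, $w_k=\int_\Omega w\varphi_k$, one sets $(-\Delta_N)^{1/2}w:=\sum_k\lambda_k^{1/2}w_k\varphi_k$. Let $H^{1/2}(\Omega):=\{w=\sum_kw_k\varphi_k\in L^2(\Omega):\ \sum_k\lambda_k^{1/2}|w_k|^2<+\infty\}$. Solution. $v=\sum_kv_k\varphi_k\in H^{1/2}(\Omega)\cap L^\infty(\Omega)$ is a solution of the problem if $\sum_k\lambda_k^{1/2}v_k\zeta_k=\int_\Omega f(v)\zeta\,dx$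 for every $\zeta=\sum_k\zeta_k\varphi_k\in H^{1/2}(\Omega)$. Extension. Let $\mathcal{H}(\mathcal{C})$ be the completion of $H^1(\mathcal{C})$ with respect to the scalar product $\int_{\mathcal{C}}\nabla u_1\cdot\nabla u_2+\int_\Omega u_1u_2$, where in the last integral $u_i|_\Omega$ is the trace on $\Omega\times\{0\}$. A weak solution $v$ is the trace on $\Omega\times\{0\}$ of a function $u\in\mathcal{H}(\mathcal{C})$, called its extension, such that $\int_{\mathcal{C}}\nabla u\cdot\nabla\varphi-\int_{\Omega\times\{0\}}f(u)\varphi=0$ for all $\varphi\in\mathcal{H}(\mathcal{C})$; this is the weak form of $\Delta u=0$ in $\mathcal{C}$, $\partial_\nu u=0$ on $\partial_L\mathcal{C}$, $-\partial_yu=f(u)$ on $\partial_B\mathcal{C}$. Stability. The solution $v$ is stable if its extension $u$ satisfies $\int_{\mathcal{C}}|\nabla\varphi|^2-\int_{\Omega\times\{0\}}f'(u)\varphi^2\ge0$ for every $\varphi\in\mathcal{A}$, where $\mathcal{A}$ is the set of $\varphi\in W^{1,1}_{\rm loc}(\mathcal{C})$ having bounded support in $y$, with $|\nabla\varphi|^2\in L^1(\mathcal{C})$ and $\varphi|_{\Omega\times\{0\}}\in L^2(\Omega)$. *)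

(* Defs.v *)
From HB Require Import structures.
From mathcomp Require Import all_boot all_order all_algebra.
From mathcomp Require Import all_classical all_reals all_analysis.

Set Implicit Arguments.
Unset Strict Implicit.
Unset Printing Implicit Defensive.

Import Order.TTheory GRing.Theory Num.Theory.
Import numFieldNormedType.Exports.

Local Open Scope classical_set_scope.
Local Open Scope ring_scope.

(** ** Lebesgue measure on R^m, whose points are row vectors *)

Definition measure_rV_display : measure_display.
Proof. exact: default_measure_display. Qed.

Section measurable_rV.
Context {R : realType} (m : nat).

Let coors : 'I_m -> 'rV[R]_m -> measurableTypeR R := fun i x => x ord0 i.

Let rV_set0 : g_sigma_preimage coors set0.
Proof. exact: sigma_algebra0. Qed.

Let rV_setC A : g_sigma_preimage coors A -> g_sigma_preimage coors (~` A).
Proof. exact: sigma_algebraC. Qed.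

Let rV_bigcup (F : _^nat) : (forall i, g_sigma_preimage coors (F i)) ->
  g_sigma_preimage coors (\bigcup_i (F i)).
Proof. exact: sigma_algebra_bigcup. Qed.

(* The sigma-algebra generated by the coordinate functions, as the library does
   for tuples; it is the Borel sigma-algebra. *)
HB.instance Definition _ := @isMeasurable.Build measure_rV_display
  'rV[R]_m (g_sigma_preimage coors) rV_set0 rV_setC rV_bigcup.

End measurable_rV.

(* The last coordinate [ord_max] of a point of R^(n+1) is the variable y. *)
Definition xpart (R : realType) (n : nat) (z : 'rV[R]_n.+1) : 'rV[R]_n :=
  \row_j z ord0 (lift ord_max j).
Definition ypart (R : realType) (n : nat) (z : 'rV[R]_n.+1) : R :=
  z ord0 ord_max.
Definition join_xy (R : realType) (n : nat) (x : 'rV[R]_n) (y : R) :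
    'rV[R]_n.+1 :=
  \row_i (if unlift ord_max i is Some j then x ord0 j else y).

Lemma measurable_rV_coord (R : realType) (m : nat) (i : 'I_m) :
  measurable_fun [set: 'rV[R]_m] (fun x => x ord0 i : measurableTypeR R).
Proof.
move=> _ Y mY; rewrite setTI; apply: sub_sigma_algebra => /=.
rewrite -bigcup_seq/=; exists i => /=; first by rewrite mem_index_enum.
by exists Y => //; rewrite setTI.
Qed.

Lemma measurable_join_xy (R : realType) (n : nat) :
  measurable_fun [set: 'rV[R]_n * measurableTypeR R]
    (fun p => join_xy p.1 p.2).
Proof.
pose F (p : 'rV[R]_n * measurableTypeR R) := join_xy p.1 p.2.
have mF i : measurable_fun setT (fun p => F p ord0 i : measurableTypeR R).
  rewrite /F /join_xy; case: (unliftP ord_max i) => [j|] ->.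
    rewrite (_ : (fun _ => _) = (fun x : 'rV[R]_n => x ord0 j) \o fst).
      by apply: measurableT_comp => //; exact: measurable_rV_coord.
    by apply/funext => p; rewrite mxE liftK.
  rewrite (_ : (fun _ => _) = snd) //.
  by apply/funext => p; rewrite mxE unlift_none.
have sF : g_sigma_preimage (fun i => (fun x : 'rV[R]_n.+1 =>
    x ord0 i : measurableTypeR R) \o F) `<=` measurable.
  apply: smallest_sub; first exact: sigma_algebra_measurable.
  rewrite -bigcup_mkord_ord; apply: bigcup_sub => i Ii.
  by move=> A [B mB <-]; exact: mF.
move=> _ A mA; rewrite g_sigma_preimage_comp in sF.
by apply: sF; exists A.
Qed.

Fixpoint lebesgue_rV (R : realType) (n : nat) :
    {measure set 'rV[R]_n -> \bar R} :=
  match n with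
  | 0 => \d_(0 : 'rV[R]_0)
  | n'.+1 =>
    measure_function_pushforward__canonical__measure_function_Measure
      (lebesgue_rV R n' \x @lebesgue_measure R)%E (@measurable_join_xy R n')
  end.

Notation "\int_ ( x 'in' D ) f" :=
  (Rintegral (lebesgue_rV _ _) D (fun x => f)%R)
  (at level 36, f at level 36, x, D at level 50) : ring_scope.

(** ** Classes of functions and of domains *)

Definition unit_vec (R : realType) (m : nat) (i : 'I_m) : 'rV[R]_m :=
  delta_mx ord0 i.

Definition partial (R : realType) (m : nat) (i : 'I_m) (h : 'rV[R]_m -> R) :
    'rV[R]_m -> R :=
  'D_(unit_vec R i) (h : 'rV[R]_m -> R^o).

(* h is k times continuously differentiable and all its partial derivatives of
   order k satisfy P. *)
Fixpoint diff_class (R : realType) (m : nat) (P : ('rV[R]_m -> R) -> Prop)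
    (k : nat) (h : 'rV[R]_m -> R) : Prop :=
  match k with
  | 0 => P h
  | k'.+1 => [/\ continuous h,
      forall i x, derivable (h : 'rV[R]_m -> R^o) x (unit_vec R i) &
      forall i, diff_class P k' (partial i h)]
  end.

Definition locally_holder (R : realType) (V : normedModType R) (alpha : R)
    (h : V -> R) : Prop :=
  forall K : set V, compact K ->
    exists C : R, forall x y, K x -> K y ->
      `|h x - h y| <= C * `|x - y| `^ alpha.

Definition smooth (R : realType) (m : nat) (h : 'rV[R]_m -> R) : Prop :=
  forall k, diff_class (fun g => continuous g) k h.

Definition C_holder (R : realType) (m : nat) (k : nat) (alpha : R)
    (h : 'rV[R]_m -> R) : Prop :=
  diff_class (@locally_holder R 'rV[R]_m alpha) k h.

Definition C_holder_real (R : realType) (k : nat) (alpha : R) (f : R -> R) :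
    Prop :=
  (forall j x, (j < k)%N -> derivable (derive1n j (f : R -> R^o)) x 1) /\
  locally_holder (V := R^o) alpha (derive1n k (f : R -> R^o)).

Definition is_domain (R : realType) (m : nat) (Omega : set 'rV[R]_m) : Prop :=
  [/\ open Omega, connected Omega & Omega !=set0].

(* Near each boundary point, and up to relabelling and reorienting the
   coordinate axes, Omega is the region above the graph of a C^{k,alpha}
   function of the other coordinates. *)
Definition C_holder_domain (R : realType) (m : nat) (k : nat) (alpha : R)
    (Omega : set 'rV[R]_m) : Prop :=
  forall x0, closure Omega x0 -> ~ interior Omega x0 ->
    exists (r : R) (i : 'I_m) (s : bool) (gamma : 'rV[R]_m.-1 -> R),
      [/\ 0 < r, C_holder k alpha gamma &
          forall x, ball x0 r x ->
            (Omega x <-> gamma (col' i x) < (-1) ^+ s * x ord0 i)].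

Definition strictly_convex (R : realType) (f : R -> R) : Prop :=
  forall x y t : R, x != y -> 0 < t -> t < 1 ->
    f (t * x + (1 - t) * y) < t * f x + (1 - t) * f y.

Definition strictly_concave (R : realType) (f : R -> R) : Prop :=
  forall x y t : R, x != y -> 0 < t -> t < 1 ->
    t * f x + (1 - t) * f y < f (t * x + (1 - t) * y).

(** ** Lebesgue and Sobolev spaces on an open set U of R^m *)

(* Integrability on U near every point of V. *)
Definition locally_integrable_in (R : realType) (m : nat) (V U : set 'rV[R]_m)
    (u : 'rV[R]_m -> R) : Prop :=
  measurable_fun U u /\
  forall K, compact K -> K `<=` V ->
    (lebesgue_rV R m).-integrable (U `&` K) (EFin \o u).

Definition L2 (R : realType) (m : nat) (U : set 'rV[R]_m)
    (u : 'rV[R]_m -> R) : Prop :=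
  measurable_fun U u /\
  (lebesgue_rV R m).-integrable U (fun x => (u x ^+ 2)%:E).

Definition Linfty (R : realType) (m : nat) (U : set 'rV[R]_m)
    (u : 'rV[R]_m -> R) : Prop :=
  measurable_fun U u /\
  exists M : R, {ae lebesgue_rV R m, forall x, U x -> `|u x| <= M}.

Definition test_function (R : realType) (m : nat) (U : set 'rV[R]_m)
    (h : 'rV[R]_m -> R) : Prop :=
  smooth h /\
  exists K, [/\ compact K, K `<=` U & forall x, ~ K x -> h x = 0].

(* Functions are defined on the whole space, but only their values on U matter;
   a vector field is given by its components. *)
Definition weak_gradient (R : realType) (m : nat) (U : set 'rV[R]_m)
    (u : 'rV[R]_m -> R) (G : 'I_m -> 'rV[R]_m -> R) : Prop :=
  [/\ locally_integrable_in U U u,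
      forall i, locally_integrable_in U U (G i) &
      forall i h, test_function U h ->
        \int_(x in U) (u x * partial i h x) = - \int_(x in U) (G i x * h x)].

Definition dot (R : realType) (m : nat) (G H : 'I_m -> 'rV[R]_m -> R)
    (x : 'rV[R]_m) : R :=
  \sum_(i < m) G i x * H i x.

(* u is in H^1(U), with weak gradient G. *)
Definition H1 (R : realType) (m : nat) (U : set 'rV[R]_m)
    (u : 'rV[R]_m -> R) (G : 'I_m -> 'rV[R]_m -> R) : Prop :=
  [/\ weak_gradient U u G, L2 U u & forall i, L2 U (G i)].

(** ** The spectral Neumann Laplacian *)

(* Weak form of - Delta w = l w in Omega, d_nu w = 0 on the boundary. *)
Definition neumann_eigenpair (R : realType) (n : nat) (Omega : set 'rV[R]_n)
    (l : R) (w : 'rV[R]_n -> R) : Prop :=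
  exists2 G, H1 Omega w G &
    forall psi H, H1 Omega psi H ->
      \int_(x in Omega) dot G H x = l * \int_(x in Omega) (w x * psi x).

Definition coef (R : realType) (n : nat) (Omega : set 'rV[R]_n)
    (phi : nat -> 'rV[R]_n -> R) (w : 'rV[R]_n -> R) (k : nat) : R :=
  \int_(x in Omega) (w x * phi k x).

Definition orthonormal_basis (R : realType) (n : nat) (Omega : set 'rV[R]_n)
    (phi : nat -> 'rV[R]_n -> R) : Prop :=
  [/\ forall k, L2 Omega (phi k),
      forall j k, \int_(x in Omega) (phi j x * phi k x) = (j == k)%:R &
      forall w, L2 Omega w ->
        (fun N => \int_(x in Omega)
           ((w x - \sum_(k < N) coef Omega phi w k * phi k x) ^+ 2))
        @ \oo --> (0 : R)].

Definition neumann_eigenbasis (R : realType) (n : nat) (Omega : set 'rV[R]_n)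
    (phi : nat -> 'rV[R]_n -> R) (lambda : nat -> R) : Prop :=
  orthonormal_basis Omega phi /\
  forall k, neumann_eigenpair Omega (lambda k) (phi k).

Definition Hhalf (R : realType) (n : nat) (Omega : set 'rV[R]_n)
    (phi : nat -> 'rV[R]_n -> R) (lambda : nat -> R) (w : 'rV[R]_n -> R) :
    Prop :=
  L2 Omega w /\
  cvgn (series (fun k => Num.sqrt (lambda k) * `|coef Omega phi w k| ^+ 2)).

(* Weak form of (- Delta_N)^{1/2} v = f(v). *)
Definition half_laplacian_solution (R : realType) (n : nat)
    (Omega : set 'rV[R]_n) (phi : nat -> 'rV[R]_n -> R) (lambda : nat -> R)
    (f : R -> R) (v : 'rV[R]_n -> R) : Prop :=
  [/\ Hhalf Omega phi lambda v, Linfty Omega v &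
      forall zeta, Hhalf Omega phi lambda zeta ->
        series (fun k => Num.sqrt (lambda k) *
                         coef Omega phi v k * coef Omega phi zeta k)
        @ \oo --> \int_(x in Omega) (f (v x) * zeta x)].

(** ** The extension to the half-cylinder *)

Definition cylinder (R : realType) (n : nat) (Omega : set 'rV[R]_n) :
    set 'rV[R]_n.+1 :=
  [set z | Omega (xpart z) /\ 0 < ypart z].

(* t is the trace on Omega x {0} of u, where G is the weak gradient of u:
   the Gauss-Green formula holds against every test function on Omega x R. *)
Definition is_trace (R : realType) (n : nat) (Omega : set 'rV[R]_n)
    (u : 'rV[R]_n.+1 -> R) (G : 'I_n.+1 -> 'rV[R]_n.+1 -> R)
    (t : 'rV[R]_n -> R) : Prop :=
  let V := [set z : 'rV[R]_n.+1 | Omega (xpart z)] in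
  [/\ locally_integrable_in V (cylinder Omega) u,
      locally_integrable_in V (cylinder Omega) (G ord_max),
      locally_integrable_in Omega Omega t &
      forall h, test_function V h ->
        \int_(z in cylinder Omega) (u z * partial ord_max h z + G ord_max z * h z)
        = - \int_(x in Omega) (t x * h (join_xy x 0))].

(* The completion of H^1(C) for |u|^2 = int_C |grad u|^2 + int_Omega u^2,
   realized as a space of functions: by the trace inequality on bounded parts
   of C, a Cauchy sequence also converges locally in L^2.
   u is such a function, with weak gradient G and trace t. *)
Definition H_cylinder (R : realType) (n : nat) (Omega : set 'rV[R]_n)
    (u : 'rV[R]_n.+1 -> R) (G : 'I_n.+1 -> 'rV[R]_n.+1 -> R)
    (t : 'rV[R]_n -> R) : Prop :=
  let C := cylinder Omega in
  [/\ weak_gradient C u G /\ is_trace Omega u G t,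
      (forall i, L2 C (G i)), L2 Omega t &
      exists (uj : nat -> 'rV[R]_n.+1 -> R)
             (Gj : nat -> 'I_n.+1 -> 'rV[R]_n.+1 -> R)
             (tj : nat -> 'rV[R]_n -> R),
        [/\ forall j, H1 C (uj j) (Gj j),
            forall j, is_trace Omega (uj j) (Gj j) (tj j) /\ L2 Omega (tj j),
            (fun j => \int_(z in C) (\sum_i (Gj j i z - G i z) ^+ 2))
              @ \oo --> (0 : R) &
            (fun j => \int_(x in Omega) ((tj j x - t x) ^+ 2))
              @ \oo --> (0 : R)]].

(* u, with weak gradient G, is the extension of v: its trace is v and
   Delta u = 0 in C, d_nu u = 0 on the lateral boundary, - d_y u = f(u) on the
   bottom, in the weak sense. *)
Definition is_extension (R : realType) (n : nat) (Omega : set 'rV[R]_n)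
    (f : R -> R) (v : 'rV[R]_n -> R) (u : 'rV[R]_n.+1 -> R)
    (G : 'I_n.+1 -> 'rV[R]_n.+1 -> R) : Prop :=
  H_cylinder Omega u G v /\
  forall h H s, H_cylinder Omega h H s ->
    \int_(z in cylinder Omega) dot G H z - \int_(x in Omega) (f (v x) * s x)
    = 0.

(* h is in the class A, with weak gradient H and trace s. *)
Definition stability_class (R : realType) (n : nat) (Omega : set 'rV[R]_n)
    (h : 'rV[R]_n.+1 -> R) (H : 'I_n.+1 -> 'rV[R]_n.+1 -> R)
    (s : 'rV[R]_n -> R) : Prop :=
  [/\ weak_gradient (cylinder Omega) h H,
      exists Y : R, {ae lebesgue_rV R n.+1, forall z,
        cylinder Omega z -> Y < ypart z -> h z = 0},
      forall i, L2 (cylinder Omega) (H i),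
      is_trace Omega h H s &
      L2 Omega s].

(* The extension u is unique up to a null set, and f'(u) on the bottom is
   f'(v) because v is the trace of u. *)
Definition stable (R : realType) (n : nat) (Omega : set 'rV[R]_n)
    (f : R -> R) (v : 'rV[R]_n -> R) : Prop :=
  exists u G, is_extension Omega f v u G /\
    forall h H s, stability_class Omega h H s ->
      0 <= \int_(z in cylinder Omega) dot H H z
           - \int_(x in Omega) (derive1 (f : R -> R^o) (v x) * s x ^+ 2).

(* Main.v *)
Require Import Defs.
From HB Require Import structures.
From mathcomp Require Import all_boot all_order all_algebra.
From mathcomp Require Import all_classical all_reals all_analysis.
From mathcomp Require Import measurable_realfun ring lra.

Set Implicit Arguments.
Unset Strict Implicit.
Unset Printing Implicit Defensive.

Import Order.TTheory GRing.Theory Num.Theory.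
Import numFieldNormedType.Exports.

Local Open Scope classical_set_scope.
Local Open Scope ring_scope.

(** Suppose that f is strictly convex, let u be the extension of v to the
    half-cylinder C, and let c be a level with f(c) <= 0. The truncation
    w = min((u - c)^+, M) and a cutoff k(y) with values in [0, 1] and k(0) = 1
    give a function k w that may be used both in the equation and in the
    stability inequality. The gradient of w is that of u or 0, hence
    |grad(k w)|^2 <= grad u . grad(k w) up to terms that contain k'. As w is
    bounded and Omega has finite measure, these terms disappear when k is
    stretched to infinity, because the integral over C of (k' w)^2 is of order
    1/N for a cutoff of height N. With s = (v - c)^+ there remains
      int_Omega (f(v) s - f'(v) s^2) >= 0,
    which is [truncated_energy_ge0]. But where v > c the tangent to the graph
    of f at v shows that f(v) - f'(v) (v - c) < f(c) <= 0. So v <= c almost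
    everywhere ([le_of_truncated_energy]).

    Testing the equation with the constant 1, which is orthogonal to the
    eigenfunctions of nonzero eigenvalue, gives int_Omega f(v) = 0
    ([solution_mean_zero]). Let z be the least level with f(z) <= 0. Then
    v <= z, and f >= 0 on ]-oo, z], so f(v) >= 0 has mean zero; thus f(v) = 0
    and v = z ([constant_of_convex]). A concave f reduces to this case by
    replacing v, u and f(r) by -v, -u and -f(-r).

    The analytic tool is the chain rule for the positive part w = (u - c)^+ of
    a function with weak gradient, together with its counterpart for traces.
    Convexity gives w(x + t e) - w(x) >= 1_{u > c}(x) (u(x + t e) - u(x)).
    Integrated against a test function h >= 0, this says that a function of t
    is minimal at t = 0, and the vanishing of its derivative there is the
    chain rule ([weak_chain_rule_ge0]). Differentiating the right-hand side
    means passing to the limit in the difference quotients of u against the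
    indicator of a measurable set ([weak_difference_quotient]). That rests on
    the smooth approximation of measurable sets
    ([smooth_approximable_measurable]) and on the continuity of translations
    in L^1 ([translation_continuous]). Traces need no separate argument: when
    u is extended below y = 0 by its trace, the Gauss-Green formula becomes
    the statement that the extension has a weak derivative in y
    ([trace_weak_partial]). *)

(** * Borel sets of R^m *)

Section measurability.
Context {R : realType}.

Lemma measurable_fun_rV d (T : measurableType d) m (g : T -> 'rV[R]_m) :
  (forall i, measurable_fun setT (fun x => g x ord0 i : measurableTypeR R)) ->
  measurable_fun setT g.
Proof.
move=> mg.
have sF : g_sigma_preimage (fun i => (fun x : 'rV[R]_m =>
    x ord0 i : measurableTypeR R) \o g) `<=` measurable.
  apply: smallest_sub; first exact: sigma_algebra_measurable.
  by rewrite -bigcup_seq/=; apply: bigcup_sub => i _ A [B mB <-]; exact: mg.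
move=> _ A mA; rewrite g_sigma_preimage_comp in sF.
by apply: sF; exists A.
Qed.

Lemma measurable_addr_rV m (a : 'rV[R]_m) :
  measurable_fun setT (fun x : 'rV[R]_m => x + a).
Proof.
apply: measurable_fun_rV => i.
rewrite (_ : (fun _ => _) =
  (fun y : R => y + a ord0 i) \o (fun x : 'rV[R]_m => x ord0 i)).
  apply: measurableT_comp; last exact: measurable_rV_coord.
  exact: measurable_funD.
by apply/funext => x /=; rewrite mxE.
Qed.

Lemma measurable_xpart n : measurable_fun setT (@xpart R n).
Proof.
apply: measurable_fun_rV => i.
rewrite (_ : (fun _ => _) = (fun x : 'rV[R]_n.+1 => x ord0 (lift ord_max i))).
  exact: measurable_rV_coord.
by apply/funext => x; rewrite mxE.
Qed.

Lemma measurable_ypart n :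
  measurable_fun setT (@ypart R n : _ -> measurableTypeR R).
Proof. exact: measurable_rV_coord. Qed.

Lemma rV_ballP m (x y : 'rV[R]_m) (r : R) : 0 < r ->
  ball x r y <-> (forall i, `|x ord0 i - y ord0 i| < r).
Proof.
move=> r0; split => [[_ h] i|h]; first exact: h.
by split => // i j; rewrite (ord1 i); exact: h.
Qed.

Lemma measurable_ball_rV m (x : 'rV[R]_m) (r : R) : measurable (ball x r).
Proof.
have [r0|r0] := ltP 0 r; last first.
  rewrite (_ : ball x r = set0) //; apply/seteqP; split => // y [r1 _].
  by move: r1; rewrite ltNge r0.
rewrite (_ : ball x r = \bigcap_(i in [set: 'I_m])
  ((fun y : 'rV[R]_m => y ord0 i : measurableTypeR R) @^-1`
     [set t | `|x ord0 i - t| < r])).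
  apply: fin_bigcap_measurable => // i _.
  rewrite -[X in measurable X]setTI; apply: measurable_rV_coord => //.
  rewrite (_ : [set _ | _] = ball (x ord0 i) r) //; exact: measurable_ball.
apply/seteqP; split => [y /(rV_ballP _ _ r0) h i _|y h] /=; first exact: h.
by apply/rV_ballP => // i; exact: h.
Qed.

(** The balls with a rational centre and radius 1/(k+1) contained in U cover
    U, and there are countably many of them. *)
Lemma open_measurable_rV m (U : set 'rV[R]_m) : open U -> measurable U.
Proof.
move=> oU.
pose B (p : 'rV[rat]_m * nat) : set 'rV[R]_m :=
  ball (map_mx (@ratr R) p.1) (p.2.+1%:R^-1).
rewrite (_ : U = \bigcup_(p in [set p | B p `<=` U]) B p).
  rewrite bigcup_mkcond; apply: countable_bigcupT_measurable => [|p].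
    exact: countableP.
  by case: ifP => // _; exact: measurable_ball_rV.
apply/seteqP; split => [x Ux|x [p /= h]]; last exact: h.
have /nbhs_ballP[e /= e0 xe] : nbhs x U by exact: open_nbhs_nbhs.
have [k _ hk] : exists2 k : nat, True & 2 * k.+1%:R^-1 < e.
  exists (Num.truncn (2 / e)) => //.
  rewrite ltr_pdivrMr ?ltr0n// mulrC -ltr_pdivrMr//.
  exact: truncnS_gt.
have k0 : 0 < k.+1%:R^-1 :> R by rewrite invr_gt0.
have /choice[q hq] : forall i, exists q : rat,
    `|x ord0 i - ratr q| < k.+1%:R^-1.
  move=> i; have : x ord0 i - k.+1%:R^-1 < x ord0 i + k.+1%:R^-1 by rewrite ltrBlDr -addrA ltrDl addr_gt0.
  move=> /rat_in_itvoo[q]; rewrite in_itv/= => /andP[h1 h2].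
  by exists q; rewrite distrC ltr_distl h1.
have hx : B (\row_i q i, k) x.
  by apply/rV_ballP => // i; rewrite !mxE distrC; exact: hq.
exists (\row_i q i, k) => //= y By; apply: xe.
apply: (@le_ball _ _ _ (k.+1%:R^-1 + k.+1%:R^-1)); last first.
  exact: ball_triangle (ball_sym hx) By.
by apply: ltW; move: hk; rewrite mulr_natl mulr2n.
Qed.

Lemma closed_measurable_rV m (U : set 'rV[R]_m) : closed U -> measurable U.
Proof.
move=> cU; rewrite -(setCK U); apply: measurableC; apply: open_measurable_rV.
exact: closed_openC.
Qed.

Lemma compact_measurable_rV m (K : set 'rV[R]_m) : compact K -> measurable K.
Proof.
move=> cK; apply: closed_measurable_rV; exact: compact_closed.
Qed.

Lemma continuous_measurable_rV m (h : 'rV[R]_m -> R) (D : set 'rV[R]_m) :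
  continuous h -> measurable D -> measurable_fun D h.
Proof.
move=> ch mD; apply: (measurable_funS measurableT) => //.
apply: (measurability _ (RGenOInfty.measurableE R)) => /=.
move=> _ [_ [a ->] <-]; rewrite setTI; apply: open_measurable_rV.
move/continuousP : ch; apply; exact: interval_open.
Qed.

End measurability.

(** * Translations, cubes and products for the Lebesgue measure *)

Section lebesgue_rV_theory.
Context {R : realType}.
Local Notation mu m := (lebesgue_rV R m).

Lemma lebesgue_measure_addr (a : R) (A : set (measurableTypeR R)) :
  measurable A -> lebesgue_measure ((fun x => x + a) @^-1` A) = lebesgue_measure A.
Proof.
move=> mA.
have mf : measurable_fun setT
  ((fun x => x + a) : measurableTypeR R -> measurableTypeR R).
  exact: measurable_funD.
pose nu := measure_function_pushforward__canonical__measure_function_Measure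
  (@lebesgue_measure R) mf.
apply/esym/(@lebesgue_measure_unique R nu) => // _ [[x y] /= _ <-].
rewrite /nu /pushforward /=.
rewrite (_ : _ @^-1` _ = `]x - a, y - a]%classic); last first.
  by apply/seteqP; split => z /=; rewrite !in_itv/= ltrBlDr lerBrDr.
rewrite !lebesgue_measure_itv/= !lte_fin ltrD2r.
case: ifP => // _; rewrite -!EFinB; congr (_%:E); ring.
Qed.

Lemma lebesgue_rVS n (A : set 'rV[R]_n.+1) :
  mu n.+1 A = (\int[mu n]_x lebesgue_measure
    ((fun y => join_xy x y) @^-1` A))%E.
Proof.
rewrite /= /pushforward /= /product_measure1; apply: eq_integral => x _ /=.
by congr (lebesgue_measure _); apply/seteqP; split => y; rewrite /xsection/= inE.
Qed.

(** By induction on the dimension: translate the last coordinate inside each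
    slice, then the base. *)
Lemma lebesgue_rV_addr m (a : 'rV[R]_m) (A : set 'rV[R]_m) :
  measurable A -> mu m ((fun x => x + a) @^-1` A) = mu m A.
Proof.
elim: m a A => [|n IH] a A mA.
  by congr (mu 0 _); apply/seteqP; split => x /=; rewrite (thinmx0 a) addr0.
rewrite !lebesgue_rVS.
pose F (x : 'rV[R]_n) := lebesgue_measure ((fun y => join_xy x y) @^-1` A).
have mj := @measurable_join_xy R n.
have mF : measurable_fun setT F.
  have mA' : measurable ((fun p : 'rV[R]_n * measurableTypeR R =>
      join_xy p.1 p.2) @^-1` A) by rewrite -[X in measurable X]setTI; exact: mj.
  have := @measurable_fun_xsection _ _ _ _ _ (@lebesgue_measure R) _ mA'.
  apply: eq_measurable_fun => x _; rewrite /F/=; congr (lebesgue_measure _).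
  by apply/seteqP; split => y; rewrite /xsection/= inE.
transitivity (\int[mu n]_x F (x + xpart a)%R)%E.
  apply: eq_integral => x _; rewrite /F.
  rewrite -[RHS](@lebesgue_measure_addr (ypart a)); last first.
    rewrite -[X in measurable X]setTI.
    have -> : (fun y => join_xy (x + xpart a) y) =
      (fun p : 'rV[R]_n * measurableTypeR R => join_xy p.1 p.2) \o
      (fun y => (x + xpart a, y)) by [].
    by apply: measurableT_comp => //; exact: measurable_pair1.
  congr (lebesgue_measure _); apply/seteqP; split => y /=.
    rewrite (_ : join_xy x y + a = join_xy (x + xpart a) (y + ypart a)) //.
    by apply/rowP => i; rewrite !mxE; case: unliftP => [j|] ->; rewrite ?mxE.
  rewrite (_ : join_xy x y + a = join_xy (x + xpart a) (y + ypart a)) //.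
  by apply/rowP => i; rewrite !mxE; case: unliftP => [j|] ->; rewrite ?mxE.
have mT := measurable_addr_rV (xpart a).
transitivity (\int[pushforward (mu n) (fun x : 'rV[R]_n => (x + xpart a)%R)]_x
   F x)%E.
  by rewrite [RHS]ge0_integral_pushforward.
by apply: eq_measure_integral => B mB _; exact: IH.
Qed.

Lemma xpartK n (x : 'rV[R]_n) (y : R) : xpart (join_xy x y) = x.
Proof. by apply/rowP => i; rewrite !mxE liftK. Qed.

Lemma ypartK n (x : 'rV[R]_n) (y : R) : ypart (join_xy x y) = y.
Proof. by rewrite /ypart mxE unlift_none. Qed.

Lemma lebesgue_rV_prod n (A : set 'rV[R]_n) (B : set (measurableTypeR R)) :
  measurable A -> measurable B ->
  mu n.+1 [set z | A (xpart z) /\ B (ypart z)] = (mu n A * lebesgue_measure B)%E.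
Proof.
move=> mA mB; rewrite -product_measure1E//=.
rewrite /pushforward; congr (product_measure1 _ _ _).
by apply/seteqP; split => -[x y] /=; rewrite xpartK ypartK.
Qed.

Definition cube m (r : R) : set 'rV[R]_m := [set x | forall i, `|x ord0 i| <= r].
Arguments cube : clear implicits.

Lemma closed_cube m r : closed (cube m r).
Proof.
rewrite (_ : cube m r = \bigcap_(i in setT)
  ((fun x : 'rV[R]_m => x ord0 i) @^-1` [set t | `|t| <= r])).
  apply: closed_bigI => i _.
  apply: (preimage_closed (f := fun x : 'rV[R]_m => x ord0 i)).
    by move=> x _; exact: coord_continuous.
  by apply: (preimage_closed (D := [set t | t <= r]));
    [move=> x _; exact: norm_continuous|exact: closed_le].
by apply/seteqP; split => [x h i _|x h i]; [exact: h|exact: (h i)].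
Qed.

Lemma lebesgue_rV_cube m (r : R) : (mu m (cube m r) < +oo)%E.
Proof.
elim: m => [|n IH].
  by apply: le_lt_trans (ltry 1); rewrite /= diracE; case: (_ \in _);
    rewrite ?lee_fin.
rewrite (_ : cube n.+1 r = [set z : 'rV[R]_n.+1 |
    cube n r (xpart z) /\ `[-r, r]%classic (ypart z)]).
  rewrite lebesgue_rV_prod//; last by apply: closed_measurable_rV; exact: closed_cube.
  apply: lte_mul_pinfty => //; first by rewrite ge0_fin_numE.
  by rewrite lebesgue_measure_itv/=; case: ifP => // _; rewrite -EFinB ltry.
apply/seteqP; split => z /=.
  move=> h; split; first by move=> i; rewrite mxE.
  by rewrite in_itv/= -ler_norml; exact: h.
rewrite in_itv/= -ler_norml => -[h1 h2] i.
case: (unliftP ord_max i) => [j|] -> //.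
by have := h1 j; rewrite mxE.
Qed.

Lemma mx_norm_le_coord m (x : 'rV[R]_m) i : `|x ord0 i| <= `|x|.
Proof.
have /mapP[j Hj Hij] : `|x ord0 i| \in [seq `|x k.1 k.2| | k : 'I_1 * 'I_m].
  by apply/mapP; exists (ord0, i) => //=; rewrite mem_enum.
rewrite (_ : `|x| = mx_norm x)// mx_normrE Hij.
by apply/bigmax_geP; right => /=; exists j.
Qed.

Lemma bounded_lebesgue_rV m (A : set 'rV[R]_m) : bounded_set A ->
  measurable A -> (mu m A < +oo)%E.
Proof.
move=> [M [Mr h]] mA; apply: le_lt_trans (lebesgue_rV_cube m (M + 1)).
apply: le_measure; rewrite ?inE//.
  by apply: closed_measurable_rV; exact: closed_cube.
move=> x Ax i; apply: le_trans (mx_norm_le_coord _ _) _.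
by apply: h => //; rewrite ltrDl.
Qed.

(** The balls of integer radius exhaust the space. *)
Lemma sigma_finite_lebesgue_rV m : sigma_finite setT (mu m).
Proof.
exists (fun k => [set x : 'rV[R]_m | `|x| <= k%:R]).
  apply/esym/seteqP; split => // x _; exists (Num.truncn `|x|).+1 => //=.
  by apply/ltW; exact: truncnS_gt.
move=> k; have mk : measurable [set x : 'rV[R]_m | `|x| <= k%:R].
  apply: closed_measurable_rV.
  apply: (preimage_closed (f := fun x : 'rV[R]_m => `|x|)
    (D := [set t | t <= k%:R]));
    [move=> x _; exact: norm_continuous|exact: closed_le].
split => //; apply: bounded_lebesgue_rV => //.
by exists k%:R; split => // y ky x /= h; apply: le_trans h (ltW ky).
Qed.

(** An alias that carries the sigma-finite structure on which Fubini's theorem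
    depends. *)
Definition leb m : set 'rV[R]_m -> \bar R := mu m.
Arguments leb : clear implicits.
HB.instance Definition _ m := Measure.on (leb m).
HB.instance Definition _ m := Measure_isSigmaFinite.Build _ _ _ (leb m)
  (sigma_finite_lebesgue_rV m).

Lemma integrable_addr m (a : 'rV[R]_m) (f : 'rV[R]_m -> \bar R) :
  (mu m).-integrable setT f ->
  (mu m).-integrable setT (fun x => f (x + a)).
Proof.
move=> /integrableP[mf fi]; apply/integrableP; split.
  exact: (measurableT_comp mf (measurable_addr_rV a)).
apply: le_lt_trans fi; rewrite le_eqVlt; apply/orP; left; apply/eqP.
have mT := measurable_addr_rV a.
transitivity (\int[pushforward (mu m) (fun x : 'rV[R]_m => (x + a)%R)]_x
   `|f x|)%E.
  rewrite [RHS]ge0_integral_pushforward//.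
  exact: measurableT_comp.
by apply: eq_measure_integral => B mB _; exact: lebesgue_rV_addr.
Qed.

Lemma Rintegral_addr m (a : 'rV[R]_m) (f : 'rV[R]_m -> R) :
  (mu m).-integrable setT (EFin \o f) ->
  \int_(x in setT) f (x + a) = \int_(x in setT) f x.
Proof.
move=> fi; congr fine.
have mT := measurable_addr_rV a.
transitivity (\int[pushforward (mu m) (fun x : 'rV[R]_m => (x + a)%R)]_x
   (EFin \o f) x)%E.
  rewrite [RHS]integral_pushforward//; first exact: measurable_int fi.
  exact: (integrable_addr _ fi).
by apply: eq_measure_integral => B mB _; exact: lebesgue_rV_addr.
Qed.

End lebesgue_rV_theory.
Arguments cube {R} m r. Arguments leb {R} m.

(** * Smooth functions and bumps *)

Section smooth_functions.
Context {R : realType}.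

Local Notation C m := (@diff_class R m (fun g : 'rV[R]_m -> R => continuous g)).

Section closure.
Variable m : nat.
Implicit Types h : 'rV[R]_m -> R.

Lemma diff_class_mono k h : C m k.+1 h -> C m k h.
Proof.
elim: k h => [|k IH] h /= [ch dh sh] //.
by split => // i; exact: IH.
Qed.

Lemma diff_class_cst k (c : R) : C m k (fun=> c).
Proof.
elim: k c => [|k IH] c /=; first exact: cst_continuous.
split => [|i x|i]; first exact: cst_continuous.
  exact: derivable_cst.
rewrite (_ : partial i _ = fun=> 0) //.
by apply/funext => x; exact: derive_cst.
Qed.

Lemma diff_classD k h1 h2 : C m k h1 -> C m k h2 ->
  C m k (fun x => h1 x + h2 x).
Proof.
elim: k h1 h2 => [|k IH] h1 h2 /=.
  by move=> c1 c2 x; exact: (cvgD (c1 x) (c2 x)).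
move=> [c1 d1 s1] [c2 d2 s2]; split => [x|i x|i].
- by exact: (cvgD (c1 x) (c2 x)).
- by apply: derivableD; [exact: d1|exact: d2].
- rewrite (_ : partial i _ = fun x => partial i h1 x + partial i h2 x).
    by apply: IH; [exact: s1|exact: s2].
  by apply/funext => x; apply: deriveD; [exact: d1|exact: d2].
Qed.

Lemma diff_classM k h1 h2 : C m k h1 -> C m k h2 ->
  C m k (fun x => h1 x * h2 x).
Proof.
elim: k h1 h2 => [|k IH] h1 h2 /=.
  by move=> c1 c2 x; exact: (cvgM (c1 x) (c2 x)).
move=> H1 H2; have M1 := diff_class_mono H1; have M2 := diff_class_mono H2.
move: H1 H2 => /= [c1 d1 s1] [c2 d2 s2]; split => [x|i x|i].
- by exact: (cvgM (c1 x) (c2 x)).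
- by apply: derivableM; [exact: d1|exact: d2].
- rewrite (_ : partial i _ =
      fun x => h1 x * partial i h2 x + h2 x * partial i h1 x).
    by apply: diff_classD; exact: IH.
  by apply/funext => x; apply: deriveM; [exact: d1|exact: d2].
Qed.

Lemma smoothP h : smooth h <->
  [/\ continuous h, forall i x, derivable (h : _ -> R^o) x (unit_vec R i) &
      forall i, smooth (partial i h)].
Proof.
split => [sh|[ch dh sh] [|k]] //.
  split; [exact: (sh 0)|by case: (sh 1)|by move=> i k; have [_ _ s] := sh k.+1; exact: s].
by split => // i; exact: sh.
Qed.

Lemma smooth_continuous h : smooth h -> continuous h.
Proof. by case/smoothP. Qed.

Lemma smooth_derivable h i x : smooth h -> derivable h x (unit_vec R i).
Proof. by case/smoothP => _ dh _; have := dh i x. Qed.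

Lemma smooth_partial h i : smooth h -> smooth (partial i h).
Proof. by case/smoothP. Qed.

Lemma smooth_cst (c : R) : smooth (fun _ : 'rV[R]_m => c).
Proof. by move=> k; exact: diff_class_cst. Qed.

Lemma smoothD h1 h2 : smooth h1 -> smooth h2 -> smooth (fun x => h1 x + h2 x).
Proof. by move=> s1 s2 k; exact: diff_classD. Qed.

Lemma smoothM h1 h2 : smooth h1 -> smooth h2 -> smooth (fun x => h1 x * h2 x).
Proof. by move=> s1 s2 k; exact: diff_classM. Qed.

Lemma smooth_sum I (r : seq I) (F : I -> 'rV[R]_m -> R) :
  (forall i, smooth (F i)) -> smooth (fun x => \sum_(i <- r) F i x).
Proof.
move=> sF; elim: r => [|i r IH].
  rewrite (_ : (fun _ => _) = fun=> 0); first exact: smooth_cst.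
  by apply/funext => x; rewrite big_nil.
rewrite (_ : (fun _ => _) = fun x => F i x + \sum_(i <- r) F i x).
  exact: smoothD.
by apply/funext => x; rewrite big_cons.
Qed.

Lemma smooth_prod I (r : seq I) (F : I -> 'rV[R]_m -> R) :
  (forall i, smooth (F i)) -> smooth (fun x => \prod_(i <- r) F i x).
Proof.
move=> sF; elim: r => [|i r IH].
  rewrite (_ : (fun _ => _) = fun=> 1); first exact: smooth_cst.
  by apply/funext => x; rewrite big_nil.
rewrite (_ : (fun _ => _) = fun x => F i x * \prod_(i <- r) F i x).
  exact: smoothM.
by apply/funext => x; rewrite big_cons.
Qed.

Lemma partialD i h1 h2 x : smooth h1 -> smooth h2 ->
  partial i (fun x => h1 x + h2 x) x = partial i h1 x + partial i h2 x.
Proof. by move=> s1 s2; apply: deriveD; exact: smooth_derivable. Qed.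

Lemma partialM i h1 h2 x : smooth h1 -> smooth h2 ->
  partial i (fun x => h1 x * h2 x) x =
  h1 x * partial i h2 x + h2 x * partial i h1 x.
Proof. by move=> s1 s2; apply: deriveM; exact: smooth_derivable. Qed.

End closure.

(** For s > 0 this is p(1/s) e^{-1/s}. The polynomial factor makes the family
    stable under differentiation, whence smoothness by induction on the order.
    *)
Definition flat (p : {poly R}) (s : R) : R :=
  if 0 < s then p.[s^-1] * expR (- s^-1) else 0.

(** The exponential e^x dominates x^{i+2} / (i+2)!, so each monomial of p(1/s)
    costs at most a multiple of s^2. The square makes the extension by 0
    differentiable at s = 0. *)
Lemma flat_le (p : {poly R}) : exists2 M : R, 0 <= M &
  forall s, `|flat p s| <= M * s ^+ 2.
Proof.
exists (\sum_(i < size p) `|p`_i| * (i.+2)`!%:R).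
  by apply: sumr_ge0 => i _; rewrite mulr_ge0.
move=> s; rewrite /flat; case: ifPn => [s0|_]; last first.
  rewrite normr0 mulr_ge0 ?sqr_ge0//.
  by apply: sumr_ge0 => i _; rewrite mulr_ge0.
set x := s^-1; have x0 : 0 < x by rewrite invr_gt0.
rewrite -ler_pdivrMr ?exprn_gt0// -exprVn -/x.
rewrite normrM (ger0_norm (expR_ge0 _)) expRN mulrAC ler_pdivrMr ?expR_gt0//.
rewrite horner_coef mulr_suml.
apply: le_trans (ler_wpM2r _ (ler_norm_sum _ _ _)) _; first by rewrite exprn_ge0// ltW.
rewrite !mulr_suml; apply: ler_sum => i _.
rewrite normrM (ger0_norm (exprn_ge0 _ (ltW x0))) -!mulrA ler_wpM2l//.
rewrite -exprD addn2.
rewrite -ler_pdivrMl ?ltr0n ?fact_gt0// mulrC.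
by apply: le_trans (expR_ge1Dxn i.+1 (ltW x0)); rewrite lerDr.
Qed.

Lemma is_derive_flat (p : {poly R}) (s : R) :
  is_derive s 1 (flat p) (flat ('X^2 * (p - p^`())) s).
Proof.
have [s0|s0|->] := ltgtP s 0.
- rewrite [X in is_derive _ _ _ X]/flat ltNge (ltW s0)/=.
  apply: (@near_eq_is_derive _ _ _ (cst 0)).
    near=> t; rewrite /flat ifF//.
    by apply/negbTE; rewrite -leNgt ltW//; near: t; exact: lt_nbhsl.
- apply: (@near_eq_is_derive R R R (fun t => p.[t^-1] * expR (- t^-1))).
    by near=> t; rewrite /flat ifT//; near: t; exact: lt_nbhsr.
  have sn0 : s != 0 by rewrite gt_eqF.
  have dV : is_derive s 1 (fun t : R => t^-1) (- s ^- 2).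
    apply: DeriveDef; first exact: derivableV.
    by rewrite deriveV// derive_id [_ *: _]mulr1.
  have d1 : is_derive s 1 (fun t : R => p.[t^-1]) (p^`().[s^-1] * - s ^- 2).
    exact: (is_derive1_comp (f := horner p) (g := fun t : R => t^-1)).
  have d2 : is_derive s 1 (fun t : R => expR (- t^-1))
      (expR (- s^-1) * s ^- 2).
    rewrite -[s ^- 2]opprK.
    apply: (is_derive1_comp (f := expR) (g := fun t : R => - t^-1)).
  apply: (@is_derive_eq R R R _ _ _ _ _ (is_deriveM d1 d2)).
  rewrite {1}/flat s0 !hornerE /= -!exprVn /GRing.scale/=.
  ring.
- rewrite /flat ltxx.
  have [M M0 hM] := flat_le p.
  have h : (fun h => h^-1 *: ((flat p \o shift 0) (h *: 1) - flat p 0 ))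
      @ 0^' --> (0 : R).
    rewrite (_ : (fun _ => _) = fun h => h^-1 * flat p h); last first.
      apply/funext => h /=; rewrite /flat ltxx subr0 addr0.
      by rewrite /GRing.scale/= mulr1.
    apply: norm_cvg0; apply: (@squeeze_cvgr _ _ _ _ (cst 0) (fun h => M * `|h|)).
    + near=> h; rewrite /= normr_ge0/= normrM normfV.
      have h0 : h != 0 by near: h; exact: nbhs_dnbhs_neq.
      rewrite mulrC ler_pdivrMr ?normr_gt0// -mulrA -expr2 -normrX.
      by rewrite (ger0_norm (sqr_ge0 _)).
    + exact: cvg_cst.
    + rewrite -[X in _ --> X](mulr0 M); apply: cvgM; first exact: cvg_cst.
      rewrite -[X in _ --> X](@normr0 R R).
      by apply: cvg_norm; apply: nbhs_dnbhs.
  by apply: DeriveDef; [apply/cvg_ex; exists 0|exact: cvg_lim h].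
Unshelve. all: by end_near. Qed.

(** A directional derivative is the derivative along a line, which gives
    access to the one-variable calculus. *)
Lemma is_derive_line m (g : 'rV[R]_m -> R) (x v : 'rV[R]_m) (s d : R) :
  is_derive s 1 (fun t : R => g (x + t *: v)) d <->
  is_derive (x + s *: v) v g d.
Proof.
have E : (fun h : R => h^-1 *: ((g \o shift (x + s *: v)) (h *: v) - g (x + s *: v))) =
  (fun h : R => h^-1 *: (((fun t : R => g (x + t *: v)) \o shift s) (h *: 1)
     - g (x + s *: v))).
  apply/funext => h /=; congr (_ *: (g _ - _)).
  by rewrite [_ *: 1]mulr1 scalerDl addrCA.
split => -[dg <-]; apply: DeriveDef.
- by rewrite /derivable E.
- by rewrite /derive E.
- by rewrite /derivable -E.
- by rewrite /derive -E.
Qed.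

Lemma is_derive_partial m (h : 'rV[R]_m -> R) i x (s : R) : smooth h ->
  is_derive s 1 (fun t : R => h (x + t *: unit_vec R i))
    (partial i h (x + s *: unit_vec R i)).
Proof.
move=> sh; apply/is_derive_line; apply: DeriveDef; last by [].
exact: smooth_derivable.
Qed.

Let shift_quotient m (h : 'rV[R]_m -> R) (v a x : 'rV[R]_m) :
  (fun t : R => t^-1 *: (((fun x => h (x + a)) \o shift x) (t *: v) - h (x + a))) =
  (fun t : R => t^-1 *: ((h \o shift (x + a)) (t *: v) - h (x + a))).
Proof. by apply/funext => t /=; rewrite addrA. Qed.

Lemma partial_addr m (h : 'rV[R]_m -> R) i (a : 'rV[R]_m) :
  partial i (fun x => h (x + a)) = fun x => partial i h (x + a).
Proof.
apply/funext => x; have E := shift_quotient h (unit_vec R i) a x.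
by rewrite /partial /derive; rewrite -E.
Qed.

Lemma derivable_addr m (h : 'rV[R]_m -> R) (v a x : 'rV[R]_m) :
  derivable h (x + a) v -> derivable (fun x => h (x + a)) x v.
Proof. by rewrite /derivable -shift_quotient. Qed.

Lemma smooth_addr m (h : 'rV[R]_m -> R) (a : 'rV[R]_m) : smooth h -> smooth (fun x => h (x + a)).
Proof.
have ca (g : 'rV[R]_m -> R) : continuous g -> continuous (fun x : 'rV[R]_m => g (x + a)).
  move=> cg x; apply: (@continuous_comp _ _ _ (fun x : 'rV[R]_m => x + a) g); last exact: cg.
  by apply: continuousD; [exact: cvg_id|exact: cst_continuous].
move=> + k; elim: k h => [|k IH] h /smoothP[ch dh sh] /=; first exact: ca.
split => [|i x|i]; first exact: ca.
  exact: derivable_addr.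
by rewrite partial_addr; exact: IH.
Qed.

(** Composing with affine functions of one coordinate, of either orientation,
    yields the factors of bumps, the approximations of half-spaces and the
    vertical cutoff. *)
Lemma is_derive_flat_coord m (i : 'I_m) (a b : R) (q : {poly R}) (j : 'I_m)
    (x : 'rV[R]_m) :
  is_derive x (unit_vec R j) (fun x : 'rV[R]_m => flat q (a * x ord0 i + b))
    ((a *+ (i == j)) * flat ('X^2 * (q - q^`())) (a * x ord0 i + b)).
Proof.
suff : is_derive (x + 0 *: unit_vec R j) (unit_vec R j)
  (fun x : 'rV[R]_m => flat q (a * x ord0 i + b))
  ((a *+ (i == j)) * flat ('X^2 * (q - q^`())) (a * x ord0 i + b)).
  by rewrite scale0r addr0.
apply/is_derive_line.
rewrite (_ : (fun _ => _) = flat q \o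
  (fun t : R => (a *+ (i == j)) * t + (a * x ord0 i + b))); last first.
  apply/funext => t /=; congr flat; rewrite !mxE eqxx/= eq_sym.
  by case: (j == i); rewrite ?mulr1n ?mulr0n/=; ring.
have d1 : is_derive (0 : R) 1
    (fun t : R => (a *+ (i == j)) * t + (a * x ord0 i + b)) (a *+ (i == j)).
  rewrite (_ : (fun _ => _) =
    (a *+ (i == j)) \*: id + cst (a * x ord0 i + b)) //.
  by apply: is_derive_eq; rewrite addr0 [_ *: _]mulr1.
have d2 : is_derive ((a *+ (i == j)) * 0 + (a * x ord0 i + b) : R) 1 (flat q)
    (flat ('X^2 * (q - q^`())) (a * x ord0 i + b)).
  by rewrite mulr0 add0r; exact: is_derive_flat.
rewrite [X in is_derive _ _ _ X]mulrC.
exact: (is_derive1_comp (f := flat q) (g := fun t : R =>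
  a *+ (i == j) * t + (a * x ord0 i + b)) d2 d1).
Qed.

Lemma smooth_flat_coord m (i : 'I_m) (a b : R) (p : {poly R}) :
  smooth (fun x : 'rV[R]_m => flat p (a * x ord0 i + b)).
Proof.
have cg q : continuous (fun x : 'rV[R]_m => flat q (a * x ord0 i + b)).
  move=> x; apply: (@continuous_comp _ _ _ (fun x : 'rV[R]_m => a * x ord0 i + b)).
    apply: continuousD; last exact: cst_continuous.
    by apply: continuousM; [exact: cst_continuous|exact: coord_continuous].
  apply: differentiable_continuous; apply/derivable1_diffP.
  by have [] := is_derive_flat q (a * x ord0 i + b).
move=> k; elim: k p => [|k IH] p /=; first exact: cg.
split => [|j x|j]; first exact: cg.
  by have [] := is_derive_flat_coord i a b p j x.
rewrite (_ : partial j _ = fun x => (a *+ (i == j)) *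
    flat ('X^2 * (p - p^`())) (a * x ord0 i + b)).
  by apply: diff_classM; [exact: diff_class_cst|exact: IH].
by apply/funext => x; have [_ <-] := is_derive_flat_coord i a b p j x.
Qed.

Lemma flat1_itv (s : R) : 0 <= flat 1 s <= 1.
Proof.
rewrite /flat; case: ifPn => s0; last by rewrite lexx ler01.
by rewrite hornerC mul1r expR_ge0/= expR_le1 oppr_le0 invr_ge0 ltW.
Qed.

Lemma flat1_gt0 (s : R) : 0 < s -> 0 < flat 1 s.
Proof. by move=> s0; rewrite /flat s0 hornerC mul1r expR_gt0. Qed.

Lemma flat1_le0 (s : R) : s <= 0 -> flat 1 s = 0.
Proof. by rewrite /flat ltNge => ->. Qed.

(** The balls of the norm are cubes, so a product over the coordinates of
    one-dimensional bumps is positive exactly on one of them. *)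
Lemma smooth_bump m (x0 : 'rV[R]_m) (r : R) : 0 < r ->
  exists b, [/\ smooth b, forall x, 0 <= b x,
    forall x, ball x0 r x -> 0 < b x & forall x, ~ ball x0 r x -> b x = 0].
Proof.
move=> r0; exists (fun x => \prod_i (flat 1 (1 * x ord0 i + (r - x0 ord0 i)) *
  flat 1 (-1 * x ord0 i + (x0 ord0 i + r)))).
split => [|x|x /rV_ballP h|x].
- by apply: smooth_prod => i; apply: smoothM; exact: smooth_flat_coord.
- apply: prodr_ge0 => i _; apply: mulr_ge0.
    by have /andP[] := flat1_itv (1 * x ord0 i + (r - x0 ord0 i)).
  by have /andP[] := flat1_itv (-1 * x ord0 i + (x0 ord0 i + r)).
- apply: prodr_gt0 => i _; have := h r0 i; rewrite ltr_norml => /andP[h1 h2].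
  by apply: mulr_gt0; apply: flat1_gt0; lra.
- move=> nb; have [i hi] : exists i, r <= `|x0 ord0 i - x ord0 i|.
    apply: contra_notP nb => /forallNP nb; apply/rV_ballP => // i.
    by rewrite ltNge; apply/negP/nb.
  rewrite (bigD1 i)//=.
  have [h|h] := leP r (x0 ord0 i - x ord0 i).
    by rewrite flat1_le0 ?mul0r//; lra.
  rewrite [X in _ * X * _]flat1_le0 ?mulr0 ?mul0r//.
  by move: hi; rewrite ler_normr leNgt h/=; lra.
Qed.

End smooth_functions.

(** * Compact sets and their neighbourhoods *)

Section compact_supports.
Context {R : realType} (m : nat).
Implicit Types (K U : set 'rV[R]_m) (h : 'rV[R]_m -> R).

Lemma le_mx_norm (x : 'rV[R]_m) (r : R) : 0 <= r ->
  (forall i, `|x ord0 i| <= r) -> `|x| <= r.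
Proof.
move=> r0 h; rewrite (_ : `|x| = mx_norm x)// mx_normrE.
by apply/bigmax_leP; split => // -[i j] _ /=; rewrite (ord1 i).
Qed.

(** By compactness the distance from K to the complement of U has a positive
    lower bound 2d; K' is the sum of K and the closed ball of radius d. *)
Lemma compact_thickening K U : compact K -> open U -> K `<=` U ->
  exists2 d : R, 0 < d & exists K', [/\ compact K', K' `<=` U &
    forall x y, K x -> `|y| <= d -> K' (x + y)].
Proof.
move=> cK oU KU.
have /compact_near_coveringP nc := cK.
have [e /= e0 he] : \forall e \near (0 : R), K `<=` (fun x =>
    forall y, `|y| <= e -> U (x + y)).
  apply: (nc R (nbhs (0 : R))
    (fun e x => forall y, `|y| <= e -> U (x + y)) _) => x Kx.
  have /nbhs_ballP[r /= r0 xr] : nbhs x U by apply: open_nbhs_nbhs; split; [|exact: KU].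
  exists (ball x (r / 2), ball 0 (r / 2)) => /=.
    by split; apply/nbhs_ballP; exists (r / 2) => //=; exact: divr_gt0.
  move=> [z t] /= [xz zt] y yt; apply: xr.
  rewrite [r]splitr; apply: ball_triangle xz _.
  apply/rV_ballP; first exact: divr_gt0.
  move=> i; rewrite mxE opprD addrA subrr sub0r normrN.
  apply: le_lt_trans (mx_norm_le_coord _ _) _; apply: le_lt_trans yt _.
  by move: zt; rewrite /ball/= sub0r normrN; apply: le_lt_trans; exact: ler_norm.
exists (e / 2); first exact: divr_gt0.
have he2 : K `<=` (fun x => forall y, `|y| <= e / 2 -> U (x + y)).
  apply: he => /=; rewrite sub0r normrN ger0_norm ?ltW ?divr_gt0//.
  by rewrite ltr_pdivrMr// mulr_natr mulr2n ltrDl.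
pose B := [set y : 'rV[R]_m | `|y| <= e / 2].
have cB : compact B.
  apply: bounded_closed_compact.
    exists (e / 2); split; first exact: num_real.
    by move=> y ey x /= h; apply: le_trans h (ltW ey).
  apply: (preimage_closed (f := fun x : 'rV[R]_m => `|x|)
    (D := [set t | t <= e / 2]));
    [move=> x _; exact: norm_continuous|exact: closed_le].
exists ((fun p : 'rV[R]_m * 'rV[R]_m => p.1 + p.2) @` (K `*` B)); split.
- apply: continuous_compact; last exact: compact_setX.
  by apply: continuous_subspaceT => p; exact: add_continuous.
- by move=> _ [[x y] /= [Kx By] <-]; exact: he2.
- by move=> x y Kx By; exists (x, y).
Qed.

Lemma compact_support_bounded h K : compact K -> continuous h ->
  (forall x, ~ K x -> h x = 0) -> exists2 M : R, 0 <= M & forall x, `|h x| <= M.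
Proof.
move=> cK ch hK.
have /compact_bounded[M [_ hM]] : compact (h @` K).
  by apply: continuous_compact => //; exact: continuous_subspaceT.
exists (`|M| + 1) => [|x]; first by rewrite addr_ge0.
have [Kx|/hK ->] := pselect (K x); last by rewrite normr0 addr_ge0.
apply: hM; first by rewrite (le_lt_trans (ler_norm _))// ltrDl.
by exists x.
Qed.

(** Finitely many bumps cover K; their sum has a positive minimum on K, by
    which it is divided. *)
Lemma smooth_above_compact K (d : R) : compact K -> 0 < d ->
  exists e, [/\ smooth e, forall x, 0 <= e x, forall x, K x -> 1 <= e x &
    forall x, e x != 0 -> exists2 x0, K x0 & `|x - x0| <= d].
Proof.
move=> cK d0.
have [K0|/set0P K0] := eqVneq K set0.
  exists (fun=> 0); split => //; [exact: smooth_cst|by rewrite K0|].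
  by move=> x; rewrite eqxx.
have /choice[b hb] : forall x0 : 'rV[R]_m, exists b : 'rV[R]_m -> R,
    [/\ smooth b, forall x, 0 <= b x, forall x, ball x0 d x -> 0 < b x &
    forall x, ~ ball x0 d x -> b x = 0].
  by move=> x0; exact: smooth_bump.
move: (cK); rewrite compact_cover => /(_ _ K (fun x => ball x d)).
case=> [x _|x Kx|D DK KD]; first exact: ball_open.
  by exists x => //; exact: ballxx.
pose e0 x := \sum_(y <- finmap.enum_fset D) b y x.
have se0 : smooth e0 by apply: smooth_sum => y; have [] := hb y.
have e0_ge0 x : 0 <= e0 x by apply: sumr_ge0 => y _; have [_ + _ _] := hb y; exact.
have e0_gt0 x : K x -> 0 < e0 x.
  move=> /KD[y /= yD xy]; rewrite /e0 (big_rem y)//=.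
  apply: ltr_pwDl; first by have [_ _ + _] := hb y; apply.
  by apply: sumr_ge0 => z _; have [_ + _ _] := hb z; exact.
have [z zK hz] : exists2 c, c \in K & forall t, t \in K -> e0 c <= e0 t.
  apply: EVT_min_rV => //; apply: continuous_subspaceT.
  exact: smooth_continuous.
rewrite inE in zK.
exists (fun x => (e0 z)^-1 * e0 x); split.
- by apply: smoothM => //; exact: smooth_cst.
- by move=> x; rewrite mulr_ge0// invr_ge0.
- move=> x Kx; rewrite mulrC ler_pdivlMr ?e0_gt0// mul1r.
  by apply: hz; rewrite inE.
- move=> x; rewrite mulf_eq0 negb_or => /andP[_].
  apply: contra_neqP => /forall2NP nx; rewrite /e0 big1_seq// => y /andP[_ yD].
  have [_ _ _] := hb y; apply => xy.
  have [] := nx y; first by apply; have := DK _ yD; rewrite inE.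
  apply; apply: le_mx_norm; first exact: ltW.
  by move: xy => /(rV_ballP _ _ d0) xy i; rewrite !mxE distrC ltW.
Qed.

End compact_supports.

(** * Real-valued integrals *)

Section real_integrals.
Context d (T : measurableType d) (R : realType) (mu : {measure set T -> \bar R}).
Implicit Types (D : set T) (f g : T -> R).

Lemma integrable_le D f g : measurable D -> measurable_fun D f ->
  (forall x, D x -> `|f x| <= g x) ->
  mu.-integrable D (EFin \o g) -> mu.-integrable D (EFin \o f).
Proof.
move=> mD mf fg; apply: le_integrable => //; first exact/measurable_EFinP.
by move=> x Dx; rewrite /= lee_fin (le_trans (fg _ Dx))// ler_norm.
Qed.

Lemma integrable_mfun D f : mu.-integrable D (EFin \o f) -> measurable_fun D f.
Proof. by move=> /integrableP[/measurable_EFinP]. Qed.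

Lemma integrable_bounded_mul D f g (M : R) : measurable D ->
  measurable_fun D g -> (forall x, D x -> `|g x| <= M) ->
  mu.-integrable D (EFin \o f) ->
  mu.-integrable D (EFin \o (fun x => f x * g x)).
Proof.
move=> mD mg gM fi; apply: (@integrable_le _ _ (fun x => M * `|f x|)) => //.
- by apply: measurable_funM => //; exact: integrable_mfun fi.
- by move=> x Dx; rewrite normrM mulrC ler_wpM2r// gM.
- rewrite (_ : _ \o _ = (fun x => M%:E * (abse \o (EFin \o f)) x)%E) //.
  by apply: integrableZl => //; exact: integrable_abse.
Qed.

Lemma integrable_norm D f : measurable D -> mu.-integrable D (EFin \o f) ->
  mu.-integrable D (EFin \o (fun x => `|f x|)).
Proof.
move=> mD fi; rewrite (_ : _ \o _ = abse \o (EFin \o f)) //.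
exact: integrable_abse.
Qed.

Lemma integrable_add D f g : measurable D -> mu.-integrable D (EFin \o f) ->
  mu.-integrable D (EFin \o g) ->
  mu.-integrable D (EFin \o (fun x => f x + g x)).
Proof. by move=> mD fi gi; exact: (integrableD mD fi gi). Qed.

Lemma integrable_sub D f g : measurable D -> mu.-integrable D (EFin \o f) ->
  mu.-integrable D (EFin \o g) ->
  mu.-integrable D (EFin \o (fun x => f x - g x)).
Proof. by move=> mD fi gi; exact: (integrableB mD fi gi). Qed.

Lemma integrable_scale D f (k : R) : measurable D ->
  mu.-integrable D (EFin \o f) ->
  mu.-integrable D (EFin \o (fun x => k * f x)).
Proof. by move=> mD fi; exact: (integrableZl mD k fi). Qed.

Lemma integrable_bounded D f (M : R) : measurable D -> (mu D < +oo)%E ->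
  measurable_fun D f -> (forall x, D x -> `|f x| <= M) ->
  mu.-integrable D (EFin \o f).
Proof.
move=> mD Doo mf fM; apply: measurable_bounded_integrable => //.
exists M; split; first exact: num_real.
by move=> y My x Dx; apply: le_trans (fM _ Dx) (ltW My).
Qed.

Lemma integrable_indic_finite D : measurable D -> (mu D < +oo)%E ->
  mu.-integrable setT (EFin \o (\1_D : T -> R)).
Proof.
move=> mD Doo; apply/integrableP; split.
  by apply/measurable_EFinP; exact: measurable_indic.
rewrite (eq_integral (fun x => (\1_D x)%:E)); last first.
  by move=> x _ /=; rewrite ger0_norm.
by rewrite integral_indic// setIT.
Qed.

Lemma Rintegral_dominated_cvg D (f_ : nat -> T -> R) f g : measurable D ->
  (forall n, measurable_fun D (f_ n)) ->
  (forall x, D x -> f_ n x @[n --> \oo] --> f x) ->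
  mu.-integrable D (EFin \o g) ->
  (forall n x, D x -> `|f_ n x| <= g x) ->
  \int[mu]_(x in D) f_ n x @[n --> \oo] --> \int[mu]_(x in D) f x.
Proof.
move=> mD mf ff gi fg.
have mlim : measurable_fun D f by apply: measurable_fun_cvg ff.
have [|||||fi _] := @dominated_convergence _ _ _ mu _ mD
  (fun n x => (f_ n x)%:E) (EFin \o f) (EFin \o g).
- by move=> n; exact/measurable_EFinP.
- exact/measurable_EFinP.
- by apply: aeW => x Dx; apply: cvg_EFin; [exact: nearW|exact: ff].
- exact: gi.
- by apply: aeW => x n Dx; rewrite lee_fin fg.
rewrite -(fineK (integrable_fin_num mD fi)) => /fine_cvgP[_ h].
exact: h.
Qed.

Lemma restrict_indic D f :
  (EFin \o f) \_ D = EFin \o (fun x => f x * \1_D x).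
Proof.
by apply/funext => x; rewrite patchE /= indicE;
  case: (_ \in _); rewrite ?mulr1 ?mulr0.
Qed.

Lemma integrable_mul_indic D f : measurable D ->
  mu.-integrable D (EFin \o f) <->
  mu.-integrable setT (EFin \o (fun x => f x * \1_D x)).
Proof.
by move=> mD; rewrite -restrict_indic; exact: integrable_mkcond.
Qed.

Lemma Rintegral_indic D f :
  \int[mu]_(x in D) f x = \int[mu]_x (f x * \1_D x).
Proof.
rewrite Rintegral_mkcond; apply: eq_Rintegral => x _; rewrite patchE indicE.
by case: (_ \in _); rewrite ?mulr1 ?mulr0.
Qed.

Lemma ge0_subset_Rintegral A B f : measurable A -> measurable B -> A `<=` B ->
  mu.-integrable B (EFin \o f) -> (forall x, B x -> 0 <= f x) ->
  \int[mu]_(x in A) f x <= \int[mu]_(x in B) f x.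
Proof.
move=> mA mB AB fi f0; apply: fine_le.
- by apply: integrable_fin_num => //; exact: integrableS fi.
- exact: integrable_fin_num.
- apply: ge0_subset_integral => //.
  by apply/measurable_EFinP; exact: integrable_mfun fi.
Qed.

End real_integrals.

(** * Smooth approximation of indicators *)

Section density.
Context {R : realType} (m : nat).
Local Notation mu := (lebesgue_rV R m).
Implicit Types (W : 'rV[R]_m -> R) (A : set 'rV[R]_m).

(** The weight W lets the integrand of the difference quotients below act as
    the measure in which A is approximated. *)
Definition smooth_approximable W A := measurable A /\
  forall e : R, 0 < e -> exists b, [/\ smooth b, forall x, 0 <= b x <= 1 &
    \int_(x in setT) (`|W x| * `|b x - \1_A x|) < e].

Lemma measurable_smooth (b : 'rV[R]_m -> R) D : smooth b -> measurable D ->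
  measurable_fun D b.
Proof.
by move=> sb mD; apply: continuous_measurable_rV => //; exact: smooth_continuous.
Qed.

Lemma indic_itv01 (A : set 'rV[R]_m) x : 0 <= (\1_A x : R) <= 1.
Proof. by rewrite indicE; case: (_ \in _); rewrite ?ler01 ?lexx. Qed.

Lemma smooth_approximableC W A : smooth_approximable W A ->
  smooth_approximable W (~` A).
Proof.
move=> [mA hA]; split; first exact: measurableC.
move=> e /hA[b [sb b01 he]]; exists (fun x => 1 + -1 * b x); split.
- apply: smoothD; first exact: smooth_cst.
  by apply: smoothM => //; exact: smooth_cst.
- by move=> x; have := b01 x; lra.
- rewrite (_ : (fun x => _) = fun x => `|W x| * `|b x - \1_A x|)//.
  apply/funext => x; congr (_ * _); rewrite !indicE in_setC -normrN.
  by congr `|_|; case: (x \in A) => /=; lra.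
Qed.

Lemma integrable_weighted W (g : 'rV[R]_m -> R) :
  mu.-integrable setT (EFin \o W) -> measurable_fun setT g ->
  (forall x, `|g x| <= 1) ->
  mu.-integrable setT (EFin \o (fun x => `|W x| * `|g x|)).
Proof.
move=> Wi mg g1; apply: (@integrable_bounded_mul _ _ _ _ _ _ _ 1) => //.
- exact: measurableT_comp.
- by move=> x _; rewrite normr_id.
- exact: integrable_norm.
Qed.

Lemma measurable_diff_indic (b : 'rV[R]_m -> R) A : smooth b -> measurable A ->
  measurable_fun setT (fun x => b x - \1_A x).
Proof.
by move=> sb mA; apply: measurable_funB;
  [exact: measurable_smooth|exact: measurable_indic].
Qed.

Lemma norm_diff_indic (b : R) A x : 0 <= b <= 1 -> `|b - \1_A x| <= 1.
Proof.
by move=> b01; have := indic_itv01 A x; rewrite ler_norml; lra.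
Qed.

(** The function a + b - ab approximates the indicator of a union. *)
Lemma smooth_approximableU W A B : mu.-integrable setT (EFin \o W) ->
  smooth_approximable W A -> smooth_approximable W B ->
  smooth_approximable W (A `|` B).
Proof.
move=> Wi [mA hA] [mB hB]; split; first exact: measurableU.
move=> e e0; have e20 : 0 < e / 2 by exact: divr_gt0.
have [a [sa a01 ha]] := hA _ e20; have [b [sb b01 hb]] := hB _ e20.
exists (fun x => (a x + b x) + -1 * (a x * b x)).
have s : smooth (fun x => (a x + b x) + -1 * (a x * b x)).
  apply: smoothD; first exact: smoothD.
  by apply: smoothM; [exact: smooth_cst|exact: smoothM].
have c01 x : 0 <= (a x + b x) + -1 * (a x * b x) <= 1.
  by have := a01 x; have := b01 x; nra.
split => //; rewrite [e]splitr; apply: le_lt_trans (ltrD ha hb).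
have mAB : measurable (A `|` B) by exact: measurableU.
have i1 := integrable_weighted Wi (measurable_diff_indic sa mA)
  (fun x => norm_diff_indic A x (a01 x)).
have i2 := integrable_weighted Wi (measurable_diff_indic sb mB)
  (fun x => norm_diff_indic B x (b01 x)).
rewrite -RintegralD//; apply: le_Rintegral => //.
- exact: integrable_weighted Wi (measurable_diff_indic s mAB)
    (fun x => norm_diff_indic _ x (c01 x)).
- exact: integrable_add.
move=> x _; rewrite -mulrDr ler_wpM2l//.
rewrite !indicE in_setU; have := a01 x; have := b01 x.
case: (x \in A); case: (x \in B) => /= b01x a01x.
- by rewrite ler_norml (ler0_norm (_ : a x - 1 <= 0)) ?(ler0_norm (_ : b x - 1 <= 0)); nra.
- by rewrite ler_norml (ler0_norm (_ : a x - 1 <= 0)) ?(ger0_norm (_ : 0 <= b x - 0)); nra.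
- by rewrite ler_norml (ger0_norm (_ : 0 <= a x - 0)) ?(ler0_norm (_ : b x - 1 <= 0)); nra.
- by rewrite ler_norml (ger0_norm (_ : 0 <= a x - 0)) ?(ger0_norm (_ : 0 <= b x - 0)); nra.
Qed.

Lemma smooth_approximable0 W : smooth_approximable W set0.
Proof.
split => // e e0; exists (fun=> 0); split; first exact: smooth_cst.
  by move=> _; rewrite lexx ler01.
rewrite (_ : (fun x => _) = fun=> 0); last first.
  by apply/funext => x; rewrite indic0 subr0 normr0 mulr0.
by rewrite Rintegral_cst// mul0r.
Qed.

(** By dominated convergence a finite union is already close to the countable
    one. *)
Lemma smooth_approximable_bigcup W (F : nat -> set 'rV[R]_m) :
  mu.-integrable setT (EFin \o W) ->
  (forall n, smooth_approximable W (F n)) ->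
  smooth_approximable W (\bigcup_n F n).
Proof.
move=> Wi hF; have mF : measurable (\bigcup_n F n).
  by apply: bigcup_measurable => n _; have [] := hF n.
split => // e e0; have e20 : 0 < e / 2 by exact: divr_gt0.
pose U n := \big[setU/set0]_(i < n) F i.
have hU n : smooth_approximable W (U n).
  elim: n => [|n IH]; rewrite /U; first by rewrite big_ord0; exact: smooth_approximable0.
  by rewrite big_ord_recr/=; apply: smooth_approximableU.
have hlim : \int_(x in setT) (`|W x| * `|\1_(U n) x - \1_(\bigcup_n F n) x|)
    @[n --> \oo] --> \int_(x in [set: 'rV[R]_m]) (0:R).
  apply: (@Rintegral_dominated_cvg _ _ _ _ _ _ _ (fun x => `|W x|)) => //.
  - move=> n; apply: measurable_funM.
      by apply: measurableT_comp => //; exact: integrable_mfun Wi.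
    apply: measurableT_comp => //; apply: measurable_funB;
      apply: measurable_indic => //.
    by have [] := hU n.
  - move=> x _; apply: cvg_near_cst.
    have [[k _ Fkx]|nF] := pselect ((\bigcup_n F n) x).
      exists k.+1 => // n /= kn; rewrite !indicE !mem_set.
      + by rewrite subrr normr0 mulr0.
      + by exists k.
      + by rewrite /U -bigcup_mkord; exists k.
    exists 0%N => // n _; rewrite !indicE !memNset ?subrr ?normr0 ?mulr0//.
    by apply: contra_not nF; rewrite /U -bigcup_mkord => -[k _ Fk]; exists k.
  - exact: integrable_norm.
  - move=> n x _; rewrite normrM !normr_id ler_piMr//.
    by apply: norm_diff_indic; exact: indic_itv01.
have [n hn] : exists n, \int_(x in setT)
    (`|W x| * `|\1_(U n) x - \1_(\bigcup_n F n) x|) < e / 2.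
  move: hlim; rewrite Rintegral_cst// mul0r => /cvgr0_norm_lt/(_ _ e20)[k _ hk].
  by exists k; apply: le_lt_trans (hk k _); [exact: ler_norm|rewrite /=].
have [mU /(_ _ e20)[b [sb b01 hb]]] := hU n.
exists b; split => //; rewrite [e]splitr; apply: le_lt_trans (ltrD hb hn).
have i1 := integrable_weighted Wi (measurable_diff_indic sb mU)
  (fun x => norm_diff_indic (U n) x (b01 x)).
have i2 : mu.-integrable setT
   (EFin \o (fun x => `|W x| * `|\1_(U n) x - \1_(\bigcup_n F n) x|)).
  apply: integrable_weighted => //.
    by apply: measurable_funB; exact: measurable_indic.
  by move=> x; apply: norm_diff_indic; exact: indic_itv01.
rewrite -RintegralD//; apply: le_Rintegral => //.
- exact: integrable_weighted Wi (measurable_diff_indic sb mF)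
    (fun x => norm_diff_indic _ x (b01 x)).
- exact: integrable_add.
by move=> x _; rewrite -mulrDr ler_wpM2l//; exact: ler_distD.
Qed.

(** The functions flat 1 (k (x_i - a)) increase to the indicator as k grows.
    *)
Lemma smooth_approximable_half_space W (i : 'I_m) (a : R) :
  mu.-integrable setT (EFin \o W) ->
  smooth_approximable W [set x : 'rV[R]_m | a < x ord0 i].
Proof.
move=> Wi; have mA : measurable [set x : 'rV[R]_m | a < x ord0 i].
  apply: open_measurable_rV.
  rewrite (_ : mkset _ = (fun x : 'rV[R]_m => x ord0 i) @^-1` [set t | a < t]) //.
  by apply: open_comp; [move=> x _; exact: coord_continuous|exact: open_gt].
split => // e e0.
pose b (k : nat) (x : 'rV[R]_m) := flat 1 (k%:R * x ord0 i + - (k%:R * a)).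
have sb k : smooth (b k) by exact: smooth_flat_coord.
have b01 k x : 0 <= b k x <= 1 by exact: flat1_itv.
(* Pointwise convergence: e^{-1/(k (x_i - a))} tends to 1 for x_i > a, and
   every term is 0 for x_i <= a. *)
have hlim : \int_(x in setT) (`|W x| * `|b n x - \1_[set x : 'rV[R]_m | a < x ord0 i] x|)
    @[n --> \oo] --> \int_(x in [set: 'rV[R]_m]) (0:R).
  apply: (@Rintegral_dominated_cvg _ _ _ _ _ _ _ (fun x => `|W x|)) => //.
  - move=> n; exact: integrable_mfun (integrable_weighted Wi
      (measurable_diff_indic (sb n) mA)
      (fun x => norm_diff_indic _ x (b01 n x))).
  - move=> x _; rewrite -[X in _ --> X](mulr0 `|W x|).
    apply: cvgM; first exact: cvg_cst.
    have [ax|xa] := ltP a (x ord0 i); last first.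
      rewrite indicE memNset; last by rewrite /= ltNge xa.
      apply: cvg_near_cst; apply: nearW => n; rewrite subr0 /b flat1_le0 ?normr0//.
      by rewrite -mulrBr mulr_ge0_le0// subr_le0.
    rewrite indicE mem_set//=.
    have : b n x @[n --> \oo] --> (1 : R).
      rewrite -(@expR0 R).
      have : expR (- ((x ord0 i - a)^-1 * n.+1%:R^-1)) @[n --> \oo] --> expR (0 : R).
        apply: continuous_cvg; first exact: continuous_expR.
        rewrite -(@oppr0 R) -(mulr0 (x ord0 i - a)^-1); apply: cvgN.
        by apply: cvgM; [exact: cvg_cst|exact: cvg_harmonic].
      move=> h; rewrite -(cvg_shiftS (fun n => b n x)).
      rewrite (_ : (fun n => b n.+1 x) =
        fun n => expR (- ((x ord0 i - a)^-1 * n.+1%:R^-1))) //.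
      apply/funext => n.
      rewrite /b /flat -mulrBr mulr_gt0 ?subr_gt0//.
      by rewrite hornerC mul1r invfM mulrC.
    move=> hb; rewrite -[X in _ --> X](@normr0 R R); apply: cvg_norm.
    by rewrite -(subrr (1:R)); apply: cvgB => //; exact: cvg_cst.
  - exact: integrable_norm.
  - move=> n x _; rewrite normrM !normr_id ler_piMr//.
    exact: (norm_diff_indic _ x (b01 n x)).
move: hlim; rewrite Rintegral_cst// mul0r => /cvgr0_norm_lt/(_ _ e0)[k _ hk].
exists (b k); split => //.
by apply: le_lt_trans (hk k _); [exact: ler_norm|rewrite /=].
Qed.

(** The sets whose indicator is a limit of smooth functions with values in [0,
    1], in the L^1 norm of weight |W|, form a sigma-algebra; it contains the
    half-spaces, hence all measurable sets. *)
Lemma smooth_approximable_measurable W A : mu.-integrable setT (EFin \o W) ->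
  measurable A -> smooth_approximable W A.
Proof.
move=> Wi; have [H0 HC HU] : sigma_algebra setT (smooth_approximable W).
  split; first exact: smooth_approximable0.
    by move=> B hB; rewrite setTD; exact: smooth_approximableC.
  by move=> F hF; exact: smooth_approximable_bigcup.
have hcoord i (B : set (measurableTypeR R)) : measurable B ->
    smooth_approximable W ((fun x : 'rV[R]_m => x ord0 i) @^-1` B).
  rewrite [in X in X -> _]RGenOInfty.measurableE.
  move: B; apply: smallest_sub.
    split => [|B hB|F hF] /=; first by rewrite preimage_set0.
      by rewrite setTD preimage_setC -setTD; exact: HC.
    by rewrite preimage_bigcup; exact: HU.
  move=> _ [a ->] /=.
  rewrite (_ : _ @^-1` _ = [set x : 'rV[R]_m | a < x ord0 i]).
    exact: smooth_approximable_half_space.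
  by apply/seteqP; split => x /=; rewrite in_itv/= andbT.
move: A; apply: smallest_sub => // B.
by rewrite -bigcup_seq => -[i _ [C mC <-]]; rewrite setTI; exact: hcoord.
Qed.

End density.

(** * Density of smooth functions in L^1 *)

Section L1_density.
Import HBSimple.
Context {R : realType} (m : nat).
Local Notation mu := (lebesgue_rV R m).

Lemma measurable_cube r : measurable (@cube R m r).
Proof. by apply: closed_measurable_rV; exact: closed_cube. Qed.

Lemma smooth_sum_indic (A : R -> set 'rV[R]_m) (s : seq R) (Q : set 'rV[R]_m) :
  measurable Q -> (mu Q < +oo)%E -> (forall y, measurable (A y)) ->
  forall e : R, 0 < e -> exists b, [/\ smooth b,
    exists M : R, forall x, `|b x| <= M &
    \int_(x in Q) `|\sum_(y <- s) y * \1_(A y) x - b x| < e].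
Proof.
move=> mQ Qoo mA; elim: s => [|y s IH] e e0.
  exists (fun=> 0); split; first exact: smooth_cst.
    by exists 0 => x; rewrite normr0.
  rewrite (_ : (fun x => _) = fun=> 0); last first.
    by apply/funext => x; rewrite big_nil subr0 normr0.
  by rewrite Rintegral_cst// mul0r.
have e20 : 0 < e / 2 by exact: divr_gt0.
have [b [sb [M bM] hb]] := IH _ e20.
pose W (x : 'rV[R]_m) := y * \1_Q x.
have Wi : mu.-integrable setT (EFin \o W).
  apply: integrable_scale => //; rewrite /comp.
  exact: integrable_indic_finite.
have [_ /(_ _ e20)[a [sa a01 ha]]] := smooth_approximable_measurable Wi (mA y).
exists (fun x => y * a x + b x); split.
- by apply: smoothD => //; apply: smoothM => //; exact: smooth_cst.
- exists (`|y| + M) => x; apply: le_trans (ler_normD _ _) _.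
  apply: lerD => //; rewrite normrM ler_piMr//.
  by have /andP[a0 a1] := a01 x; rewrite ger0_norm.
have mS : measurable_fun Q (fun x => \sum_(y <- s) y * \1_(A y) x).
  apply: measurable_sum => z; apply: measurable_funM => //.
have bS : forall x, `|\sum_(y <- s) y * \1_(A y) x| <= \sum_(y <- s) `|y|.
  move=> x; apply: le_trans (ler_norm_sum _ _ _) _; apply: ler_sum => z _.
  rewrite normrM ler_piMr// indicE; case: (_ \in _); by rewrite ?normr1 ?normr0.
have mb := measurable_smooth sb mQ.
have ma := measurable_smooth sa mQ.
have bint (g : 'rV[R]_m -> R) (C : R) : measurable_fun Q g -> (forall x, `|g x| <= C) ->
    mu.-integrable Q (EFin \o g).
  by move=> mg gC; exact: (@integrable_bounded _ _ _ _ _ _ C).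
have i1 : mu.-integrable Q (EFin \o (fun x => `|\sum_(y <- s) y * \1_(A y) x - b x|)).
  apply: integrable_norm => //; apply: integrable_sub => //.
    exact: bint bS.
  exact: bint bM.
have i2 : mu.-integrable Q (EFin \o (fun x => `|y| * `|a x - \1_(A y) x|)).
  apply: integrable_scale => //; apply: (bint _ 1).
    apply: measurableT_comp => //; apply: measurable_funB => //.
  by move=> x; rewrite normr_id; apply: norm_diff_indic.
have -> : e = e / 2 + e / 2 by exact: splitr.
have E2 : \int_(x in Q) (`|y| * `|a x - \1_(A y) x|) < e / 2.
  apply: le_lt_trans ha; rewrite Rintegral_mkcond le_eqVlt; apply/orP; left.
  apply/eqP; apply: eq_Rintegral => x _.
  rewrite /W patchE; have -> : \1_Q x = (x \in Q)%:R :> R by rewrite indicE.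
  case: ifP => _ /=; first by rewrite mulr1.
  by rewrite mulr0 normr0 mul0r.
apply: le_lt_trans (ltrD E2 hb); rewrite -RintegralD//.
apply: le_Rintegral => //.
- apply: (bint _ (\sum_(z <- y :: s) `|z| + (`|y| + M))) => [|x].
    apply: measurableT_comp => //; apply: measurable_funB.
      under eq_fun do rewrite big_cons.
      apply: measurable_funD => //; apply: measurable_funM => //.
    by apply: measurable_funD => //; exact: measurable_funM.
  rewrite normr_id; apply: le_trans (ler_normB _ _) _; apply: lerD.
    rewrite !big_cons; apply: le_trans (ler_normD _ _) _; apply: lerD => //.
    rewrite normrM ler_piMr// indicE; case: (_ \in _); by rewrite ?normr1 ?normr0.
  apply: le_trans (ler_normD _ _) _.
  apply: lerD => //; rewrite normrM ler_piMr//.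
  by have /andP[a0 a1] := a01 x; rewrite ger0_norm.
- exact: integrable_add.
move=> x _; rewrite big_cons -normrM -(normrN (y * _)).
by apply: le_trans (ler_normD _ _); rewrite le_eqVlt; apply/orP; left;
   apply/eqP; congr `|_|; lra.
Qed.

(** Approximate f by a simple function, then each of its level sets by a
    smooth function. The bound on b provides the domination in the continuity
    of translations. *)
Lemma smooth_dense_L1 (f : 'rV[R]_m -> R) (Q : set 'rV[R]_m) :
  measurable Q -> (mu Q < +oo)%E -> mu.-integrable Q (EFin \o f) ->
  forall e : R, 0 < e -> exists b, [/\ smooth b,
    exists M : R, forall x, `|b x| <= M & \int_(x in Q) `|f x - b x| < e].
Proof.
move=> mQ Qoo fi e e0; have e20 : 0 < e / 2 by exact: divr_gt0.
have [g [gi _ gcvg]] := approximation_sfun_integrable mQ fi.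
have [n hn] : exists n, \int_(x in Q) `|f x - g n x| < e / 2.
  move: gcvg => /fine_cvgP[_] /cvgr0_norm_lt/(_ _ e20)[k _ hk].
  by exists k; apply: le_lt_trans (hk k _); [exact: ler_norm|rewrite /=].
pose s : seq R := finmap.enum_fset (fset_set (range (g n))).
have gE x : g n x = \sum_(y <- s) y * \1_(g n @^-1` [set y]) x.
  rewrite [LHS]fimfunE fsbig_finite//; exact: fimfunP.
have [b [sb bM hb]] := @smooth_sum_indic (fun y => g n @^-1` [set y]) s Q mQ Qoo
  (fun y => measurable_funPTI (g n) (measurable_set1 y)) _ e20.
exists b; split => //; rewrite [e]splitr; apply: le_lt_trans (ltrD hn hb).
under [X in _ <= _ + X]eq_Rintegral do rewrite -gE.
have [M hM] := bM.
have bi : mu.-integrable Q (EFin \o b).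
  by apply: (@integrable_bounded _ _ _ _ _ _ M) => //; exact: measurable_smooth.
rewrite -RintegralD//.
- apply: le_Rintegral => //.
  + by apply: integrable_norm => //; exact: integrable_sub.
  + by apply: integrable_add => //; apply: integrable_norm => //;
      apply: integrable_sub.
  + by move=> x _; exact: ler_distD.
- by apply: integrable_norm => //; exact: integrable_sub.
- by apply: integrable_norm => //; exact: integrable_sub.
Qed.

End L1_density.

(** * Continuity of translations in L^1 *)

Section translation_continuity.
Context {R : realType} (m : nat).
Local Notation mu := (lebesgue_rV R m).

Lemma Rintegral_cube_addr (f : 'rV[R]_m -> R) (i : 'I_m) (r t : R) :
  mu.-integrable (cube m (r + 1)) (EFin \o f) -> `|t| <= 1 ->
  (forall x, 0 <= f x) ->
  mu.-integrable (cube m r) (EFin \o (fun x => f (x + t *: unit_vec R i))) /\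
  \int_(x in cube m r) f (x + t *: unit_vec R i) <=
  \int_(x in cube m (r + 1)) f x.
Proof.
move=> fi t1 f0; set Q := cube m (r + 1).
have mQ : measurable Q by exact: measurable_cube.
have mK : measurable (cube (R := R) m r) by exact: measurable_cube.
have f1i : mu.-integrable setT (EFin \o (fun x => f x * \1_Q x)).
  exact: (@integrable_mul_indic _ _ R mu Q f mQ).1.
have f2i := integrable_addr (t *: unit_vec R i) f1i.
have KQ x : cube m r x -> Q (x + t *: unit_vec R i).
  move=> Kx j; rewrite !mxE; apply: le_trans (ler_normD _ _) _.
  apply: lerD => //; rewrite normrM eqxx/=; apply: le_trans t1.
  by rewrite ler_piMr//; case: (_ == _); rewrite ?normr1 ?normr0.
have E x : cube m r x -> f (x + t *: unit_vec R i) =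
    f (x + t *: unit_vec R i) * \1_Q (x + t *: unit_vec R i).
  by move=> Kx; rewrite indicE mem_set ?mulr1//; exact: KQ.
have f3i : mu.-integrable (cube m r) (EFin \o (fun x => f (x + t *: unit_vec R i))).
  apply: (@eq_integrable _ _ _ _ _ mK
    (EFin \o (fun x => f (x + t *: unit_vec R i) * \1_Q (x + t *: unit_vec R i)))).
    by move=> x; rewrite inE => Kx /=; rewrite -E.
  by apply: integrableS f2i.
split => //; rewrite [leRHS]Rintegral_indic -(Rintegral_addr (t *: unit_vec R i) f1i).
rewrite (@eq_Rintegral _ _ _ mu _ (fun x => f (x + t *: unit_vec R i) *
    \1_Q (x + t *: unit_vec R i))); last first.
  by move=> x; rewrite inE => Kx; rewrite -E.
by apply: ge0_subset_Rintegral => // x _; rewrite mulr_ge0.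
Qed.

(** Three-epsilon argument: f is close to a smooth b both before and after the
    translation, the latter on a cube larger by 1, and b is continuous. *)
Lemma translation_continuous (f : 'rV[R]_m -> R) (i : 'I_m) (r : R) :
  mu.-integrable setT (EFin \o f) ->
  \int_(x in cube m r) `|f (x + s *: unit_vec R i) - f x|
    @[s --> (0 : R)] --> (0 : R).
Proof.
move=> fi; set Q := cube m (r + 1).
have mQ : measurable Q by exact: measurable_cube.
have mK : measurable (cube (R := R) m r) by exact: measurable_cube.
pose F s := \int_(x in cube m r) `|f (x + s *: unit_vec R i) - f x|.
have F0 : F 0 = 0.
  rewrite /F (@eq_Rintegral _ _ _ mu _ (fun=> 0)) ?Rintegral_cst// ?mul0r//.
  by move=> x _; rewrite scale0r addr0 subrr normr0.
suff : F s @[s --> (0 : R)] --> F 0 by rewrite F0.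
apply/(@cvg_nbhsP _ R^o) => u u0.
rewrite F0; apply/cvgr0Pnorm_lt => e e0.
have e30 : 0 < e / 3 by exact: divr_gt0.
have Qoo : (mu Q < +oo)%E by exact: lebesgue_rV_cube.
have Koo : (mu (cube m r) < +oo)%E by exact: lebesgue_rV_cube.
have fQ : mu.-integrable Q (EFin \o f) by apply: integrableS fi.
have fK : mu.-integrable (cube m r) (EFin \o f) by apply: integrableS fi.
have [b [sb [M bM] hb]] := smooth_dense_L1 mQ Qoo fQ e30.
have bint D : measurable D -> (mu D < +oo)%E -> mu.-integrable D (EFin \o b).
  move=> mD Doo; apply: (@integrable_bounded _ _ _ _ _ _ M) => //.
  exact: measurable_smooth.
have smid t : measurable_fun (cube m r) (fun x => `|b (x + t *: unit_vec R i) - b x|).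
  apply: measurableT_comp => //; apply: measurable_funB; last exact: measurable_smooth.
  by apply: measurable_smooth => //; exact: smooth_addr.
have bmid t x : `| `|b (x + t *: unit_vec R i) - b x| | <= M + M.
  by rewrite normr_id; apply: le_trans (ler_normB _ _) _; exact: lerD.
have imid t : mu.-integrable (cube m r)
    (EFin \o (fun x => `|b (x + t *: unit_vec R i) - b x|)).
  exact: (@integrable_bounded _ _ _ _ _ _ (M + M)).
have hmid : \int_(x in cube m r) `|b (x + u n *: unit_vec R i) - b x|
    @[n --> \oo] --> (0 : R).
  rewrite (_ : 0 = \int_(x in (cube m r : set 'rV[R]_m)) (0 : R)); last first.
    by rewrite Rintegral_cst// mul0r.
  apply: (@Rintegral_dominated_cvg _ _ _ _ _ _ _ (fun=> M + M)) => //.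
  - move=> x _.
    rewrite -[X in _ --> X](@normr0 R R); apply: cvg_norm.
    rewrite -(subrr (b x)); apply: cvgB; last exact: cvg_cst.
    have hz : x + u n *: unit_vec R i @[n --> \oo] --> x.
      rewrite -[X in _ --> X]addr0; apply: cvgD; first exact: cvg_cst.
      rewrite -[X in _ --> X](scale0r (unit_vec R i)).
      by have := cvgZr_tmp (a := unit_vec R i) u0; apply.
    by apply: (@continuous_cvg _ _ _ _ _ _ b); [exact: smooth_continuous|exact: hz].
  - by apply: (@integrable_bounded _ _ _ _ _ _ (M + M)) => // x _; rewrite ger0_norm// (le_trans _ (bmid 0 x)).
have fbi : mu.-integrable Q (EFin \o (fun x => `|f x - b x|)).
  by apply: integrable_norm => //; apply: integrable_sub => //; exact: bint.
near=> n.
have un1 : `|u n| <= 1 by near: n; exact: (cvgr0_norm_le _ u0 _ ltr01).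
have hn : \int_(x in cube m r) `|b (x + u n *: unit_vec R i) - b x| < e / 3.
  apply: le_lt_trans (ler_norm _) _.
  by near: n; exact: (cvgr0_norm_lt _ hmid _ e30).
have [i1 h1] := Rintegral_cube_addr i fbi un1 (fun x => normr_ge0 _).
have h2 : \int_(x in cube m r) `|f x - b x| < e / 3.
  apply: le_lt_trans hb; apply: ge0_subset_Rintegral => //.
  by move=> x Kx j; apply: le_trans (Kx j) _; rewrite lerDl.
have i2 : mu.-integrable (cube m r) (EFin \o (fun x => `|f x - b x|)).
  by apply: integrable_norm => //; apply: integrable_sub => //; exact: bint.
have fti : mu.-integrable (cube m r) (EFin \o (fun x => f (x + u n *: unit_vec R i))).
  by apply: integrableS (integrable_addr (u n *: unit_vec R i) fi).
rewrite ger0_norm; last by apply: Rintegral_ge0.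
apply: (@le_lt_trans _ _
  ((\int_(x in cube m r) `|f (x + u n *: unit_vec R i) - b (x + u n *: unit_vec R i)| +
    \int_(x in cube m r) `|b (x + u n *: unit_vec R i) - b x|) +
    \int_(x in cube m r) `|f x - b x|)).
  rewrite -!RintegralD//; last exact: integrable_add.
  apply: le_Rintegral => //.
  + by apply: integrable_norm => //; exact: integrable_sub.
  + by apply: integrable_add => //; exact: integrable_add.
  + move=> x _; rewrite (distrC (f x)).
    apply: le_trans (ler_distD (b x) _ _) _; rewrite lerD2r.
    exact: ler_distD.
have -> : e = e / 3 + e / 3 + e / 3 by field.
by apply: ltrD => //; apply: ltrD => //; exact: le_lt_trans h1 hb.
Unshelve. all: by end_near. Qed.

End translation_continuity.

(** * Difference quotients of weakly differentiable functions *)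

Section difference_quotients.
Context {R : realType} (m : nat) (i : 'I_m).
Local Notation mu := (lebesgue_rV R m).
Local Notation e := (unit_vec R i).

Lemma partial_support (k : 'rV[R]_m -> R) (K : set 'rV[R]_m) : closed K ->
  (forall x, ~ K x -> k x = 0) -> forall x, ~ K x -> partial i k x = 0.
Proof.
move=> cK k0 x Kx; rewrite /partial.
rewrite (@near_eq_derive R 'rV[R]_m R^o k (cst 0)); first exact: derive_cst.
have : nbhs x (~` K) by apply: open_nbhs_nbhs; split => //; exact: closed_openC.
by apply: filterS => y; exact: k0.
Qed.

Lemma smooth_subr (k : 'rV[R]_m -> R) (s : R) : smooth k ->
  smooth (fun x => k (x - s *: e)).
Proof. exact: smooth_addr. Qed.

Lemma integrable_mul_smooth (w k : 'rV[R]_m -> R) (M : R) D : measurable D ->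
  mu.-integrable D (EFin \o w) -> smooth k -> (forall x, `|k x| <= M) ->
  mu.-integrable D (EFin \o (fun x => w x * k x)).
Proof.
move=> mD wi sk kM; apply: (@integrable_bounded_mul _ _ _ _ _ _ _ M) => //.
exact: measurable_smooth.
Qed.

(** All the dependence on s sits in the smooth factor, so differentiation
    under the integral sign applies to any integrable w. *)
Lemma is_derive_convolution (w k : 'rV[R]_m -> R) (M M' : R) (s : R) :
  mu.-integrable setT (EFin \o w) -> smooth k -> (forall x, `|k x| <= M) ->
  (forall x, `|partial i k x| <= M') ->
  is_derive s 1 (fun s => \int_(x in setT) (w x * k (x - s *: e)))
    (- \int_(x in setT) (w x * partial i k (x - s *: e))).
Proof.
move=> wi sk kM kM'.
pose f (t : R) (x : 'rV[R]_m) := w x * k (x - t *: e).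
have df (t : R) x : is_derive t 1 (f ^~ x) (w x * - partial i k (x - t *: e)).
  have d1 : is_derive t 1 (fun t : R => k (x - t *: e)) (- partial i k (x - t *: e)).
    have -> : (fun t : R => k (x - t *: e)) = (fun t => k (x + t *: e)) \o -%R.
      by apply/funext => t' /=; rewrite scaleNr.
    have := is_derive_partial i x (- t) sk; rewrite scaleNr => d.
    rewrite -[X in is_derive _ _ _ X]mulrN1.
    exact: (is_derive1_comp (f := fun t => k (x + t *: e)) (g := -%R) d).
  have := @is_deriveZ R R R _ (w x) t 1 _ d1.
  by [].
have pf t x : partial1of2 f t x = w x * - partial i k (x - t *: e).
  by rewrite partial1of2E; have [_ ->] := df t x.
have fi t : mu.-integrable setT (EFin \o f t).
  apply: (@integrable_mul_smooth _ _ M) => //; exact: smooth_subr.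
pose G x := M' * `|w x|.
have M'0 : 0 <= M' by exact: le_trans (normr_ge0 _) (kM' 0).
have Is : `]s - 1, s + 1[%classic s by rewrite /= in_itv/= ltrBlDr ltrDl ltr01.
have derf t x : `]s - 1, s + 1[%classic t -> [set: 'rV[R]_m] x ->
    derivable (f ^~ x) t 1 by move=> _ _; have [] := df t x.
have G0 x : 0 <= G x by rewrite mulr_ge0.
have iG : mu.-integrable setT (EFin \o G).
  by apply: integrable_scale => //; exact: integrable_norm.
have GM t x : `]s - 1, s + 1[%classic t -> [set: 'rV[R]_m] x ->
    `|partial1of2 f t x| <= G x.
  by move=> _ _; rewrite pf normrM normrN mulrC ler_wpM2r.
have fi' t : `]s - 1, s + 1[%classic t -> mu.-integrable setT (EFin \o f t) by [].
have d := derivable_under_integral measurableT Is fi' derf G0 iG GM.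
apply: DeriveDef; first exact: d.
have := differentiation_under_integral measurableT Is fi' derf G0 iG GM.
rewrite derive1E => ->.
rewrite -[RHS]mulN1r -RintegralZl//.
  by apply: eq_Rintegral => x _; rewrite pf mulrN mulN1r.
apply: (@integrable_mul_smooth _ (fun x => partial i k (x - s *: e)) M') => //.
by apply: smooth_subr; exact: smooth_partial.
Qed.

Lemma Rintegral_mul_addr (w k : 'rV[R]_m -> R) (M s : R) :
  mu.-integrable setT (EFin \o w) -> smooth k -> (forall x, `|k x| <= M) ->
  \int_(x in setT) (w x * k (x - s *: e)) =
  \int_(x in setT) (w (x + s *: e) * k x).
Proof.
move=> wi sk kM.
have fi : mu.-integrable setT (EFin \o (fun x => w x * k (x - s *: e))).
  by apply: (@integrable_mul_smooth _ (fun x => k (x - s *: e)) M) => //;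
    exact: smooth_subr.
rewrite -(Rintegral_addr (s *: e) fi).
by apply: eq_Rintegral => x _; rewrite addrK.
Qed.

(** With Phi(s) the integral of u(x) k(x - s e), the weak formulation says
    that Phi'(s) is the integral of g(x) k(x - s e); this is the mean value
    theorem for Phi. *)
Lemma weak_mean_value (u g k : 'rV[R]_m -> R) (M M' t : R) :
  mu.-integrable setT (EFin \o u) -> mu.-integrable setT (EFin \o g) ->
  smooth k -> (forall x, `|k x| <= M) -> (forall x, `|partial i k x| <= M') ->
  (forall s : R, `|s| <= `|t| ->
    \int_(x in setT) (u x * partial i k (x - s *: e)) =
    - \int_(x in setT) (g x * k (x - s *: e))) ->
  exists2 s, `|s| <= `|t| &
    \int_(x in setT) ((u (x + t *: e) - u x) * k x) =
    t * \int_(x in setT) (g (x + s *: e) * k x).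
Proof.
move=> ui gi sk kM kM' weak.
pose Phi (s : R) := \int_(x in setT) (u x * k (x - s *: e)).
have dPhi (s : R) : `|s| <= `|t| ->
    is_derive s 1 Phi (\int_(x in setT) (g x * k (x - s *: e))).
  move=> st; have := is_derive_convolution s ui sk kM kM'.
  by rewrite (weak _ st) opprK.
have cPhi : continuous Phi.
  move=> s; apply: differentiable_continuous; apply/derivable1_diffP.
  by have [] := is_derive_convolution s ui sk kM kM'.
have E : \int_(x in setT) ((u (x + t *: e) - u x) * k x) = Phi t - Phi 0.
  rewrite /Phi !(@Rintegral_mul_addr _ _ M)// scale0r.
  under [X in _ = _ - X]eq_Rintegral do rewrite addr0.
  rewrite -RintegralB//.
  - by apply: eq_Rintegral => x _; rewrite mulrBl.
  - by apply: (@integrable_mul_smooth _ _ M) => //; exact: (integrable_addr (t *: e) ui).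
  - exact: (@integrable_mul_smooth _ _ M).
rewrite E.
pose Psi (s : R) := \int_(x in setT) (g x * k (x - s *: e)).
have PsiE s : Psi s = \int_(x in setT) (g (x + s *: e) * k x).
  exact: (@Rintegral_mul_addr _ _ M).
have [t0|t0] := leP 0 t.
  have [s|s] := @MVT_segment R Phi Psi 0 t t0 _ (continuous_subspaceT cPhi).
    rewrite in_itv/= => /andP[s0 st].
    by apply: dPhi; rewrite !ger0_norm// ltW.
  rewrite in_itv/= => /andP[s0 st] ->; exists s; first by rewrite !ger0_norm.
  by rewrite subr0 mulrC -PsiE.
have [s|s] := @MVT_segment R Phi Psi t 0 (ltW t0) _ (continuous_subspaceT cPhi).
  rewrite in_itv/= => /andP[st s0].
  by apply: dPhi; rewrite !ltr0_norm// lerN2 ltW.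
rewrite in_itv/= => /andP[st s0] Es; exists s.
  by rewrite !ler0_norm ?lerN2// ltW.
by rewrite -opprB Es sub0r mulrN opprK mulrC -PsiE.
Qed.

Lemma compact_sub_cube (K : set 'rV[R]_m) : compact K ->
  exists r : R, K `<=` cube m r.
Proof.
move=> /compact_bounded[M [_ hM]]; exists (M + 1) => x Kx j.
by apply: le_trans (mx_norm_le_coord x j) _; apply: hM => //; rewrite ltrDl.
Qed.

(** The weak formulation for all small translates of the test functions
    supported in K, written for functions extended by zero outside a
    neighbourhood of K. *)
Definition weak_derivative_near (K : set 'rV[R]_m) (d : R)
    (u g : 'rV[R]_m -> R) : Prop :=
  forall k, smooth k -> (forall x, ~ K x -> k x = 0) ->
    forall s : R, `|s| <= d ->
    \int_(x in setT) (u x * partial i k (x - s *: e)) =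
    - \int_(x in setT) (g x * k (x - s *: e)).

(** Replacing A by a smooth b costs little in the L^1 norm weighted by the
    integrand. For smooth b the mean value form bounds the error by the L^1
    modulus of continuity of g, which does not depend on b. *)
Lemma weak_difference_quotient (u g h : 'rV[R]_m -> R) (K A : set 'rV[R]_m) (d : R) :
  mu.-integrable setT (EFin \o u) -> mu.-integrable setT (EFin \o g) ->
  compact K -> 0 < d -> weak_derivative_near K d u g ->
  smooth h -> (forall x, ~ K x -> h x = 0) -> measurable A ->
  forall eps : R, 0 < eps -> exists2 d' : R, 0 < d' & forall t, `|t| < d' ->
    `|\int_(x in setT) (((u (x + t *: e) - u x) - t * g x) * h x * \1_A x)|
      <= `|t| * eps.
Proof.
move=> ui gi cK d0 weak sh h0 mA eps eps0.
have cK' : closed K by apply: compact_closed.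
have [r Kr] := compact_sub_cube cK.
have [M M0 hM] := compact_support_bounded cK (smooth_continuous sh) h0.
have M10 : 0 < M + 1 by rewrite ltr_wpDl.
have epsM : 0 < eps / (M + 1) by rewrite divr_gt0.
have /cvgr0_norm_lt/(_ _ epsM)[d1 /= d10 hd1] := translation_continuous i r gi.
exists (Num.min d d1); first by rewrite lt_min d0.
move=> t; rewrite lt_min => /andP[td td1].
pose W x := ((u (x + t *: e) - u x) - t * g x) * h x.
have uti : mu.-integrable setT (EFin \o (fun x => u (x + t *: e))).
  exact: (integrable_addr (t *: e) ui).
have dui : mu.-integrable setT (EFin \o (fun x => u (x + t *: e) - u x)).
  exact: integrable_sub.
have tgi : mu.-integrable setT (EFin \o (fun x => t * g x)).
  exact: integrable_scale.
have Wi : mu.-integrable setT (EFin \o W).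
  by apply: (@integrable_mul_smooth _ _ M) => //; exact: integrable_sub.
apply/ler_addgt0Pr => eta eta0.
have [_ /(_ _ eta0)[b [sb b01 hb]]] := smooth_approximable_measurable Wi mA.
pose k x := h x * b x.
have sk : smooth k by exact: smoothM.
have k0 x : ~ K x -> k x = 0 by move=> /h0 hx; rewrite /k hx mul0r.
have kM x : `|k x| <= M.
  rewrite normrM; apply: le_trans (hM x).
  by have /andP[b0 b1] := b01 x; rewrite ler_piMr// ger0_norm.
have [M' M'0 kM'] := compact_support_bounded cK
  (smooth_continuous (smooth_partial i sk)) (partial_support cK' k0).
(* The mean value form is applied to the product k = h b, which is supported
   in K. *)
have [s st Es] := weak_mean_value ui gi sk kM kM'
  (fun s st => weak k sk k0 s (le_trans st (ltW td))).
have gsi : mu.-integrable setT (EFin \o (fun x => g (x + s *: e))).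
  exact: (integrable_addr (s *: e) gi).
have dgi : mu.-integrable setT (EFin \o (fun x => g (x + s *: e) - g x)).
  exact: integrable_sub.
have Ek : \int_(x in setT) (W x * b x) =
    t * \int_(x in setT) ((g (x + s *: e) - g x) * k x).
  transitivity (\int_(x in setT) ((u (x + t *: e) - u x) * k x) -
      t * \int_(x in setT) (g x * k x)).
    rewrite -RintegralZl//; last exact: (@integrable_mul_smooth _ _ M).
    rewrite -RintegralB//.
    - by apply: eq_Rintegral => x _; rewrite /W /k; ring.
    - exact: (@integrable_mul_smooth _ _ M).
    - by apply: integrable_scale => //; exact: (@integrable_mul_smooth _ _ M).
  rewrite Es -mulrBr -RintegralB//.
  - by congr (_ * _); apply: eq_Rintegral => x _; rewrite mulrBl.
  - exact: (@integrable_mul_smooth _ _ M).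
  - exact: (@integrable_mul_smooth _ _ M).
have B1 : `|\int_(x in setT) (W x * b x)| <= `|t| * eps.
  rewrite Ek normrM ler_wpM2l//.
  have ik : mu.-integrable setT (EFin \o (fun x => (g (x + s *: e) - g x) * k x)).
    exact: (@integrable_mul_smooth _ _ M).
  apply: le_trans (le_normr_Rintegral _ ik) _ => //.
  have mr : measurable (cube (R := R) m r) by exact: measurable_cube.
  have idg : mu.-integrable (cube m r) (EFin \o (fun x => `|g (x + s *: e) - g x|)).
    by apply: integrable_norm => //; apply: integrableS dgi.
  apply: (@le_trans _ _ (M * \int_(x in cube m r) `|g (x + s *: e) - g x|)).
    rewrite -RintegralZl// [leRHS]Rintegral_indic.
    apply: le_Rintegral => //.
    + exact: integrable_norm.
    + apply/(@integrable_mul_indic _ _ R mu _ _ mr).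
      exact: integrable_scale.
    move=> x _; rewrite normrM indicE.
    have [Kx|Kx] := pselect (K x).
      by rewrite mem_set ?mulr1 1?mulrC ?ler_wpM2r//; exact: Kr.
    by rewrite k0// normr0 mulr0 !mulr_ge0.
  have : \int_(x in cube m r) `|g (x + s *: e) - g x| <= eps / (M + 1).
    apply: le_trans (ler_norm _) _; apply/ltW/hd1 => /=.
    by rewrite sub0r normrN; exact: le_lt_trans st td1.
  rewrite ler_pdivlMr// => le1; apply: le_trans le1.
  by rewrite mulrC ler_wpM2l// ?lerDl// Rintegral_ge0.
have Wbi : mu.-integrable setT (EFin \o (fun x => W x * b x)).
  apply: (@integrable_mul_smooth _ _ 1) => // x.
  by have /andP[b0 b1] := b01 x; rewrite ger0_norm.
have mdb := measurable_diff_indic sb mA.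
have Wdi : mu.-integrable setT (EFin \o (fun x => W x * (b x - \1_A x))).
  apply: (@integrable_bounded_mul _ _ _ _ _ _ _ 1) => // x _.
  exact: norm_diff_indic.
have -> : \int_(x in setT) (W x * \1_A x) =
    \int_(x in setT) (W x * b x) - \int_(x in setT) (W x * (b x - \1_A x)).
  by rewrite -RintegralB//; apply: eq_Rintegral => x _; ring.
apply: le_trans (ler_normB _ _) _; apply: lerD => //.
apply: le_trans (le_normr_Rintegral _ Wdi) _ => //.
by apply: le_trans (ltW hb); under eq_Rintegral do rewrite normrM.
Qed.

End difference_quotients.

(** * The chain rule for positive parts *)

Section chain_rule.
Context {R : realType} (m : nat).
Local Notation mu := (lebesgue_rV R m).

(** The form at first order that survives multiplication by t of either sign.
    *)
Lemma derive_expansion (F : R -> R) (a : R) : is_derive (0 : R) 1 F a ->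
  forall eps : R, 0 < eps -> exists2 d : R, 0 < d & forall t, `|t| < d ->
    `|F t - F 0 - t * a| <= `|t| * eps.
Proof.
move=> [dF <-] eps eps0.
have /cvgrPdist_le/(_ _ eps0)[d /= d0 hd] :
    (fun h => h^-1 *: ((F \o shift 0) (h *: 1) - F 0)) @ 0^' --> 'D_1 F 0 by [].
exists d => // t td; have [->|t0] := eqVneq t 0.
  by rewrite subrr mul0r subr0 normr0 mul0r.
have := hd t; rewrite /= sub0r normrN => /(_ td t0).
rewrite addr0 [t *: 1]mulr1 distrC => h.
have -> : F t - F 0 - t * 'D_1 F 0 = t * (t^-1 *: (F t - F 0) - 'D_1 F 0).
  by rewrite mulrBr [t * (_ *: _)]mulrA mulfV// mul1r.
by rewrite normrM ler_wpM2l.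
Qed.

Lemma Rintegral_compact_support (u phi : 'rV[R]_m -> R) (K U : set 'rV[R]_m) :
  K `<=` U -> (forall x, ~ K x -> phi x = 0) ->
  \int_(x in U) (u x * phi x) = \int_(x in setT) ((u x * \1_K x) * phi x).
Proof.
move=> KU phi0; rewrite Rintegral_indic; apply: eq_Rintegral => x _.
have [Kx|Kx] := pselect (K x).
  by rewrite !indicE !mem_set ?mulr1//; exact: KU.
by rewrite phi0// !mulr0 mul0r.
Qed.

Lemma integrable_compact_support (u phi : 'rV[R]_m -> R) (K U V : set 'rV[R]_m)
    (M : R) : measurable U -> compact K -> K `<=` V ->
  locally_integrable_in V U u ->
  measurable_fun U phi -> (forall x, U x -> `|phi x| <= M) ->
  (forall x, ~ K x -> phi x = 0) ->
  mu.-integrable U (EFin \o (fun x => u x * phi x)).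
Proof.
move=> mU cK KV [mu_u ui] mphi phiM phi0.
have mK : measurable K by exact: compact_measurable_rV.
have mUK : measurable (U `&` K) by exact: measurableI.
have i1 : mu.-integrable (U `&` K) (EFin \o (fun x => u x * phi x)).
  apply: (@integrable_bounded_mul _ _ _ _ _ _ _ M) => //; last exact: ui.
  - exact: measurable_funS mphi.
  - by move=> x [Ux _]; exact: phiM.
have := (@integrable_mul_indic _ _ R mu _ _ mUK).1 i1.
rewrite (_ : (fun x => _ * \1__ x) = fun x => (u x * phi x) * \1_U x).
  by move/(@integrable_mul_indic _ _ R mu _ _ mU).
apply/funext => x; have [Kx|Kx] := pselect (K x); last by rewrite phi0// mulr0 !mul0r.
by rewrite indicI /= [\1_K x]indicE (mem_set Kx) mulr1.
Qed.

(** The inequality w(x + t e) - w(x) >= 1_A(x) (u(x + t e) - u(x)), integrated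
    against h >= 0, says that a function of t is minimal at t = 0. Its
    derivative there vanishes, and it is the difference of the two sides of
    the conclusion. *)
Lemma weak_chain_rule_ge0 (i : 'I_m) (u g w h : 'rV[R]_m -> R)
    (K A : set 'rV[R]_m) (d : R) :
  mu.-integrable setT (EFin \o u) -> mu.-integrable setT (EFin \o g) ->
  mu.-integrable setT (EFin \o w) ->
  compact K -> 0 < d -> weak_derivative_near i K d u g -> measurable A ->
  (forall x t, K x -> `|t| <= d ->
    \1_A x * (u (x + t *: unit_vec R i) - u x) <= w (x + t *: unit_vec R i) - w x) ->
  smooth h -> (forall x, 0 <= h x) -> (forall x, ~ K x -> h x = 0) ->
  \int_(x in setT) (w x * partial i h x) =
  - \int_(x in setT) (g x * h x * \1_A x).
Proof.
move=> ui gi wi cK d0 weak mA ineq sh hge0 h0.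
have cK' : closed K by apply: compact_closed.
have [M M0 hM] := compact_support_bounded cK (smooth_continuous sh) h0.
have [M' M'0 hM'] := compact_support_bounded cK
  (smooth_continuous (smooth_partial i sh)) (partial_support i cK' h0).
pose e := unit_vec R i.
pose Phi (s : R) := \int_(x in setT) (w x * h (x - s *: e)).
set a := - \int_(x in setT) (w x * partial i h x).
have dPhi : is_derive (0 : R) 1 Phi a.
  have := is_derive_convolution 0 wi sh hM hM'.
  by rewrite scale0r; under eq_Rintegral do rewrite subr0.
set b := \int_(x in setT) (g x * h x * \1_A x).
suff : a = b by rewrite /a => <-; rewrite opprK.
have bA f : mu.-integrable setT (EFin \o f) ->
    mu.-integrable setT (EFin \o (fun x => f x * \1_A x)).
  move=> fi; apply: (@integrable_bounded_mul _ _ _ _ _ _ _ 1) => //.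
  by move=> x _; have /andP[? ?] := indic_itv01 A x; rewrite ger0_norm.
suff : forall eps, 0 < eps -> `|a - b| <= eps.
  move=> h1; apply/eqP; rewrite -subr_eq0 -normr_le0; apply/ler_addgt0Pr => eps e0.
  by rewrite add0r; exact: h1.
move=> eps0 eps00; pose eps := eps0 / 2.
have epsgt0 : 0 < eps by rewrite divr_gt0.
have [d1 d10 H1] := derive_expansion dPhi epsgt0.
have [d2 d20 H2] := weak_difference_quotient ui gi cK d0 weak sh h0 mA epsgt0.
pose D (t : R) := \int_(x in setT) ((u (x + t *: e) - u x) * h x * \1_A x).
have hD t : `|t| <= d -> D t <= Phi t - Phi 0.
  move=> td.
  have wti := integrable_addr (t *: e) wi.
  have uti := integrable_addr (t *: e) ui.
  have -> : Phi t - Phi 0 = \int_(x in setT) ((w (x + t *: e) - w x) * h x).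
    rewrite /Phi !(@Rintegral_mul_addr _ _ _ _ _ M)// scale0r.
    under [X in _ - X]eq_Rintegral do rewrite addr0.
    rewrite -RintegralB//.
    - by apply: eq_Rintegral => x _; rewrite mulrBl.
    - exact: (@integrable_mul_smooth _ _ (fun x => w (x + t *: e)) h M).
    - exact: (@integrable_mul_smooth _ _ w h M).
  apply: le_Rintegral => //.
  - apply: bA; apply: (@integrable_mul_smooth _ _ _ _ M) => //.
    exact: (integrable_sub measurableT uti ui).
  - apply: (@integrable_mul_smooth _ _ _ _ M) => //.
    exact: (integrable_sub measurableT wti wi).
  move=> x _; have [Kx|/h0 ->] := pselect (K x); last by rewrite !mulr0 mul0r.
  by rewrite mulrAC ler_wpM2r// mulrC; exact: ineq.
have hD2 t : `|t| < d2 -> `|D t - t * b| <= `|t| * eps.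
  move=> td; have := H2 _ td; congr (`|_| <= _).
  have uti := integrable_addr (t *: e) ui.
  rewrite -RintegralZl//; last first.
    by apply: bA; exact: (@integrable_mul_smooth _ _ _ _ M).
  rewrite -RintegralB//.
  - by apply: eq_Rintegral => x _; rewrite /e; ring.
  - apply: bA; apply: (@integrable_mul_smooth _ _ _ _ M) => //.
    exact: (integrable_sub measurableT uti ui).
  - by apply: integrable_scale => //; apply: bA; exact: (@integrable_mul_smooth _ _ _ _ M).
pose t := Num.min d (Num.min d1 d2) / 2.
have t0 : 0 < t by rewrite divr_gt0// !lt_min d0 d10.
have tmin : t < Num.min d (Num.min d1 d2).
  by rewrite ltr_pdivrMr// mulr_natr mulr2n ltrDl !lt_min d0 d10.
move: tmin; rewrite !lt_min => /and3P[td td1 td2].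
have nt : `|t| = t by rewrite gtr0_norm.
have nNt : `| - t| = t by rewrite normrN.
(* At t and at -t the two expansions leave a sandwich; together they bound the
   difference a - b on both sides. *)
have F s : `|s| = t -> s * b - t * eps <= s * a + t * eps.
  move=> st; have h1 := H1 s; have h2 := hD2 s; have h3 := hD s.
  move: h1 h2 h3; rewrite st => /(_ td1) + /(_ td2) + /(_ (ltW td)).
  by rewrite !ler_norml => /andP[k1 k2] /andP[k3 k4] k5; lra.
have F1 := F _ nt; have F2 := F _ nNt.
have tn : t * (a - b) <= t * eps0 by rewrite /eps in F1 F2; lra.
have tn2 : t * (b - a) <= t * eps0 by rewrite /eps in F1 F2; lra.
by rewrite ler_norml -lerNl opprB -(ler_pM2l t0) tn2 -(ler_pM2l t0) tn.
Qed.

Definition weak_partial (i : 'I_m) (U : set 'rV[R]_m) (u g : 'rV[R]_m -> R) :=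
  forall h, test_function U h ->
    \int_(x in U) (u x * partial i h x) = - \int_(x in U) (g x * h x).

Definition pos_part (c : R) (u : 'rV[R]_m -> R) (x : 'rV[R]_m) : R :=
  Num.max (u x - c) 0.

Definition above (c : R) (u : 'rV[R]_m -> R) (x : 'rV[R]_m) : R :=
  (c < u x)%R%:R.

Lemma above_itv c u x : 0 <= above c u x <= 1.
Proof. by rewrite /above; case: (_ < _); rewrite /= ?lexx ler01. Qed.

Lemma pos_part_ge0 c u x : 0 <= pos_part c u x.
Proof. by rewrite /pos_part le_max lexx orbT. Qed.

Lemma pos_part_le c u x : `|pos_part c u x| <= `|u x| + `|c|.
Proof.
rewrite ger0_norm ?pos_part_ge0// /pos_part ge_max addr_ge0// andbT.
by apply: le_trans (ler_norm _) _; exact: ler_normB.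
Qed.

(** This is the subgradient inequality for the convex function (r - c)^+, with
    the subgradient 0 at r = c. *)
Lemma pos_part_convex c u x y :
  above c u x * (u y - u x) <= pos_part c u y - pos_part c u x.
Proof.
rewrite /above /pos_part; have [cx|xc] := ltP c (u x).
  rewrite mul1r [Num.max (u x - c) 0](max_idPl _); last by rewrite subr_ge0 ltW.
  by rewrite lerBrDr addrA subrK le_max lexx.
rewrite mul0r [Num.max (u x - c) 0](max_idPr _) ?subr0 ?subr_le0//.
by rewrite le_max lexx orbT.
Qed.

Lemma measurable_above D c u : measurable D -> measurable_fun D u ->
  measurable_fun D (above c u).
Proof.
move=> mD mu_u; rewrite /above.
rewrite (_ : (fun _ => _) = (fun b : bool => b%:R : R) \o (fun x => c < u x)) //.
apply: measurableT_comp => //; apply: measurable_fun_ltr => //.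
Qed.

Lemma measurable_pos_part D c u : measurable D -> measurable_fun D u ->
  measurable_fun D (pos_part c u).
Proof.
move=> mD mu_u; apply: measurable_maxr => //.
exact: measurable_funB.
Qed.

Lemma locally_integrable_cst_bounded (U V : set 'rV[R]_m) (u : 'rV[R]_m -> R) (M : R) :
  measurable U -> measurable_fun U u -> (forall x, U x -> `|u x| <= M) ->
  locally_integrable_in V U u.
Proof.
move=> mU mu_u uM; split => // K cK KV.
have mK := compact_measurable_rV cK.
apply: (@integrable_bounded _ _ _ _ _ _ M); first exact: measurableI.
- apply: le_lt_trans (bounded_lebesgue_rV (compact_bounded cK) mK).
  by apply: le_measure; rewrite ?inE//; exact: measurableI.
- by apply: measurable_funS mu_u => // x [].
- by move=> x [Ux _]; exact: uM.
Qed.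

Lemma locally_integrable_le (U V : set 'rV[R]_m) (u w : 'rV[R]_m -> R) (c : R) :
  measurable U -> locally_integrable_in V U u -> measurable_fun U w ->
  (forall x, U x -> `|w x| <= `|u x| + c) -> locally_integrable_in V U w.
Proof.
move=> mU [mu_u ui] mw wu; split => // K cK KV.
have mK := compact_measurable_rV cK.
have mUK : measurable (U `&` K) by exact: measurableI.
have UKoo : (mu (U `&` K) < +oo)%E.
  apply: le_lt_trans (bounded_lebesgue_rV (compact_bounded cK) mK).
  by apply: le_measure; rewrite ?inE.
apply: (@integrable_le _ _ _ _ _ _ (fun x => `|u x| + c)) => //.
- by apply: measurable_funS mw => // x [].
- by move=> x [Ux _]; exact: wu.
- apply: integrable_add => //; first by apply: integrable_norm => //; exact: ui.
  exact: (@integrable_bounded _ _ _ _ _ _ `|c|).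
Qed.

Lemma locally_integrable_pos_part (U V : set 'rV[R]_m) u c : measurable U ->
  locally_integrable_in V U u -> locally_integrable_in V U (pos_part c u).
Proof.
move=> mU li; apply: (locally_integrable_le (c := `|c|) mU li).
  by apply: measurable_pos_part => //; case: li.
by move=> x _; exact: pos_part_le.
Qed.

Lemma locally_integrable_above (U V : set 'rV[R]_m) u g c : measurable U ->
  measurable_fun U u ->
  locally_integrable_in V U g ->
  locally_integrable_in V U (fun x => above c u x * g x).
Proof.
move=> mU mu_u li; apply: (locally_integrable_le (c := 0) mU li).
  by apply: measurable_funM; [exact: measurable_above|case: li].
move=> x _; rewrite addr0 normrM ler_piMl//.
by have /andP[? ?] := above_itv c u x; rewrite ger0_norm.
Qed.

(** The global chain rule above, for the restrictions of u and g to a compact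
    neighbourhood of the support of h. *)
Lemma weak_pos_part_ge0 (i : 'I_m) (U : set 'rV[R]_m) (u g : 'rV[R]_m -> R) (c : R) :
  open U -> locally_integrable_in U U u -> locally_integrable_in U U g ->
  weak_partial i U u g ->
  forall h, test_function U h -> (forall x, 0 <= h x) ->
    \int_(x in U) (pos_part c u x * partial i h x) =
    - \int_(x in U) ((above c u x * g x) * h x).
Proof.
move=> oU lu lg weak h [sh [K [cK KU h0]]] hge0.
have mU := open_measurable_rV oU.
have cK' : closed K by apply: compact_closed.
have [d d0 [K' [cK2 K'U KK']]] := compact_thickening cK oU KU.
have mK' := compact_measurable_rV cK2.
have UK' : U `&` K' = K' by apply: setIidr.
have liK f : locally_integrable_in U U f ->
    mu.-integrable setT (EFin \o (fun x => f x * \1_K' x)).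
  move=> [_ fi]; apply: (@integrable_mul_indic _ _ R mu _ _ mK').1.
  by have := fi _ cK2 K'U; rewrite UK'.
have lw := locally_integrable_pos_part c mU lu.
have KsubK' : K `<=` K'.
  by move=> x Kx; rewrite -[x]addr0; apply: KK' => //; rewrite normr0 ltW.
have KK2 x s : K x -> `|s| <= d -> K' (x + s *: unit_vec R i).
  move=> Kx sd; apply: KK' => //; apply: le_trans sd.
  apply: le_mx_norm => // j; rewrite !mxE normrM ler_piMr//.
  by case: (_ && _); rewrite ?normr1 ?normr0.
(* Outside K' the restriction of u is 0, whatever its relation to c; A only
   records the points of K'. *)
pose A := K' `&` [set x | c < u x].
have mA : measurable A.
  rewrite /A -UK' -setIA setICA; apply: measurableI => //.
  have [mu_u _] := lu.
  have := measurable_fun_ltr (measurable_cst c) mu_u.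
  move=> /(_ mU [set true]); rewrite (_ : _ @^-1` _ = [set x | c < u x]) //.
  by apply.
have wn : weak_derivative_near i K d (fun x => u x * \1_K' x) (fun x => g x * \1_K' x).
  move=> k sk k0 s sd.
  have ks0 x : ~ K' x -> k (x - s *: unit_vec R i) = 0.
    move=> K'x; apply: k0 => Kx; apply: K'x.
    by rewrite -[x](subrK (s *: unit_vec R i)); exact: KK2.
  have sks := smooth_addr (- (s *: unit_vec R i)) sk.
  have tks : test_function U (fun x => k (x - s *: unit_vec R i)).
    by split => //; exists K'.
  have pks0 x : ~ K' x -> partial i k (x - s *: unit_vec R i) = 0.
    have := partial_support i (compact_closed (@norm_hausdorff _ _) cK2) ks0.
    by rewrite partial_addr; apply.
  rewrite -(Rintegral_compact_support u K'U pks0).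
  rewrite -(Rintegral_compact_support g K'U ks0).
  by have := weak _ tks; rewrite partial_addr.
have ph0 := partial_support i cK' h0.
have h0' x : ~ K' x -> h x = 0 by move=> nK; apply: h0 => /KsubK'.
have ph0' x : ~ K' x -> partial i h x = 0 by move=> nK; apply: ph0 => /KsubK'.
rewrite (Rintegral_compact_support _ K'U ph0').
rewrite (weak_chain_rule_ge0 (liK _ lu) (liK _ lg) (liK _ lw) cK d0 wn mA _ sh hge0 h0); last first.
  move=> x t Kx td.
  rewrite !indicE (mem_set (KK2 _ _ Kx td)) (mem_set (KsubK' _ Kx)) !mulr1.
  apply: le_trans (pos_part_convex _ _ _ _).
  rewrite /above /A in_setI (mem_set (KsubK' _ Kx)) /=.
  by rewrite (_ : (x \in [set x | c < u x]) = (c < u x))//; exact: asboolb.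
congr (- _); rewrite [RHS]Rintegral_indic; apply: eq_Rintegral => x _.
have [K'x|K'x] := pselect (K' x); last by rewrite h0'// !mulr0 !mul0r.
rewrite !indicE (mem_set K'x) (mem_set (K'U _ K'x)) /above /A in_setI (mem_set K'x) /=.
rewrite (_ : (x \in [set x | c < u x]) = (c < u x)); last exact: asboolb.
by rewrite !mulr1 mulrC mulrA.
Qed.

End chain_rule.

(** * Test functions of arbitrary sign *)

Section test_functions.
Context {R : realType} (m : nat).
Local Notation mu := (lebesgue_rV R m).
Implicit Types (U : set 'rV[R]_m) (h : 'rV[R]_m -> R).

Lemma test_functionD U h1 h2 : test_function U h1 -> test_function U h2 ->
  test_function U (fun x => h1 x + h2 x).
Proof.
move=> [s1 [K1 [c1 U1 z1]]] [s2 [K2 [c2 U2 z2]]]; split; first exact: smoothD.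
exists (K1 `|` K2); split; first exact: compactU.
  by rewrite subUset.
by move=> x /not_orP[n1 n2]; rewrite z1// z2// addr0.
Qed.

Lemma test_functionM U h1 h2 : smooth h1 -> test_function U h2 ->
  test_function U (fun x => h1 x * h2 x).
Proof.
move=> s1 [s2 [K2 [c2 U2 z2]]]; split; first exact: smoothM.
by exists K2; split => // x n; rewrite z2// mulr0.
Qed.

Lemma test_function_bounded U h : test_function U h ->
  exists K, [/\ compact K, K `<=` U, forall x, ~ K x -> h x = 0,
    forall i x, ~ K x -> partial i h x = 0 &
    exists2 M : R, 0 <= M & (forall x, `|h x| <= M) /\
      forall i x, `|partial i h x| <= M].
Proof.
move=> [sh [K [cK KU h0]]].
have cK' : closed K by apply: compact_closed.
have p0 i := partial_support i cK' h0.
exists K; split => //.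
have [M M0 hM] := compact_support_bounded cK (smooth_continuous sh) h0.
have /choice[N hN] : forall i, exists N : R, 0 <= N /\ forall x, `|partial i h x| <= N.
  move=> i; have [N N0 hN] := compact_support_bounded cK
    (smooth_continuous (smooth_partial i sh)) (p0 i).
  by exists N.
exists (M + \sum_i N i).
  by rewrite addr_ge0// sumr_ge0// => i _; have [] := hN i.
have N0 : 0 <= \sum_i N i by rewrite sumr_ge0// => i _; have [] := hN i.
split => [x|i x]; first by apply: le_trans (hM x) _; rewrite lerDl.
have [_ h1] := hN i; apply: le_trans (h1 x) _.
rewrite (bigD1 i)//= addrCA lerDl addr_ge0// sumr_ge0// => j _.
by have [] := hN j.
Qed.

Lemma integrable_test_function (U V : set 'rV[R]_m) u h : measurable U ->
  locally_integrable_in V U u -> test_function V h ->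
  mu.-integrable U (EFin \o (fun x => u x * h x)).
Proof.
move=> mU lu th; have [K [cK KV h0 _ [M _ [hM _]]]] := test_function_bounded th.
apply: (integrable_compact_support (M := M) mU cK KV lu) => //.
by apply: measurable_smooth => //; case: th.
Qed.

Lemma integrable_test_partial (U V : set 'rV[R]_m) u h i : measurable U ->
  locally_integrable_in V U u -> test_function V h ->
  mu.-integrable U (EFin \o (fun x => u x * partial i h x)).
Proof.
move=> mU lu th; have [K [cK KV _ h0 [M _ [_ hM]]]] := test_function_bounded th.
apply: (integrable_compact_support (M := M) mU cK KV lu (phi := partial i h)).
- by apply: measurable_smooth => //; apply: smooth_partial; case: th.
- by move=> x _; exact: hM.
- exact: h0.
Qed.

(** A multiple of a test function that is at least 1 on the support of h
    dominates |h|; add and subtract it. *)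
Lemma test_function_nonneg_decomp U h : open U -> test_function U h ->
  exists h1 h2, [/\ test_function U h1, test_function U h2,
    forall x, 0 <= h1 x, forall x, 0 <= h2 x & forall x, h x = h1 x - h2 x].
Proof.
move=> oU th; have [K [cK KU h0 _ [M M0 [hM _]]]] := test_function_bounded th.
have [d d0 [K' [cK' K'U KK']]] := compact_thickening cK oU KU.
have [e [se e0 e1 esupp]] := smooth_above_compact cK d0.
have te : test_function U e.
  split => //; exists K'; split => // x nK; apply/eqP; apply: contra_notT nK.
  by move=> /esupp[x0 Kx0 xx0]; rewrite -(subrKC x0 x); exact: KK'.
have tMe : test_function U (fun x => M * e x).
  by apply: test_functionM => //; exact: smooth_cst.
exists (fun x => h x + M * e x), (fun x => M * e x); split => //.
- exact: test_functionD.
- move=> x; have [Kx|Kx] := pselect (K x); last by rewrite h0// add0r mulr_ge0.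
  have := hM x; rewrite ler_norml => /andP[h1 _].
  have : M <= M * e x by rewrite ler_peMr// e1.
  by move=> h2; lra.
- by move=> x; rewrite mulr_ge0.
- by move=> x; rewrite addrK.
Qed.

Lemma weak_pos_part (i : 'I_m) (U : set 'rV[R]_m) (u g : 'rV[R]_m -> R) (c : R) :
  open U -> locally_integrable_in U U u -> locally_integrable_in U U g ->
  weak_partial i U u g ->
  weak_partial i U (pos_part c u) (fun x => above c u x * g x).
Proof.
move=> oU lu lg weak h th; have mU := open_measurable_rV oU.
have [h1 [h2 [t1 t2 p1 p2 hE]]] := test_function_nonneg_decomp oU th.
have lw := locally_integrable_pos_part c mU lu.
have lag : locally_integrable_in U U (fun x => above c u x * g x).
  by apply: locally_integrable_above => //; case: lu.
have pE x : partial i h x = partial i h1 x - partial i h2 x.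
  have -> : h = (fun x => h1 x + (fun x => -1 * h2 x) x).
    by apply/funext => y; rewrite hE mulN1r.
  have [s1 _] := t1; have [s2 _] := t2.
  rewrite partialD//; last by apply: smoothM => //; exact: smooth_cst.
  rewrite partialM//; last exact: smooth_cst.
  rewrite [partial i (fun=> -1) x](_ : _ = 0); last exact: derive_cst.
  by rewrite mulr0 addr0 mulN1r.
transitivity (\int_(x in U) (pos_part c u x * partial i h1 x) -
    \int_(x in U) (pos_part c u x * partial i h2 x)).
  rewrite -RintegralB//.
  - by apply: eq_Rintegral => x _; rewrite pE mulrBr.
  - exact: integrable_test_partial t1.
  - exact: integrable_test_partial t2.
rewrite !(weak_pos_part_ge0 c oU lu lg weak)// opprK addrC.
rewrite -[RHS]opprK opprK -[LHS]opprK opprB -RintegralB//.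
- by congr (- _); apply: eq_Rintegral => x _; rewrite hE mulrBr.
- exact: integrable_test_function t1.
- exact: integrable_test_function t2.
Qed.

Lemma weak_gradient_pos_part U u G c : open U ->
  weak_gradient U u G ->
  weak_gradient U (pos_part c u) (fun i x => above c u x * G i x).
Proof.
move=> oU [lu lG w]; have mU := open_measurable_rV oU.
split; first exact: locally_integrable_pos_part.
  by move=> i; apply: locally_integrable_above => //; case: lu.
by move=> i h th; apply: weak_pos_part => // k tk; exact: w.
Qed.

End test_functions.

(** * Iterated integrals over R^n x R *)

Section fubini_rV.
Context {R : realType} (n : nat).
Local Notation mu m := (lebesgue_rV R m).
Local Notation lam := (@lebesgue_measure R).

Lemma integrable_prod_rV (a : 'rV[R]_n -> R) (B : set (measurableTypeR R)) :
  measurable B -> (lam B < +oo)%E -> (mu n).-integrable setT (EFin \o a) ->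
  (mu n.+1).-integrable setT (EFin \o (fun z => a (xpart z) * \1_B (ypart z))).
Proof.
move=> mB Boo ai; have ma := integrable_mfun ai.
have mf : measurable_fun setT (fun z : 'rV[R]_n.+1 => a (xpart z) * \1_B (ypart z)).
  apply: measurable_funM; first exact: (measurableT_comp ma (@measurable_xpart R n)).
  apply: (measurableT_comp (f := \1_B : measurableTypeR R -> R)) (@measurable_ypart R n).
  exact: measurable_indic.
apply: (integrable_pushforward (@measurable_join_xy R n)) => //.
  exact/measurable_EFinP.
rewrite preimage_setT.
have E : (EFin \o (fun z => a (xpart z) * \1_B (ypart z))) \o
    (fun p : 'rV[R]_n * measurableTypeR R => join_xy p.1 p.2) =
    EFin \o (fun p : 'rV[R]_n * measurableTypeR R => a p.1 * \1_B p.2).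
  by apply/funext => -[x y] /=; rewrite xpartK ypartK.
rewrite E.
have mp : measurable_fun setT (EFin \o (fun p : 'rV[R]_n * measurableTypeR R => a p.1 * \1_B p.2)).
  apply/measurable_EFinP; apply: measurable_funM.
    exact: (measurableT_comp ma measurable_fst).
  apply: (measurableT_comp (f := \1_B : measurableTypeR R -> R)) measurable_snd.
  exact: measurable_indic.
apply/(@integrable12ltyP _ _ _ _ R (leb n) lam _ mp).
rewrite (eq_integral (fun x => `|(a x)%:E| * lam B)%E); last first.
  move=> x _ /=.
  rewrite (eq_integral (fun y => `|a x|%:E * (\1_B y)%:E)%E); last first.
    by move=> y _; rewrite normrM EFinM (ger0_norm (_ : 0 <= \1_B y :> R)).
  by rewrite ge0_integralZl//= ?integral_indic ?setIT//; apply/measurable_EFinP; exact: measurable_indic.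
move: ai => /integrableP[mea aoo].
rewrite ge0_integralZr//; last exact: measurableT_comp.
by apply: lte_mul_pinfty => //; [exact: integral_ge0|rewrite ge0_fin_numE//; exact: integral_ge0].
Qed.

Lemma Fubini_rV (f : 'rV[R]_n.+1 -> R) (phi : 'rV[R]_n -> R) :
  (mu n.+1).-integrable setT (EFin \o f) ->
  (forall x, (\int[lam]_y (f (join_xy x y))%:E = (phi x)%:E)%E) ->
  \int_(z in setT) f z = \int_(x in setT) phi x.
Proof.
move=> fi hphi; have mf := integrable_mfun fi.
pose F (p : 'rV[R]_n * measurableTypeR R) := (f (join_xy p.1 p.2))%:E.
have mF : measurable_fun setT F.
  by apply/measurable_EFinP; exact: (measurableT_comp mf (@measurable_join_xy R n)).
have Fi : (leb n \x lam)%E.-integrable setT F.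
  apply/integrableP; split => //; case/integrableP : fi => _.
  apply: le_lt_trans; rewrite le_eqVlt; apply/orP; left; apply/eqP.
  rewrite [RHS](ge0_integral_pushforward (@measurable_join_xy R n))//.
  by apply: measurableT_comp => //; exact/measurable_EFinP.
congr fine.
rewrite [LHS](integral_pushforward (@measurable_join_xy R n))//; last exact/measurable_EFinP.
rewrite preimage_setT.
rewrite -[LHS](integral12_prod_meas1 Fi); apply: eq_integral => x _.
exact: hphi.
Qed.

End fubini_rV.

(** * Traces as weak derivatives across the bottom *)

Section traces.
Context {R : realType} (n : nat).
Local Notation mu m := (lebesgue_rV R m).
Local Notation lam := (@lebesgue_measure R).
Variable Omega : set 'rV[R]_n.
Hypothesis oOmega : open Omega.

Lemma continuous_xpart : continuous (@xpart R n).
Proof.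
move=> z A /nbhs_ballP[r /= r0 h]; apply/nbhs_ballP; exists r => //= y zy.
apply: h; apply/rV_ballP => // i; rewrite !mxE.
by move: zy => /(rV_ballP _ _ r0); apply.
Qed.

Lemma continuous_ypart : continuous (@ypart R n).
Proof. exact: coord_continuous. Qed.

Definition full_cylinder : set 'rV[R]_n.+1 := [set z | Omega (xpart z)].

Lemma open_full_cylinder : open full_cylinder.
Proof. by apply: open_comp => // z _; exact: continuous_xpart. Qed.

Lemma cylinderE : cylinder Omega = full_cylinder `&` [set z | 0 < ypart z].
Proof. by []. Qed.

Lemma open_cylinder : open (cylinder Omega).
Proof.
rewrite cylinderE; apply: openI; first exact: open_full_cylinder.
rewrite (_ : mkset _ = @ypart R n @^-1` [set t | 0 < t])//.
by apply: open_comp; [move=> z _; exact: continuous_ypart|exact: open_gt].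
Qed.

Lemma join_xy_line (x : 'rV[R]_n) (y : R) :
  join_xy x y = join_xy x 0 + y *: unit_vec R ord_max.
Proof.
apply/rowP => i; rewrite !mxE eqxx /=; case: unliftP => [j|] ->.
  by rewrite eq_sym (negbTE (neq_lift _ _)) mulr0 addr0.
by rewrite eqxx mulr1 add0r.
Qed.

(** Fundamental theorem of calculus on a vertical segment. *)
Lemma Rintegral_partial_y (h : 'rV[R]_n.+1 -> R) (x : 'rV[R]_n) (a : R) :
  smooth h -> a < 0 ->
  (\int[lam]_(y in `[a, 0%R]) (partial ord_max h (join_xy x y))%:E =
   (h (join_xy x 0))%:E - (h (join_xy x a))%:E)%E.
Proof.
move=> sh a0.
have d (k : 'rV[R]_n.+1 -> R) (y : R) : smooth k ->
    is_derive y 1 (fun y => k (join_xy x y)) (partial ord_max k (join_xy x y)).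
  move=> sk; have := is_derive_partial ord_max (join_xy x 0) y sk.
  rewrite -join_xy_line.
  by rewrite (_ : (fun _ => _) = (fun y => k (join_xy x y)))//;
    apply/funext => t; rewrite -join_xy_line.
have c (k : 'rV[R]_n.+1 -> R) : smooth k -> continuous (fun y => k (join_xy x y)).
  move=> sk y; apply: differentiable_continuous; apply/derivable1_diffP.
  by have [] := d k y sk.
apply: (@continuous_FTC2 _ _ (fun y => h (join_xy x y))) => //.
- by apply: continuous_subspaceT; apply: c; exact: smooth_partial.
- split.
  + by move=> y _; have [] := d h y sh.
  + by apply: cvg_at_right_filter; exact: c.
  + by apply: cvg_at_left_filter; exact: c.
- by move=> y _; rewrite derive1E; have [_ ->] := d h y sh.
Qed.

Definition lower_part : set 'rV[R]_n.+1 := [set z | ypart z <= 0].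

Lemma measurable_lower_part : measurable lower_part.
Proof.
apply: closed_measurable_rV; apply: (preimage_closed (f := @ypart R n)
  (D := [set t | t <= 0])); last exact: closed_le.
by move=> z _; exact: continuous_ypart.
Qed.

(** On a compact K the extension t(x) of the trace to y <= 0 is dominated by a
    product of an integrable function of x and the indicator of a segment in
    y. *)
Lemma integrable_below (t : 'rV[R]_n -> R) (K : set 'rV[R]_n.+1) (r : R) :
  locally_integrable_in Omega Omega t -> compact K -> K `<=` full_cylinder ->
  let X := @xpart R n @` K in
  [/\ compact X, X `<=` Omega,
   (mu n).-integrable setT (EFin \o (fun x => t x * \1_X x)) &
   (mu n.+1).-integrable setT (EFin \o (fun z =>
     t (xpart z) * \1_X (xpart z) * \1_(`[r, 0%R]%classic) (ypart z)))].
Proof.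
move=> [_ ti] cK KV X.
have cX : compact X.
  by apply: continuous_compact => //; apply: continuous_subspaceT; exact: continuous_xpart.
have XO : X `<=` Omega by move=> _ [z Kz <-]; exact: KV.
have mX := compact_measurable_rV cX.
have i1 : (mu n).-integrable setT (EFin \o (fun x => t x * \1_X x)).
  apply: (@integrable_mul_indic _ _ R (mu n) _ _ mX).1.
  by have := ti _ cX XO; rewrite setIidr.
split => //; apply: (integrable_prod_rV _ _ i1) => //.
by rewrite lebesgue_measure_itv/=; case: ifP => // _; rewrite -EFinB ltry.
Qed.

(** Integrating first in y, from below the support of h up to y = 0, leaves
    the values of h on the bottom. *)
Lemma boundary_term (t : 'rV[R]_n -> R) (h : 'rV[R]_n.+1 -> R) :
  locally_integrable_in Omega Omega t -> test_function full_cylinder h ->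
  \int_(z in full_cylinder `&` lower_part) (t (xpart z) * partial ord_max h z) =
  \int_(x in Omega) (t x * h (join_xy x 0)).
Proof.
move=> lt th; have [sh _] := th.
have [K [cK KV h0 ph0 [M M0 [hM phM]]]] := test_function_bounded th.
have [r0 Kr0] := compact_sub_cube cK; pose r := `|r0| + 1.
have rgt0 : 0 < r by rewrite ltr_wpDl.
have Kr z : K z -> - r < ypart z.
  move=> Kz; have := Kr0 _ Kz ord_max; rewrite ler_norml => /andP[h1 _].
  by apply: lt_le_trans h1; rewrite ltrN2 /r (le_lt_trans (ler_norm _))// ltrDl.
have [cX XO i1 i2] := integrable_below (- r) lt cK KV.
set X := @xpart R n @` K in cX XO i1 i2.
have -> : \int_(x in Omega) (t x * h (join_xy x 0)) =
    \int_(x in setT) ((t x * \1_X x) * h (join_xy x 0)).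
  apply: Rintegral_compact_support => // x nX; apply: h0 => Kx; apply: nX.
  by exists (join_xy x 0) => //; rewrite xpartK.
transitivity (\int_(z in setT) ((t (xpart z) * \1_X (xpart z) *
   \1_(`[- r, 0%R]%classic) (ypart z)) * partial ord_max h z)).
  rewrite Rintegral_indic; apply: eq_Rintegral => z _.
  have [Kz|nK] := pselect (K z); last by rewrite ph0// !mulr0 mul0r.
  have -> : \1_X (xpart z) = 1 :> R by rewrite indicE mem_set//; exists z.
  have -> : \1_(full_cylinder `&` lower_part) z =
      \1_(`[- r, 0%R]%classic) (ypart z) :> R.
    rewrite !indicE; congr (_ %:R : R); congr nat_of_bool.
    apply/idP/idP; rewrite !inE /= in_itv/=.
      by move=> [_ z0]; rewrite z0 ltW ?Kr.
    by move=> /andP[_ z0]; split => //; exact: KV.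
  by rewrite mulr1 mulrAC.
apply: Fubini_rV.
  apply: (@integrable_bounded_mul _ _ _ _ _ _ _ M) => //.
  by apply: measurable_smooth => //; exact: smooth_partial.
move=> x.
transitivity (\int[lam]_(y in `[(- r)%R, 0%R])
    ((t x * \1_X x) * partial ord_max h (join_xy x y))%:E)%E.
  rewrite [RHS]integral_mkcond; apply: eq_integral => y _.
  rewrite xpartK ypartK patchE.
  have -> : \1_(`[- r, 0%R]%classic) y = (y \in `[- r, 0%R]%classic)%:R :> R.
    by rewrite indicE.
  by case: ifP => _ /=; rewrite ?mulr1// mulr0 mul0r.
under eq_integral do rewrite EFinM.
have ph_i : lam.-integrable `[(- r)%R, 0%R]
    (fun y => (partial ord_max h (join_xy x y))%:E).
  apply: (@integrable_bounded _ _ _ lam _ (fun y => partial ord_max h (join_xy x y)) M) => //.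
  - have : (@lebesgue_measure R `[(- r)%R, 0%R] < +oo)%E; last exact.
    by rewrite lebesgue_measure_itv/=; case: ifP => // _; rewrite -EFinB ltry.
  - apply: measurable_funTS.
    have mph : measurable_fun setT (partial ord_max h).
      by apply: measurable_smooth => //; exact: smooth_partial.
    have mj : measurable_fun setT (fun y : measurableTypeR R => join_xy x y).
      have -> : (fun y : measurableTypeR R => join_xy x y) =
        (fun p : 'rV[R]_n * measurableTypeR R => join_xy p.1 p.2) \o
        (fun y => (x, y)) by [].
      apply: measurableT_comp; [exact: measurable_join_xy|exact: measurable_pair1].
    exact: (measurableT_comp mph mj).
rewrite integralZl// Rintegral_partial_y//; last by rewrite oppr_lt0.
rewrite (h0 (join_xy x (- r))); last first.
  by move=> /Kr; rewrite ypartK ltxx.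
by rewrite sube0 -EFinM.
Qed.

(** The extension of u across the bottom by its trace, constant in y. *)
Definition glue (u : 'rV[R]_n.+1 -> R) (t : 'rV[R]_n -> R) (z : 'rV[R]_n.+1) : R :=
  if 0 < ypart z then u z else t (xpart z).

Lemma full_cylinderE : full_cylinder = cylinder Omega `|` (full_cylinder `&` lower_part).
Proof.
apply/seteqP; split => [z Vz|z [[]//|[]//]].
by have [y0|y0] := ltP 0 (ypart z); [left|right].
Qed.

Lemma disjoint_cylinder_below :
  [disjoint cylinder Omega & full_cylinder `&` lower_part].
Proof.
by apply/disj_setPS => z [[_ y0] [_]]; rewrite /lower_part /= leNgt y0.
Qed.

Lemma measurable_glue u t : measurable_fun (cylinder Omega) u ->
  measurable_fun Omega t -> measurable_fun full_cylinder (glue u t).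
Proof.
move=> mu_u mt.
have mV := open_measurable_rV open_full_cylinder.
have mC := open_measurable_rV open_cylinder.
have mL := measurable_lower_part.
rewrite full_cylinderE; apply/measurable_funU => //; first exact: measurableI.
split.
  apply: eq_measurable_fun mu_u => z; rewrite inE => -[_ y0].
  by rewrite /glue y0.
apply: (eq_measurable_fun (t \o @xpart R n)).
  by move=> z; rewrite inE => -[_]; rewrite /lower_part /= leNgt /glue => /negbTE ->.
apply: (measurable_comp (open_measurable_rV oOmega)) => //.
  by move=> _ [z [Vz _] <-].
exact: measurable_funTS (@measurable_xpart R n).
Qed.

Lemma locally_integrable_glue u t :
  locally_integrable_in full_cylinder (cylinder Omega) u ->
  locally_integrable_in Omega Omega t ->
  locally_integrable_in full_cylinder full_cylinder (glue u t).
Proof.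
move=> [mu_u ui] lt; have [mt _] := lt.
have mV := open_measurable_rV open_full_cylinder.
have mC := open_measurable_rV open_cylinder.
have mL := measurable_lower_part.
have mg := measurable_glue mu_u mt.
split => // K cK KV; have mK := compact_measurable_rV cK.
have [r0 Kr0] := compact_sub_cube cK; pose r := - (`|r0| + 1).
have Kr z : K z -> r < ypart z.
  move=> Kz; have := Kr0 _ Kz ord_max; rewrite ler_norml => /andP[h1 _].
  by apply: lt_le_trans h1; rewrite ltrN2 (le_lt_trans (ler_norm _))// ltrDl.
have [cX XO i1 i2] := integrable_below r lt cK KV.
set X := @xpart R n @` K in cX XO i1 i2.
have mCK : measurable (cylinder Omega `&` K) by exact: measurableI.
have i3 := (@integrable_mul_indic _ _ R (mu n.+1) _ _ mCK).1 (ui _ cK KV).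
have mVK : measurable (full_cylinder `&` K) by exact: measurableI.
apply: (@integrable_le _ _ _ _ _ _ (fun z => `|u z * \1_(cylinder Omega `&` K) z| +
   `|t (xpart z) * \1_X (xpart z) * \1_(`[r, 0%R]%classic) (ypart z)|)) => //.
- exact: measurable_funS mg.
- move=> z [Vz Kz]; rewrite /glue; have [y0|y0] := ltP 0 (ypart z).
    rewrite indicE mem_set ?mulr1//.
    by rewrite lerDl.
  have -> : \1_X (xpart z) = 1 :> R by rewrite indicE mem_set//; exists z.
  rewrite [X in _ * _ * X]indicE mem_set ?mulr1 ?lerDr//=.
  by rewrite in_itv/= y0 ltW ?Kr.
- apply: integrableS (integrable_add measurableT (integrable_norm measurableT i3)
    (integrable_norm measurableT i2)) => //.
Qed.

Lemma Rintegral_glue u t h i :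
  locally_integrable_in full_cylinder (cylinder Omega) u ->
  locally_integrable_in Omega Omega t -> test_function full_cylinder h ->
  \int_(z in full_cylinder) (glue u t z * partial i h z) =
  \int_(z in cylinder Omega) (u z * partial i h z) +
  \int_(z in full_cylinder `&` lower_part) (t (xpart z) * partial i h z).
Proof.
move=> lu lt th.
have mV := open_measurable_rV open_full_cylinder.
have mC := open_measurable_rV open_cylinder.
have mL := measurable_lower_part.
have := integrable_test_partial i mV (locally_integrable_glue lu lt) th.
rewrite {1 2}full_cylinderE => gi.
rewrite Rintegral_setU//; [|exact: measurableI|exact: disjoint_cylinder_below].
congr (_ + _); apply: eq_Rintegral => z; rewrite inE.
  by move=> [_ y0]; rewrite /glue y0.
by move=> [_]; rewrite /lower_part /= leNgt /glue => /negbTE ->.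
Qed.

Lemma Rintegral_glue0 g h :
  \int_(z in full_cylinder) (glue g (fun=> 0) z * h z) =
  \int_(z in cylinder Omega) (g z * h z).
Proof.
rewrite Rintegral_indic [RHS]Rintegral_indic; apply: eq_Rintegral => z _.
rewrite cylinderE indicI /= [X in _ * (_ * X)]indicE /glue.
have [y0|y0] := ltP 0 (ypart z).
  by rewrite mem_set// mulr1.
by rewrite memNset /= ?mulr0 ?mul0r//; apply/negP; rewrite -leNgt.
Qed.

(** Glueing the trace below y = 0 turns the Gauss-Green formula that defines
    traces into a weak derivative on the full cylinder: the glued function has
    a weak derivative in y without singular part on y = 0 exactly when the two
    sides match. *)
Lemma trace_weak_partial u g t :
  locally_integrable_in full_cylinder (cylinder Omega) u ->
  locally_integrable_in full_cylinder (cylinder Omega) g ->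
  locally_integrable_in Omega Omega t ->
  (forall h, test_function full_cylinder h ->
    \int_(z in cylinder Omega) (u z * partial ord_max h z + g z * h z)
    = - \int_(x in Omega) (t x * h (join_xy x 0))) <->
  weak_partial ord_max full_cylinder (glue u t) (glue g (fun=> 0)).
Proof.
move=> lu lg lt; have mC := open_measurable_rV open_cylinder.
have E h : test_function full_cylinder h ->
    \int_(z in cylinder Omega) (u z * partial ord_max h z + g z * h z) =
    \int_(z in cylinder Omega) (u z * partial ord_max h z) +
    \int_(z in cylinder Omega) (g z * h z).
  move=> th; rewrite RintegralD//.
  - exact: integrable_test_partial th.
  - exact: integrable_test_function th.
split => H h th; have := H h th.
  rewrite E// => h1; rewrite Rintegral_glue// boundary_term// Rintegral_glue0.
  by move: h1; lra.
rewrite Rintegral_glue// boundary_term// Rintegral_glue0 E// => h1.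
by move: h1; lra.
Qed.

(** The chain rule on the full cylinder, applied to the glued function: taking
    positive parts commutes with glueing. *)
Lemma is_trace_pos_part u G t c : is_trace Omega u G t ->
  is_trace Omega (pos_part c u) (fun i z => above c u z * G i z) (pos_part c t).
Proof.
move=> [lu lg lt tr].
have mV := open_measurable_rV open_full_cylinder.
have mC := open_measurable_rV open_cylinder.
have mO := open_measurable_rV oOmega.
have mu_u : measurable_fun (cylinder Omega) u by case: lu.
have lw := locally_integrable_pos_part c mC lu.
have lag := locally_integrable_above c mC mu_u lg.
have lwt := locally_integrable_pos_part c mO lt.
have l0 : locally_integrable_in Omega Omega (fun=> 0 : R).
  apply: (@locally_integrable_cst_bounded _ _ _ _ _ 0) => // x _.
  by rewrite normr0.
split => //; apply/trace_weak_partial => //.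
have := (trace_weak_partial lu lg lt).1 tr.
move/(weak_pos_part c open_full_cylinder (locally_integrable_glue lu lt)
  (locally_integrable_glue lg l0)).
congr (weak_partial _ _ _ _); apply/funext => z; rewrite /glue /pos_part /above.
  by case: ifP.
by case: ifP => // _; rewrite mulr0.
Qed.

End traces.

(** * Linear combinations and cutoffs *)

Section weak_calculus.
Context {R : realType}.
Local Notation mu m := (lebesgue_rV R m).

Section any_dimension.
Variable m : nat.
Implicit Types (U V : set 'rV[R]_m) (u w : 'rV[R]_m -> R).

Lemma locally_integrable_lin U V u w (a b : R) : measurable U ->
  locally_integrable_in V U u -> locally_integrable_in V U w ->
  locally_integrable_in V U (fun x => a * u x + b * w x).
Proof.
move=> mU [mu_u ui] [mw wi]; split.
  by apply: measurable_funD; apply: measurable_funM.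
move=> K cK KV; have mUK : measurable (U `&` K).
  by apply: measurableI => //; exact: compact_measurable_rV.
by apply: integrable_add => //; apply: integrable_scale => //; [exact: ui|exact: wi].
Qed.

Lemma locally_integrable_smoothM U V u k : measurable U -> smooth k ->
  locally_integrable_in V U u -> locally_integrable_in V U (fun x => k x * u x).
Proof.
move=> mU sk [mu_u ui]; split.
  by apply: measurable_funM => //; exact: measurable_smooth.
move=> K cK KV; have mUK : measurable (U `&` K).
  by apply: measurableI => //; exact: compact_measurable_rV.
have /compact_bounded[M [_ hM]] : compact (k @` K).
  apply: continuous_compact => //; apply: continuous_subspaceT.
  exact: smooth_continuous.
rewrite (_ : _ \o _ = EFin \o (fun x => u x * k x)); last first.
  by apply/funext => x /=; rewrite mulrC.
apply: (@integrable_bounded_mul _ _ _ _ _ _ _ (M + 1)) => //; last exact: ui.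
- exact: measurable_smooth.
- by move=> x [_ Kx]; apply: hM; [rewrite ltrDl|exists x].
Qed.

Lemma weak_gradient_lin U u1 G1 u2 G2 (a b : R) : open U ->
  weak_gradient U u1 G1 -> weak_gradient U u2 G2 ->
  weak_gradient U (fun x => a * u1 x + b * u2 x)
    (fun i x => a * G1 i x + b * G2 i x).
Proof.
move=> oU [l1 g1 w1] [l2 g2 w2]; have mU := open_measurable_rV oU.
split; first exact: locally_integrable_lin.
  by move=> i; exact: locally_integrable_lin.
move=> i h th.
transitivity (a * \int_(x in U) (u1 x * partial i h x) +
    b * \int_(x in U) (u2 x * partial i h x)).
  have i1 := integrable_test_partial i mU l1 th.
  have i2 := integrable_test_partial i mU l2 th.
  rewrite -!RintegralZl// -RintegralD//; try exact: integrable_scale.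
  by apply: eq_Rintegral => x _; ring.
rewrite w1// w2//.
have i1 := integrable_test_function mU (g1 i) th.
have i2 := integrable_test_function mU (g2 i) th.
rewrite !mulrN -opprD; congr (- _).
rewrite -!RintegralZl// -RintegralD//; try exact: integrable_scale.
by apply: eq_Rintegral => x _; ring.
Qed.

(** Leibniz rule: test the weak gradient of u against k h. *)
Lemma weak_gradient_smoothM U u G k : open U -> smooth k ->
  weak_gradient U u G ->
  weak_gradient U (fun x => k x * u x)
    (fun i x => k x * G i x + partial i k x * u x).
Proof.
move=> oU sk [lu lG w]; have mU := open_measurable_rV oU.
have lku := locally_integrable_smoothM mU sk lu.
have lpu i := locally_integrable_smoothM mU (smooth_partial i sk) lu.
have lkG i := locally_integrable_smoothM mU sk (lG i).
split => // [i|i h th].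
  rewrite (_ : (fun x => _) = fun x => 1 * (k x * G i x) + 1 * (partial i k x * u x)).
    exact: locally_integrable_lin.
  by apply/funext => x; rewrite !mul1r.
have [sh _] := th.
have := w i _ (test_functionM sk th).
have i1 := integrable_test_partial i mU lku th.
have i2 := integrable_test_function mU (lpu i) th.
have i3 := integrable_test_function mU (lkG i) th.
have -> : \int_(x in U) (u x * partial i (fun x => k x * h x) x) =
    \int_(x in U) (k x * u x * partial i h x) +
    \int_(x in U) (partial i k x * u x * h x).
  rewrite -RintegralD//; apply: eq_Rintegral => x _.
  by rewrite partialM//; ring.
have -> : \int_(x in U) (G i x * (k x * h x)) = \int_(x in U) (k x * G i x * h x).
  by apply: eq_Rintegral => x _; ring.
have -> : \int_(x in U) ((k x * G i x + partial i k x * u x) * h x) =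
    \int_(x in U) (k x * G i x * h x) + \int_(x in U) (partial i k x * u x * h x).
  by rewrite -RintegralD//; apply: eq_Rintegral => x _; ring.
by move=> E; lra.
Qed.

End any_dimension.

Section trace_calculus.
Variables (n : nat) (Omega : set 'rV[R]_n).
Hypothesis oOmega : open Omega.

Lemma is_trace_lin u1 G1 t1 u2 G2 t2 (a b : R) :
  is_trace Omega u1 G1 t1 -> is_trace Omega u2 G2 t2 ->
  is_trace Omega (fun z => a * u1 z + b * u2 z)
    (fun i z => a * G1 i z + b * G2 i z) (fun x => a * t1 x + b * t2 x).
Proof.
move=> [l1 g1 lt1 w1] [l2 g2 lt2 w2].
have mC := open_measurable_rV (open_cylinder oOmega).
have mO := open_measurable_rV oOmega.
have mV := open_measurable_rV (open_full_cylinder oOmega).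
split; [exact: locally_integrable_lin..|move=> h th].
have I1 : (mu n.+1).-integrable (cylinder Omega)
    (EFin \o (fun z => u1 z * partial ord_max h z + G1 ord_max z * h z)).
  apply: integrable_add => //; first exact: integrable_test_partial th.
  exact: integrable_test_function th.
have I2 : (mu n.+1).-integrable (cylinder Omega)
    (EFin \o (fun z => u2 z * partial ord_max h z + G2 ord_max z * h z)).
  apply: integrable_add => //; first exact: integrable_test_partial th.
  exact: integrable_test_function th.
transitivity (a * \int_(z in cylinder Omega)
      (u1 z * partial ord_max h z + G1 ord_max z * h z) +
    b * \int_(z in cylinder Omega)
      (u2 z * partial ord_max h z + G2 ord_max z * h z)).
  rewrite -!RintegralZl// -RintegralD//; try exact: integrable_scale.
  by apply: eq_Rintegral => x _; ring.
have It t : locally_integrable_in Omega Omega t ->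
    (mu n).-integrable Omega (EFin \o (fun x => t x * h (join_xy x 0))).
  move=> lt; have [K [cK KV h0 _ [M _ [hM _]]]] := test_function_bounded th.
  have [cX XO _ _] := integrable_below 0 lt cK KV.
  apply: (integrable_compact_support (M := M) mO cX XO lt) => //.
  - apply: (measurable_funS measurableT) => //.
    have mh : measurable_fun setT h by apply: measurable_smooth => //; case: th.
    apply: (measurableT_comp mh).
    have -> : (fun x : 'rV[R]_n => join_xy x 0) =
      (fun p : 'rV[R]_n * measurableTypeR R => join_xy p.1 p.2) \o
      (fun x => (x, 0 : measurableTypeR R)) by [].
    by apply: measurableT_comp; [exact: measurable_join_xy|exact: measurable_pair2].
  - by move=> x nX; apply: h0 => Kx; apply: nX; exists (join_xy x 0) => //; rewrite xpartK.
rewrite w1// w2// !mulrN -opprD; congr (- _).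
rewrite -!RintegralZl//; try exact: It.
rewrite -RintegralD//; try by apply: integrable_scale => //; exact: It.
by apply: eq_Rintegral => x _; ring.
Qed.

Lemma is_trace_smoothM u G t k : smooth k -> (forall x, k (join_xy x 0) = 1) ->
  is_trace Omega u G t ->
  is_trace Omega (fun z => k z * u z)
    (fun i z => k z * G i z + partial i k z * u z) t.
Proof.
move=> sk k1 [lu lG lt w].
have mC := open_measurable_rV (open_cylinder oOmega).
split => //; first exact: locally_integrable_smoothM.
  rewrite (_ : (fun z => _) = fun z => 1 * (k z * G ord_max z) +
      1 * (partial ord_max k z * u z)).
    apply: locally_integrable_lin => //.
      exact: locally_integrable_smoothM.
    by apply: locally_integrable_smoothM => //; exact: smooth_partial.
  by apply/funext => x; rewrite !mul1r.
move=> h th; have [sh _] := th.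
have := w _ (test_functionM sk th) => E.
have -> : \int_(x in Omega) (t x * h (join_xy x 0)) =
    \int_(x in Omega) (t x * (k (join_xy x 0) * h (join_xy x 0))).
  by apply: eq_Rintegral => x _; rewrite k1 mul1r.
rewrite -E; apply: eq_Rintegral => z _.
by rewrite partialM//; ring.
Qed.

End trace_calculus.

(** The cutoff is e * exp(-1/(1 - y/N)) for y < N. As N grows its derivative
    is of size 1/N on a set of height N, so the square of the derivative has
    an integral of order 1/N. *)
Lemma vertical_cutoff n : exists2 Kc : R, 0 <= Kc &
  forall N : R, 0 < N -> exists k : 'rV[R]_n.+1 -> R,
  [/\ smooth k, (forall z, 0 < ypart z -> 0 <= k z <= 1) /\
        (forall z, N <= ypart z -> k z = 0),
      forall x, k (join_xy x 0) = 1,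
      forall j z, j != ord_max -> partial j k z = 0 &
      forall z, 0 < ypart z ->
        `|partial ord_max k z| <= Kc / N * (ypart z < N)%R%:R].
Proof.
have [M M0 hM] := @flat_le R ('X^2 * (1 - 1^`())).
exists (expR 1 * M); first by rewrite mulr_ge0// expR_ge0.
move=> N N0; pose arg (z : 'rV[R]_n.+1) := - N^-1 * z ord0 ord_max + 1.
exists (fun z => expR 1 * flat 1 (arg z)).
have sf : smooth (fun z : 'rV[R]_n.+1 => flat 1 (arg z)) by exact: smooth_flat_coord.
have pk j z : partial j (fun z => expR 1 * flat 1 (arg z)) z =
    expR 1 * ((- N^-1 *+ (ord_max == j)) * flat ('X^2 * (1 - 1^`())) (arg z)).
  rewrite partialM//; last exact: smooth_cst.
  rewrite [partial j (fun=> expR 1) z](_ : _ = 0); last exact: derive_cst.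
  rewrite mulr0 addr0; congr (_ * _).
  by have [_ E] := is_derive_flat_coord ord_max (- N^-1) 1 1 j z; exact: E.
have argN z : N <= ypart z -> arg z <= 0.
  by move=> Nz; rewrite /arg mulNr addrC subr_le0 mulrC ler_pdivlMr// mul1r.
have arg1 z : 0 < ypart z -> arg z <= 1.
  by move=> z0; rewrite /arg mulNr gerDr oppr_le0 mulr_ge0 ?invr_ge0 ?ltW.
split.
- by apply: smoothM => //; exact: smooth_cst.
- split => [z z0|z Nz]; last by rewrite flat1_le0 ?mulr0// argN.
  have /andP[f0 f1] := flat1_itv (arg z).
  rewrite mulr_ge0 ?expR_ge0//=.
  have [a0|a0] := leP (arg z) 0; first by rewrite flat1_le0// mulr0.
  rewrite /flat a0 hornerC mul1r -expRD -[leRHS]expR0 ler_expR subr_le0.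
  by rewrite invf_ge1// arg1.
- move=> x; rewrite /arg (_ : join_xy x 0 ord0 ord_max = 0); last exact: (ypartK x 0).
  by rewrite mulr0 add0r /flat ltr01 hornerC mul1r invr1 -expRD subrr expR0.
- move=> j z jm; rewrite pk eq_sym (negbTE jm) mulr0n mul0r mulr0 //.
- move=> z z0; rewrite pk eqxx mulr1n.
  have [zN|Nz] := ltP (ypart z) N; last first.
    rewrite /flat ifF; first by rewrite !mulr0 normr0.
    by apply/negbTE; rewrite -leNgt argN.
  have fM : `|flat ('X^2 * (1 - 1^`())) (arg z)| <= M.
    apply: le_trans (hM _) _; rewrite ler_piMr// expr_le1 ?arg1//.
    rewrite /arg mulNr addrC subr_ge0 mulrC ler_pdivrMr// mul1r.
    exact: ltW.
  have iN0 : 0 <= N^-1 by rewrite invr_ge0 ltW.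
  rewrite /= mulr1 !normrM (ger0_norm (expR_ge0 _)) normrN (ger0_norm iN0).
  have -> : expR 1 * M / N = expR 1 * (N^-1 * M) by ring.
  by rewrite ler_wpM2l ?expR_ge0// ler_wpM2l.
Qed.

End weak_calculus.

(** * The truncated energy inequality *)

Section energy.
Context {R : realType} (n : nat).
Local Notation mu m := (lebesgue_rV R m).

(** The truncation min((u - c)^+, M), written as a difference of positive
    parts so that the chain rule applies by linearity. *)
Definition trunc m (c M : R) (u : 'rV[R]_m -> R) (x : 'rV[R]_m) : R :=
  1 * pos_part c u x + -1 * pos_part (c + M) u x.

(** The indicator of c < u <= c + M, where the gradient of the truncation is
    that of u. *)
Definition band m (c M : R) (u : 'rV[R]_m -> R) (x : 'rV[R]_m) : R :=
  above c u x - above (c + M) u x.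

Lemma trunc_itv m c M (u : 'rV[R]_m -> R) x : 0 <= M -> 0 <= trunc c M u x <= M.
Proof.
move=> M0; rewrite /trunc /pos_part mul1r mulN1r.
have [h1|h1] := lerP (u x - c) 0; have [h2|h2] := lerP (u x - (c + M)) 0; lra.
Qed.

Lemma band_01 m c M (u : 'rV[R]_m -> R) x : 0 <= M ->
  band c M u x = 0 \/ band c M u x = 1.
Proof.
move=> M0; rewrite /band /above.
have [h1|h1] := ltP c (u x); have [h2|h2] := ltP (c + M) (u x) => /=;
  rewrite ?subrr ?subr0; [by left|by right| |by left].
by exfalso; move: (lt_le_trans h2 h1); rewrite gtrDl ltNge M0.
Qed.

Lemma measurable_trunc m D c M (u : 'rV[R]_m -> R) : measurable D ->
  measurable_fun D u -> measurable_fun D (trunc c M u).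
Proof.
move=> mD mu_u; apply: measurable_funD; apply: measurable_funM => //;
  exact: measurable_pos_part.
Qed.

Lemma integrable_sum_ord d (T : measurableType d) (nu : {measure set T -> \bar R})
    (D : set T) k (F : 'I_k -> T -> R) : measurable D ->
  (forall i, nu.-integrable D (EFin \o F i)) ->
  nu.-integrable D (EFin \o (fun x => \sum_(i < k) F i x)).
Proof.
move=> mD Fi.
have -> : EFin \o (fun x => \sum_(i < k) F i x) =
    (fun x => \sum_(i <- index_enum 'I_k) (F i x)%:E)%E.
  by apply/funext => x; rewrite /= sumEFin.
apply: integrable_sum => // i _; exact: Fi.
Qed.

Variable Omega : set 'rV[R]_n.
Hypothesis oOmega : open Omega.
Hypothesis finOmega : (mu n Omega < +oo)%E.

Let mC := open_measurable_rV (open_cylinder oOmega).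
Let mO := open_measurable_rV oOmega.

Definition slab (N : R) : set 'rV[R]_n.+1 :=
  [set z | Omega (xpart z) /\ `]0, N[%classic (ypart z)].

Lemma measurable_slab N : measurable (slab N).
Proof.
rewrite /slab (_ : mkset _ = @xpart R n @^-1` Omega `&` @ypart R n @^-1` `]0, N[%classic)//.
apply: measurableI.
  by rewrite -[X in measurable X]setTI; exact: measurable_xpart.
by rewrite -[X in measurable X]setTI; exact: measurable_ypart.
Qed.

Lemma lebesgue_slab N : 0 < N -> mu n.+1 (slab N) = (mu n Omega * N%:E)%E.
Proof.
move=> N0; rewrite /slab lebesgue_rV_prod//; congr (_ * _)%E.
by rewrite lebesgue_measure_itv/= lte_fin N0 sube0.
Qed.

Lemma integrable_slab N : 0 < N ->
  (mu n.+1).-integrable (cylinder Omega) (EFin \o (\1_(slab N) : _ -> R)).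
Proof.
move=> N0; apply: (@integrableS _ _ _ _ setT) => //.
apply: integrable_indic_finite; first exact: measurable_slab.
by rewrite lebesgue_slab// lte_mul_pinfty ?ge0_fin_numE ?ltry.
Qed.

Lemma Rintegral_slab N : 0 < N ->
  \int_(z in cylinder Omega) (\1_(slab N) z : R) = fine (mu n Omega) * N.
Proof.
move=> N0; rewrite /Rintegral integral_indic//; last exact: measurable_slab.
rewrite (_ : slab N `&` cylinder Omega = slab N); last first.
  apply/seteqP; split => [z []//|z [Oz]]; rewrite /= in_itv/= => /andP[y0 yN].
  by split; split => //; rewrite /= in_itv/= y0.
by rewrite lebesgue_slab// fineM// ge0_fin_numE.
Qed.

(** The core of the argument. The equation and the stability inequality are
    tested with one function, h = k w, where w is the truncation of u between
    the levels c and c + M and k the cutoff at height N. Since grad w is grad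
    u or 0 and 0 <= k <= 1, |grad h|^2 exceeds grad u . grad h only by terms
    that contain the derivative of k; these vanish as N grows because w is
    bounded and Omega has finite measure. *)
Lemma truncated_energy_ge0 (u : 'rV[R]_n.+1 -> R) (G : 'I_n.+1 -> 'rV[R]_n.+1 -> R)
    (v : 'rV[R]_n -> R) (f f1 : R -> R) (c M : R) :
  weak_gradient (cylinder Omega) u G -> is_trace Omega u G v ->
  (forall i, L2 (cylinder Omega) (G i)) ->
  (forall h H s, H_cylinder Omega h H s ->
    \int_(z in cylinder Omega) dot G H z - \int_(x in Omega) (f (v x) * s x) = 0) ->
  (forall h H s, stability_class Omega h H s ->
    0 <= \int_(z in cylinder Omega) dot H H z -
         \int_(x in Omega) (f1 (v x) * s x ^+ 2)) ->
  0 <= M ->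
  0 <= \int_(x in Omega) (f (v x) * trunc c M v x) -
       \int_(x in Omega) (f1 (v x) * trunc c M v x ^+ 2).
Proof.
move=> wG tr GL2 heq hst M0; set C := cylinder Omega.
set I := (X in 0 <= X).
have mu_u : measurable_fun C u by case: tr => -[].
have mv : measurable_fun Omega v by case: tr => _ _ [].
pose w := trunc c M u; pose s := trunc c M v.
pose Gw (i : 'I_n.+1) (z : 'rV[R]_n.+1) : R :=
  1 * (above c u z * G i z) + -1 * (above (c + M) u z * G i z).
have GwE i z : Gw i z = band c M u z * G i z by rewrite /Gw /band; ring.
have wgw : weak_gradient C w Gw.
  apply: weak_gradient_lin; first exact: open_cylinder.
    by apply: weak_gradient_pos_part => //; exact: open_cylinder.
  by apply: weak_gradient_pos_part => //; exact: open_cylinder.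
have trw : is_trace Omega w Gw s.
  by apply: is_trace_lin => //; exact: is_trace_pos_part.
have w_itv z : 0 <= w z <= M by exact: trunc_itv.
have mw : measurable_fun C w by exact: measurable_trunc.
have mG i : measurable_fun C (G i) by have [] := GL2 i.
have Gi2 i : (mu n.+1).-integrable C (EFin \o (fun z => G i z ^+ 2)).
  by have [] := GL2 i.
have sL2 : L2 Omega s.
  have ms : measurable_fun Omega s by exact: measurable_trunc.
  split => //; apply: (@integrable_bounded _ _ _ _ _ _ (M ^+ 2)) => //.
    exact: measurable_funX.
  move=> x _; have /andP[s0 sM] := trunc_itv c v x M0.
  by rewrite normrX lerXn2r ?nnegrE// ger0_norm.
have [Kc Kc0 hK] := vertical_cutoff (R := R) n.
set A := \int_(z in C) (G ord_max z ^+ 2).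
pose B := (Kc * M) ^+ 2 * fine (mu n Omega).
have A0 : 0 <= A by apply: Rintegral_ge0 => z _; exact: sqr_ge0.
have B0 : 0 <= B by rewrite mulr_ge0 ?sqr_ge0// fine_ge0.
suff main : forall e N : R, 0 < e -> 0 < N ->
    0 <= I + e * A + ((4 * e)^-1 + 1) * (B / N).
  rewrite leNgt; apply/negP => I0.
  (* Were I negative, each of the two error terms could be made smaller than
     |I| / 4. *)
  pose e := - I / (4 * (A + 1)).
  have e0 : 0 < e by rewrite divr_gt0 ?oppr_gt0// mulr_gt0// ltr_wpDl.
  pose q := (4 * e)^-1 + 1.
  have q0 : 0 < q by rewrite addr_gt0// invr_gt0 mulr_gt0.
  pose N := q * (B + 1) * 4 / (- I).
  have N0 : 0 < N by rewrite divr_gt0 ?oppr_gt0// !mulr_gt0// ltr_wpDl.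
  have := main e N e0 N0; rewrite -/q; apply/negP; rewrite -ltNge.
  have h1 : e * A <= - I / 4.
    rewrite /e (_ : - I / (4 * (A + 1)) * A = (- I / 4) * (A / (A + 1))); last first.
      by field; rewrite gt_eqF// ltr_wpDl.
    rewrite ler_piMr//; first by rewrite divr_ge0// oppr_ge0 ltW.
    by rewrite ler_pdivrMr ?mul1r ?lerDl// ltr_wpDl.
  have h2 : q * (B / N) <= - I / 4.
    rewrite /N (_ : q * (B / (q * (B + 1) * 4 / - I)) = (- I / 4) * (B / (B + 1))); last first.
      have In0 : I != 0 by rewrite lt_eqF.
      have qn0 : q != 0 by rewrite gt_eqF.
      have Bn0 : B + 1 != 0 by rewrite gt_eqF// ltr_wpDl.
      by field; rewrite ?In0 ?qn0 ?Bn0.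
    rewrite ler_piMr//; first by rewrite divr_ge0// oppr_ge0 ltW.
    by rewrite ler_pdivrMr ?mul1r ?lerDl// ltr_wpDl.
  by lra.
move=> e N e0 N0.
have [k [sk [k01 kN] k1 kj kmax]] := hK N N0.
pose h z := k z * w z.
pose H (i : 'I_n.+1) z := k z * Gw i z + partial i k z * w z.
have wgh : weak_gradient C h H.
  by apply: weak_gradient_smoothM => //; exact: open_cylinder.
have trh : is_trace Omega h H s by exact: is_trace_smoothM.
have mk : measurable_fun C k by exact: measurable_smooth.
have mpk i : measurable_fun C (partial i k).
  by apply: measurable_smooth => //; exact: smooth_partial.
have mh : measurable_fun C h by exact: measurable_funM.
have mH i : measurable_fun C (H i).
  apply: measurable_funD; apply: measurable_funM => //.
  by have [_ + _] := wgw; move=> /(_ i)[].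
pose b := Kc * M / N.
have b0 : 0 <= b by rewrite divr_ge0 ?mulr_ge0// ltW.
have slabE z : C z -> \1_(slab N) z = (ypart z < N)%R%:R :> R.
  move=> [Oz y0]; rewrite indicE; congr (_ %:R); congr nat_of_bool.
  apply/idP/idP; rewrite inE /slab /= in_itv/= ?y0/=; first by case.
  by move=> yN; split => //; rewrite y0.
have bnd i z : C z -> (partial i k z * w z) ^+ 2 <= b ^+ 2 * \1_(slab N) z.
  move=> Cz; have [_ y0] := Cz; have /andP[w0 wM] := w_itv z.
  have [->|im] := eqVneq i ord_max; last first.
    by rewrite kj// mul0r expr0n mulr_ge0 ?sqr_ge0//; have /andP[] := indic_itv01 (slab N) z.
  rewrite slabE//; have := kmax z y0; case: (ltP (ypart z) N) => _ /=.
    rewrite !mulr1 => hk; rewrite -[X in X <= _]real_normK ?num_real//.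
    rewrite lerXn2r ?nnegrE// normrM (ger0_norm w0) /b mulrAC.
    exact: ler_pM.
  by rewrite !mulr0 normr_le0 => /eqP ->; rewrite mul0r expr0n.
have is_ := integrable_slab N0.
have H2i i : (mu n.+1).-integrable C (EFin \o (fun z => H i z ^+ 2)).
  apply: (@integrable_le _ _ _ _ _ _
    (fun z => 2 * G i z ^+ 2 + (2 * b ^+ 2) * \1_(slab N) z)) => //.
  - exact: measurable_funX.
  - move=> z Cz; rewrite ger0_norm ?sqr_ge0//.
    have := bnd i z Cz; set p := partial i k z * w z.
    have : (k z * Gw i z) ^+ 2 <= G i z ^+ 2.
      have [_ y0] := Cz; have /andP[k0 k1'] := k01 z y0.
      rewrite GwE mulrA exprMn ler_piMl ?sqr_ge0//.
      have [->|->] := band_01 c u z M0; first by rewrite mulr0 expr0n ler01.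
      by rewrite mulr1 expr_le1.
    rewrite /H -/p; set q := k z * Gw i z => h1 h2.
    have := sqr_ge0 (q - p); move: h1 h2; rewrite sqrrB sqrrD mulr2n.
    by rewrite -!mulrA; lra.
  - by apply: integrable_add => //; exact: integrable_scale.
have HL2 i : L2 C (H i) by split; [exact: mH|exact: H2i].
have hst_class : stability_class Omega h H s.
  split => //; exists N; apply: aeW => z _ Nz.
  by rewrite /h kN ?mul0r// ltW.
have hL2 : L2 C h.
  split => //; apply: (@integrable_le _ _ _ _ _ _ (fun z => M ^+ 2 * \1_(slab N) z)) => //.
  - exact: measurable_funX.
  - move=> z Cz; rewrite ger0_norm ?sqr_ge0// slabE//.
    have [_ y0] := Cz; have /andP[k0 k1'] := k01 z y0; have /andP[w0 wM] := w_itv z.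
    have [_|Nz] /= := ltP (ypart z) N; last by rewrite /h kN// mul0r expr0n mulr0.
    rewrite mulr1 lerXn2r ?nnegrE ?mulr_ge0//.
    by apply: le_trans wM; rewrite ler_piMl.
  - exact: integrable_scale.
have hH : H_cylinder Omega h H s.
  split => //; exists (fun=> h), (fun=> H), (fun=> s); split => //.
  - rewrite (_ : (fun _ => _) = fun=> 0); first exact: cvg_cst.
    apply/funext => _; rewrite (@eq_Rintegral _ _ _ _ _ (fun=> 0)).
      by rewrite Rintegral_cst// mul0r.
    by move=> z _; rewrite big1// => i _; rewrite subrr expr0n.
  - rewrite (_ : (fun _ => _) = fun=> 0); first exact: cvg_cst.
    apply/funext => _; rewrite (@eq_Rintegral _ _ _ _ _ (fun=> 0)).
      by rewrite Rintegral_cst// mul0r.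
    by move=> z _; rewrite subrr expr0n.
have E1 := heq _ _ _ hH; have E2 := hst _ _ _ hst_class.
have sumk z : \sum_(i < n.+1) G i z * partial i k z =
    G ord_max z * partial ord_max k z.
  rewrite (bigD1 ord_max)//= big1 ?addr0// => i im.
  by rewrite kj// mulr0.
have sumk2 z : \sum_(i < n.+1) (partial i k z) ^+ 2 = (partial ord_max k z) ^+ 2.
  rewrite (bigD1 ord_max)//= big1 ?addr0// => i im.
  by rewrite kj// expr0n.
pose a z := partial ord_max k z * w z.
pose G2 z := \sum_(i < n.+1) G i z ^+ 2.
have dGH z : dot G H z = k z * band c M u z * G2 z + a z * G ord_max z.
  rewrite /dot /H /G2 /a (_ : partial ord_max k z * w z * G ord_max z =
    w z * (G ord_max z * partial ord_max k z)); last by ring.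
  rewrite -sumk !mulr_sumr -big_split/=.
  by apply: eq_bigr => i _; rewrite GwE; ring.
have dHH z : dot H H z = (k z * band c M u z) ^+ 2 * G2 z +
    2 * (k z * band c M u z) * (a z * G ord_max z) + a z ^+ 2.
  rewrite /dot /H /G2 /a [(partial ord_max k z * w z) ^+ 2]exprMn -sumk2.
  rewrite (_ : partial ord_max k z * w z * G ord_max z =
    w z * (G ord_max z * partial ord_max k z)); last by ring.
  rewrite -sumk !mulr_sumr mulr_suml -!big_split/=.
  by apply: eq_bigr => i _; rewrite GwE; ring.
(* With p = k * band in [0, 1], p^2 <= p handles |grad u|^2 and Young's
   inequality with parameter e handles the mixed term. *)
have key z : C z -> dot H H z <= dot G H z + (e * G ord_max z ^+ 2 +
    ((4 * e)^-1 + 1) * (b ^+ 2 * \1_(slab N) z)).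
  move=> Cz; have [_ y0] := Cz; have /andP[k0 k1'] := k01 z y0.
  have ab := bnd ord_max z Cz; rewrite dHH dGH -/(a z) in ab *.
  have G20 : 0 <= G2 z by apply: sumr_ge0 => i _; exact: sqr_ge0.
  set g := G ord_max z.
  have le_main (p : R) : 0 <= p <= 1 ->
      p ^+ 2 * G2 z + 2 * p * (a z * g) + a z ^+ 2 <=
      p * G2 z + a z * g + (e * g ^+ 2 + ((4 * e)^-1 + 1) * a z ^+ 2).
    move=> /andP[p0 p1].
    have t1 : p ^+ 2 * G2 z <= p * G2 z.
      by rewrite ler_wpM2r// expr2 ler_piMl.
    have t2 : (2 * p - 1) * (a z * g) <= e * g ^+ 2 + (4 * e)^-1 * a z ^+ 2.
      have : (2 * p - 1) * (a z * g) <= `|a z * g|.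
        apply: le_trans (ler_norm _) _; rewrite normrM ler_piMl//.
        by rewrite ler_norml; lra.
      move/le_trans; apply.
      have sq := sqr_ge0 (2 * e * `|g| - `|a z|).
      rewrite -(ler_pM2l (_ : 0 < 4 * e)) ?mulr_gt0// mulrDr.
      rewrite [_ * ((4 * e)^-1 * _)]mulrA mulfV ?gt_eqF ?mulr_gt0// mul1r.
      rewrite normrM -(real_normK (num_real g)) -(real_normK (num_real (a z))).
      by move: sq; rewrite !expr2; lra.
    by lra.
  have p01 : 0 <= k z * band c M u z <= 1.
    have [->|->] := band_01 c u z M0; first by rewrite mulr0 lexx ler01.
    by rewrite mulr1 k0.
  apply: le_trans (le_main _ p01) _; rewrite !lerD2l.
  by rewrite ler_wpM2l// addr_ge0// invr_ge0 mulr_ge0// ltW.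
have G2i : (mu n.+1).-integrable C (EFin \o G2) by exact: integrable_sum_ord.
have mP : measurable_fun C (band c M u).
  by apply: measurable_funB; exact: measurable_above.
have mdGH : measurable_fun C (dot G H).
  apply: measurable_sum => i; exact: measurable_funM.
have mdHH : measurable_fun C (dot H H).
  apply: measurable_sum => i; exact: measurable_funM.
have idHH : (mu n.+1).-integrable C (EFin \o dot H H).
  rewrite (_ : dot H H = fun z => \sum_(i < n.+1) H i z ^+ 2); first exact: integrable_sum_ord.
  by apply/funext => z; apply: eq_bigr => i _; rewrite expr2.
have islab : (mu n.+1).-integrable C (EFin \o (fun z => b ^+ 2 * \1_(slab N) z)).
  exact: integrable_scale.
have idGH : (mu n.+1).-integrable C (EFin \o dot G H).
  apply: (@integrable_le _ _ _ _ _ _ (fun z => \sum_(i < n.+1) G i z ^+ 2 +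
     \sum_(i < n.+1) H i z ^+ 2)) => //.
  - move=> z _; rewrite -big_split/=; apply: le_trans (ler_norm_sum _ _ _) _.
    apply: ler_sum => i _; rewrite normrM.
    have := sqr_ge0 (`|G i z| - `|H i z|).
    rewrite -(real_normK (num_real (G i z))) -(real_normK (num_real (H i z))).
    by have := normr_ge0 (G i z); have := normr_ge0 (H i z); rewrite !expr2; nra.
  - by apply: integrable_add => //; exact: integrable_sum_ord.
have ineq : \int_(z in C) dot H H z <= \int_(z in C) dot G H z +
    (e * A + ((4 * e)^-1 + 1) * (B / N)).
  have -> : B / N = \int_(z in C) (b ^+ 2 * \1_(slab N) z).
    rewrite RintegralZl// Rintegral_slab// /B /b.
    by field; rewrite gt_eqF.
  rewrite -!RintegralZl// -!RintegralD//; try exact: integrable_scale.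
    apply: le_Rintegral => //.
    by apply: integrable_add => //; apply: integrable_add => //; exact: integrable_scale.
  by apply: integrable_add => //; exact: integrable_scale.
by move: E1 E2 ineq; rewrite /I -/s -/C; lra.
Qed.

End energy.

(** * Bounds and signs almost everywhere *)

Section almost_everywhere.
Context d (T : measurableType d) (R : realType) (nu : {measure set T -> \bar R}).
Implicit Types (D : set T) (g : T -> R).

Lemma integrable_ae_bounded D g (M : R) : measurable D -> (nu D < +oo)%E ->
  measurable_fun D g -> {ae nu, forall x, D x -> `|g x| <= M} ->
  nu.-integrable D (EFin \o g).
Proof.
move=> mD Doo mg gM; apply/integrableP; split; first exact/measurable_EFinP.
apply: (@le_lt_trans _ _ (`|M|%:E * nu D)%E).
  apply: (integral_le_bound `|M|%:E) => //; first exact/measurable_EFinP.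
  apply: filterS gM => x gx Dx; rewrite lee_fin.
  by apply: le_trans (gx Dx) _; exact: ler_norm.
by apply: lte_mul_pinfty.
Qed.

Lemma ae_eq0_of_Rintegral_le0 D g : measurable D ->
  nu.-integrable D (EFin \o g) -> {ae nu, forall x, D x -> 0 <= g x} ->
  \int[nu]_(x in D) g x <= 0 -> {ae nu, forall x, D x -> g x = 0}.
Proof.
move=> mD gi g0 ig; have mg := integrable_mfun gi.
have E : (\int[nu]_(x in D) `|(g x)%:E| = \int[nu]_(x in D) (g x)%:E)%E.
  apply: ae_eq_integral => //.
  - by apply: measurableT_comp => //; exact/measurable_EFinP.
  - exact/measurable_EFinP.
  - by apply: filterS g0 => x gx Dx /=; rewrite ger0_norm// gx.
have : (\int[nu]_(x in D) `|(g x)%:E| = 0)%E.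
  apply/eqP; rewrite eq_le integral_ge0// andbT E.
  by rewrite -(fineK (integrable_fin_num mD gi)) lee_fin.
have mEg : measurable_fun D (EFin \o g) by exact/measurable_EFinP.
move/(ae_eq_integral_abs nu mD mEg); apply: filterS => x gx Dx.
by have [] := gx Dx.
Qed.

End almost_everywhere.

(** * Strictly convex functions *)

Section convexity.
Context {R : realType}.

(** The weak inequality follows from convexity along the segment at small t;
    it becomes strict by using it at the midpoint of x and y. *)
Lemma strictly_convex_above_tangent (f : R -> R) (a x y : R) :
  strictly_convex f -> is_derive x 1 f a -> x != y -> f x + a * (y - x) < f y.
Proof.
move=> sc df xy.
have weak z : x != z -> f x + a * (z - x) <= f z.
  move=> xz; rewrite leNgt; apply/negP => h.
  pose F (t : R) := f (t * (z - x) + x).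
  have dF : is_derive (0 : R) 1 F (a * (z - x)).
    have d1 : is_derive (0 : R) 1 (fun t : R => t * (z - x) + x) (z - x).
      rewrite (_ : (fun _ => _) = (z - x) \*: id + cst x); last first.
        by apply/funext => t /=; rewrite mulrC.
      by apply: is_derive_eq; rewrite addr0 [_ *: _]mulr1.
    have d2 : is_derive (0 * (z - x) + x : R) 1 f a by rewrite mul0r add0r.
    exact: (is_derive1_comp (f := f) (g := fun t : R => t * (z - x) + x) d2 d1).
  pose gap := f x + a * (z - x) - f z.
  have g0 : 0 < gap / 2 by rewrite divr_gt0// subr_gt0.
  have [dd d0 hd] := derive_expansion dF g0.
  pose t := Num.min dd 1 / 2.
  have t0 : 0 < t by rewrite divr_gt0// lt_min d0 ltr01.
  have tm : t < Num.min dd 1 by rewrite ltr_pdivrMr// mulr_natr mulr2n ltrDl lt_min d0 ltr01.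
  move: tm; rewrite lt_min => /andP[td t1].
  have := hd t; rewrite gtr0_norm// => /(_ td); rewrite ler_norml => /andP[h1 _].
  have := sc z x t _ t0 t1; rewrite eq_sym => /(_ xz) h2.
  have E : F t = f (t * z + (1 - t) * x) by rewrite /F; congr f; ring.
  have E0 : F 0 = f x by rewrite /F mul0r add0r.
  rewrite E E0 in h1.
  have : t * (gap / 2) < 0 by rewrite /gap in h1 *; lra.
  by rewrite ltNge mulr_ge0// ltW.
(* Strict convexity at the midpoint beats the tangent line there. *)
pose mid := (x + y) / 2.
have xm : x != mid.
  by apply: contra_neq xy => E; move: E; rewrite /mid; lra.
have h1 := weak mid xm.
have := sc x y (1 / 2) xy; rewrite divr_gt0// => /(_ isT).
have -> : 1 / 2 < 1 :> R by lra.
move=> /(_ isT).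
rewrite (_ : 1 / 2 * x + (1 - 1 / 2) * y = mid); last by rewrite /mid; field.
by move: h1; rewrite {1}/mid; lra.
Qed.

Lemma continuous_bounded_segment (f : R -> R) (M : R) : continuous f ->
  exists K : R, forall x, `|x| <= M -> `|f x| <= K.
Proof.
move=> cf; have /compact_bounded[K [_ hK]] : compact (f @` `[- M, M]%classic).
  apply: continuous_compact; first exact: continuous_subspaceT.
  exact: segment_compact.
exists (K + 1) => x xM; apply: hK; first by rewrite ltrDl.
by exists x => //; rewrite /= in_itv/= -ler_norml.
Qed.

End convexity.

(** * From the energy inequality to constancy *)

Section constancy.
Context {R : realType} (n : nat).
Local Notation mu m := (lebesgue_rV R m).
Variable Omega : set 'rV[R]_n.
Hypothesis oOmega : open Omega.
Hypothesis finOmega : (mu n Omega < +oo)%E.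

Let mO := open_measurable_rV oOmega.

(** Where v > c, the graph of f lies above its tangent at v, so f(v) - f'(v)(v
    - c) < f(c) <= 0. The integrand of the energy inequality, which is (v - c)
    times the left-hand side there and 0 elsewhere, is then nonpositive with
    nonnegative integral, hence zero almost everywhere, which excludes v > c.
    *)
Lemma le_of_truncated_energy (v : 'rV[R]_n -> R) (f f1 : R -> R) (c M0 : R) :
  strictly_convex f -> (forall x : R, is_derive x 1 f (f1 x)) -> continuous f1 ->
  measurable_fun Omega v ->
  {ae mu n, forall x, Omega x -> `|v x| <= M0} ->
  (forall M, 0 <= M ->
    0 <= \int_(x in Omega) (f (v x) * trunc c M v x) -
         \int_(x in Omega) (f1 (v x) * trunc c M v x ^+ 2)) ->
  f c <= 0 -> {ae mu n, forall x, Omega x -> v x <= c}.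
Proof.
move=> sc df cf1 mv vM0 energy fc0.
have cf : continuous f.
  move=> x; apply: differentiable_continuous; apply/derivable1_diffP.
  by have [] := df x.
(* This level is high enough for the truncation of v to be (v - c)^+. *)
pose M := `|M0| + `|c|; have M_ge0 : 0 <= M by rewrite addr_ge0.
have {energy} := energy M M_ge0; set s := trunc c M v => energy.
have s_itv x : 0 <= s x <= M by exact: trunc_itv.
have ms : measurable_fun Omega s by exact: measurable_trunc.
have comp_m (g : R -> R) : continuous g -> measurable_fun Omega (fun x => g (v x)).
  move=> cg; have mg : measurable_fun setT (g : R -> R) by exact: continuous_measurable_fun.
  exact: (measurableT_comp mg mv).
have [K hK] := continuous_bounded_segment M0 cf.
have [K1 hK1] := continuous_bounded_segment M0 cf1.
have i1 : (mu n).-integrable Omega (EFin \o (fun x => f (v x) * s x)).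
  apply: (@integrable_ae_bounded _ _ _ _ _ _ (K * M)) => //.
    by apply: measurable_funM => //; exact: comp_m.
  apply: filterS vM0 => x vx Ox; have /andP[s0 sM] := s_itv x.
  by rewrite normrM (ger0_norm s0) ler_pM// hK// vx.
have i2 : (mu n).-integrable Omega (EFin \o (fun x => f1 (v x) * s x ^+ 2)).
  apply: (@integrable_ae_bounded _ _ _ _ _ _ (K1 * M ^+ 2)) => //.
    by apply: measurable_funM; [exact: comp_m|exact: measurable_funX].
  apply: filterS vM0 => x vx Ox; have /andP[s0 sM] := s_itv x.
  rewrite normrM normrX (ger0_norm s0) ler_pM ?exprn_ge0 ?hK1 ?vx//.
  by rewrite lerXn2r ?nnegrE.
pose g x := f1 (v x) * s x ^+ 2 - f (v x) * s x.
have sE x : `|v x| <= M0 -> s x = Num.max (v x - c) 0.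
  move=> vx; rewrite /s /trunc /pos_part [X in _ + -1 * X](max_idPr _) ?mulr0 ?addr0 ?mul1r//.
  have := ler_norm (v x); have := ler_norm M0.
  by have := ler_norm (- c); rewrite normrN /M; lra.
have gpos x : `|v x| <= M0 -> c < v x -> 0 < g x.
  move=> vx cv; rewrite /g sE// (max_idPl _) ?subr_ge0 ?ltW//.
  have vc : v x != c by rewrite gt_eqF.
  have := strictly_convex_above_tangent sc (df (v x)) vc.
  have d0 : 0 < v x - c by rewrite subr_gt0.
  by nra.
have g0 x : `|v x| <= M0 -> v x <= c -> g x = 0.
  by move=> vx vc; rewrite /g sE// (max_idPr _) ?subr_le0// expr0n !mulr0 subrr.
have gi : (mu n).-integrable Omega (EFin \o g) by exact: integrable_sub.
have gae : {ae mu n, forall x, Omega x -> 0 <= g x}.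
  apply: filterS vM0 => x vx Ox; have [vc|cv] := leP (v x) c.
    by rewrite g0// vx.
  by rewrite ltW// gpos// vx.
have gle0 : \int_(x in Omega) g x <= 0.
  by rewrite /g RintegralB// -opprB oppr_le0.
have := ae_eq0_of_Rintegral_le0 mO gi gae gle0.
apply: filterS2 vM0 => x vx gx Ox; rewrite leNgt; apply/negP => cv.
by have := gpos x (vx Ox) cv; rewrite gx// ltxx.
Qed.

(** Let z be the least level with f(z) <= 0. Then v <= z, while f > 0 below z
    and f(z) = 0 give f(v) >= 0; the mean of f(v) being 0, f(v) = 0 and v = z.
    If there is no level with f <= 0, or if there is one below all values of
    v, then Omega is a null set. *)
Lemma constant_of_convex (v : 'rV[R]_n -> R) (f : R -> R) (M0 : R) :
  continuous f -> measurable_fun Omega v ->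
  {ae mu n, forall x, Omega x -> `|v x| <= M0} ->
  \int_(x in Omega) f (v x) = 0 ->
  (forall c, f c <= 0 -> {ae mu n, forall x, Omega x -> v x <= c}) ->
  exists c : R, {ae mu n, forall x, Omega x -> v x = c}.
Proof.
move=> cf mv vM0 fv0 H.
have mfv : measurable_fun Omega (fun x => f (v x)).
  have mf : measurable_fun setT (f : R -> R) by exact: continuous_measurable_fun.
  exact: (measurableT_comp mf mv).
have [K hK] := continuous_bounded_segment M0 cf.
have fvi : (mu n).-integrable Omega (EFin \o (fun x => f (v x))).
  apply: (@integrable_ae_bounded _ _ _ _ _ _ K) => //.
  by apply: filterS vM0 => x vx Ox; rewrite hK// vx.
have fv_zero : {ae mu n, forall x, Omega x -> 0 <= f (v x)} ->
    {ae mu n, forall x, Omega x -> f (v x) = 0}.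
  by move=> h; apply: ae_eq0_of_Rintegral_le0 => //; rewrite fv0.
pose S := [set c | f c <= 0].
have [S0|] := pselect (S !=set0); last first.
  move=> /set0P/negP/negPn/eqP S0.
  have fpos y : 0 < f y.
    by rewrite ltNge; apply/negP => fy; have : S y by []; rewrite S0.
  exists 0; have := fv_zero (aeW _ (fun x _ => ltW (fpos (v x)))).
  by apply: filterS => x fx Ox; have := fpos (v x); rewrite fx// ltxx.
have [[c [Sc cM]]|] := pselect (exists c, S c /\ c < - M0).
  exists 0; apply: filterS2 vM0 (H c Sc) => x vx vc Ox.
  have := vx Ox; rewrite ler_norml => /andP[h _].
  by have := le_lt_trans (le_trans h (vc Ox)) cM; rewrite ltxx.
move=> nlow; have Slb : lbound S (- M0).
  by move=> c Sc; rewrite leNgt; apply/negP => cM; apply: nlow; exists c.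
have hinf : has_inf S by split => //; exists (- M0).
have hlb : has_lbound S by case: hinf.
pose z := inf S.
have cz_near (P : R -> Prop) : (\forall y \near f z, P y) -> exists2 e : R, 0 < e &
    forall y, `|z - y| < e -> P (f y).
  move=> hP; have : \forall y \near z, P (f y) by exact: cf.
  by move=> /nbhs_ballP[e /= e0 he]; exists e => // y zy; exact: he.
have fz_le0 : f z <= 0.
  rewrite leNgt; apply/negP => fz0.
  have [e e0 he] := cz_near (fun y => 0 < y) (lt_nbhsr fz0).
  have [c Sc cz] := inf_adherent e0 hinf.
  have zc : z <= c by exact: ge_inf.
  have : 0 < f c by apply: he; rewrite distrC ger0_norm ?subr_ge0// ltrBlDl.
  by rewrite ltNge Sc.
have fz_ge0 : 0 <= f z.
  rewrite leNgt; apply/negP => fz0.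
  have [e e0 he] := cz_near (fun y => y < 0) (lt_nbhsl fz0).
  have e2 : 0 < e / 2 by rewrite divr_gt0.
  have : S (z - e / 2).
    rewrite /S /= ltW//; apply: he; rewrite opprB addrC subrK gtr0_norm//.
    by rewrite ltr_pdivrMr// mulr_natr mulr2n ltrDl.
  by move=> /(ge_inf hlb); rewrite -/z lerBrDl gerDr leNgt e2.
have vz := H z fz_le0.
have fv_ge0 : {ae mu n, forall x, Omega x -> 0 <= f (v x)}.
  apply: filterS vz => x vx Ox; have := vx Ox; rewrite le_eqVlt => /predU1P[->//|vlt].
  rewrite leNgt; apply/negP => fvx.
  by have := ge_inf hlb (ltW fvx : S (v x)); rewrite -/z leNgt vlt.
exists z; apply: filterS2 vz (fv_zero fv_ge0) => x vx fx Ox.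
apply/eqP; rewrite eq_le vx//=; apply: ge_inf => //.
by rewrite /S /= fx.
Qed.

End constancy.

(** * The mean of f(v) *)

Section mean_zero.
Context {R : realType}.
Local Notation mu m := (lebesgue_rV R m).

(** The integral of h(x - s e) does not depend on s, so its derivative at s =
    0 is zero. *)
Lemma Rintegral_partial0 m (U : set 'rV[R]_m) h i : open U -> test_function U h ->
  \int_(x in U) partial i h x = 0.
Proof.
move=> oU th; have [K [cK KU h0 ph0 [M M0 [hM phM]]]] := test_function_bounded th.
have [sh _] := th.
have [d d0 [K' [cK' K'U KK']]] := compact_thickening cK oU KU.
have mK' := compact_measurable_rV cK'.
have w_i : (mu m).-integrable setT (EFin \o (\1_K' : _ -> R)).
  apply: integrable_indic_finite => //; apply: bounded_lebesgue_rV => //.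
  exact: compact_bounded.
pose Phi (s : R) := \int_(x in setT) (\1_K' x * h (x - s *: unit_vec R i)).
have hi : (mu m).-integrable setT (EFin \o h).
  rewrite (_ : h = fun x => h x * \1_K x); last first.
    apply/funext => x; rewrite indicE; have [Kx|Kx] := pselect (K x).
      by rewrite mem_set// mulr1.
    by rewrite h0// mul0r.
  have mK := compact_measurable_rV cK.
  apply: (@integrable_mul_indic _ _ R (mu m) _ _ mK).1.
  apply: (@integrable_bounded _ _ _ _ _ _ M) => //.
    by apply: bounded_lebesgue_rV => //; exact: compact_bounded.
  exact: measurable_smooth.
have PhiE (s : R) : `|s| <= d -> Phi s = \int_(x in setT) h x.
  move=> sd; rewrite -(Rintegral_addr (- (s *: unit_vec R i)) hi).
  apply: eq_Rintegral => x _; rewrite indicE.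
  have [Kx|Kx] := pselect (K (x - s *: unit_vec R i)); last by rewrite h0// mulr0.
  rewrite mem_set ?mul1r// -[x](subrK (s *: unit_vec R i)).
  apply: KK' => //; apply: le_trans sd; apply: le_mx_norm => // j.
  rewrite !mxE normrM ler_piMr//.
  by case: (_ && _); rewrite ?normr1 ?normr0.
have dPhi := is_derive_convolution 0 w_i sh hM (phM i).
set a := - _ in dPhi.
have a0 : a = 0.
  apply/eqP; rewrite -normr_le0; apply/ler_addgt0Pr => eps e0; rewrite add0r.
  have [d1 d10 H1] := derive_expansion dPhi e0.
  pose t := Num.min d d1 / 2.
  have t0 : 0 < t by rewrite divr_gt0// lt_min d0.
  have tm : t < Num.min d d1 by rewrite ltr_pdivrMr// mulr_natr mulr2n ltrDl lt_min d0.
  move: tm; rewrite lt_min => /andP[td td1].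
  have := H1 t; rewrite gtr0_norm// => /(_ td1).
  rewrite -/(Phi t) -/(Phi 0) !PhiE ?normr0 ?(ltW d0)//; last by rewrite gtr0_norm// ltW.
  by rewrite subrr sub0r normrN normrM gtr0_norm// ler_pM2l.
have : \int_(x in setT) (\1_K' x * partial i h x) = 0.
  move: a0; rewrite /a => /eqP; rewrite oppr_eq0 => /eqP E; rewrite -[RHS]E.
  by apply: eq_Rintegral => x _; rewrite scale0r subr0.
move=> <-; rewrite Rintegral_indic; apply: eq_Rintegral => x _.
have [Kx|Kx] := pselect (K x); last by rewrite ph0// mulr0 mul0r.
have K'x : K' x by rewrite -[x]addr0; apply: KK' => //; rewrite normr0 ltW.
by rewrite !indicE !mem_set ?mulr1 ?mul1r//; exact: K'U.
Qed.

(** The constants are the admissible functions that detect the mean of f(v).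
    *)
Lemma H1_cst m (U : set 'rV[R]_m) (c : R) : open U -> (mu m U < +oo)%E ->
  H1 U (fun=> c) (fun _ _ => 0).
Proof.
move=> oU Uoo; have mU := open_measurable_rV oU.
have L2c (b : R) : L2 U (fun=> b).
  split => //; apply: (@integrable_bounded _ _ _ _ _ (fun=> b ^+ 2) (b ^+ 2)) => //.
  by move=> x _; rewrite ger0_norm ?sqr_ge0.
have lic (b : R) : locally_integrable_in U U (fun=> b).
  by apply: (@locally_integrable_cst_bounded _ _ _ _ _ `|b|).
split => //; split => // i h th.
rewrite [X in _ = - X](@eq_Rintegral _ _ _ _ _ (fun=> 0)); last first.
  by move=> x _; rewrite mul0r.
rewrite Rintegral_cst// mul0r oppr0.
transitivity (c * \int_(x in U) partial i h x); last by rewrite Rintegral_partial0// mulr0.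
rewrite -RintegralZl//.
rewrite (_ : _ \o _ = EFin \o (fun x => 1 * partial i h x)); last first.
  by apply/funext => x /=; rewrite mul1r.
exact: (integrable_test_partial i mU (lic 1) th).
Qed.

(** The constant function 1 is orthogonal to the eigenfunctions of nonzero
    eigenvalue, so the left-hand side of the equation vanishes when it is
    tested with 1. *)
Lemma solution_mean_zero n (Omega : set 'rV[R]_n) phi lambda f v :
  open Omega -> (mu n Omega < +oo)%E ->
  neumann_eigenbasis Omega phi lambda ->
  half_laplacian_solution Omega phi lambda f v ->
  \int_(x in Omega) f (v x) = 0.
Proof.
move=> oO Ooo [_ eig] [_ _ eqn].
have H11 := H1_cst 1 oO Ooo.
have zero k : Num.sqrt (lambda k) * coef Omega phi (fun=> 1) k = 0.
  have [G _ /(_ _ _ H11)] := eig k.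
  rewrite [X in X = _](@eq_Rintegral _ _ _ _ _ (fun=> 0)); last first.
    by move=> x _; rewrite /dot big1// => i _; rewrite mulr0.
  rewrite Rintegral_cst ?mul0r; last exact: open_measurable_rV.
  move=> /esym/eqP; rewrite mulf_eq0 => /orP[/eqP ->|/eqP E].
    by rewrite sqrtr0 mul0r.
  rewrite /coef (_ : \int_(x in Omega) (1 * phi k x) = 0) ?mulr0//.
  by rewrite -E; apply: eq_Rintegral => x _; rewrite mulrC.
have series0 (c : nat -> R) : (forall k, c k = 0) -> series c = fun=> 0.
  by move=> c0; apply/funext => N; rewrite /series/= big1.
(* By the previous step every term of both series is zero. *)
have Hz : Hhalf Omega phi lambda (fun=> 1).
  split; first by case: H11.
  rewrite series0; first exact: is_cvg_cst.
  move=> k; rewrite real_normK ?num_real// expr2 mulrA zero mul0r //.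
have := eqn _ Hz; rewrite series0; last first.
  by move=> k; rewrite mulrAC zero mul0r.
move=> h0; have <- : \int_(x in Omega) (f (v x) * 1) = \int_(x in Omega) f (v x).
  by apply: eq_Rintegral => x _; rewrite mulr1.
by apply: (norm_cvg_unique h0); apply: cvg_cst.
Qed.

End mean_zero.

(** * The change of sign, and the theorem *)

Section negation.
Context {R : realType} (n : nat) (Omega : set 'rV[R]_n).
Hypothesis oOmega : open Omega.

Lemma weak_gradientN m (U : set 'rV[R]_m) u G : open U -> weak_gradient U u G ->
  weak_gradient U (fun x => - u x) (fun i x => - G i x).
Proof.
move=> oU wG; have := weak_gradient_lin (-1) 0 oU wG wG.
by congr weak_gradient; [apply/funext => x|do 2 apply/funext => ?];
  rewrite mul0r addr0 mulN1r.
Qed.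

Lemma is_traceN u G t : is_trace Omega u G t ->
  is_trace Omega (fun z => - u z) (fun i z => - G i z) (fun x => - t x).
Proof.
move=> tr; have := is_trace_lin oOmega (-1) 0 tr tr.
by congr is_trace; [apply/funext => x|do 2 apply/funext => ?|apply/funext => x];
  rewrite mul0r addr0 mulN1r.
Qed.

Lemma L2N m (U : set 'rV[R]_m) u : L2 U u -> L2 U (fun x => - u x).
Proof.
move=> [mu_u ui]; split; first exact: measurableT_comp.
by under eq_fun do rewrite sqrrN.
Qed.

Lemma H_cylinderN u G t : H_cylinder Omega u G t ->
  H_cylinder Omega (fun z => - u z) (fun i z => - G i z) (fun x => - t x).
Proof.
have oC := open_cylinder oOmega.
move=> [[wG tr] GL2 tL2 [uj [Gj [tj [hj trj Gcvg tcvg]]]]]; split.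
- by split; [exact: weak_gradientN|exact: is_traceN].
- by move=> i; exact: L2N.
- exact: L2N.
- exists (fun j z => - uj j z), (fun j i z => - Gj j i z), (fun j x => - tj j x).
  split.
  + move=> j; have [w1 l1 l2] := hj j.
    by split; [exact: weak_gradientN|exact: L2N|move=> i; exact: L2N].
  + by move=> j; have [t1 l1] := trj j; split; [exact: is_traceN|exact: L2N].
  + rewrite (_ : (fun j => _) = fun j =>
        \int_(z in cylinder Omega) (\sum_i (Gj j i z - G i z) ^+ 2)) //.
    apply/funext => j; apply: eq_Rintegral => z _.
    by apply: eq_bigr => i _; rewrite -opprD sqrrN.
  + rewrite (_ : (fun j => _) = fun j =>
        \int_(x in Omega) ((tj j x - t x) ^+ 2)) //.
    apply/funext => j; apply: eq_Rintegral => z _.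
    by rewrite -opprD sqrrN.
Qed.

End negation.

Theorem theorem1p6 (R : realType) (n : nat) (n_ge1 : (1 <= n)%N)
    (alpha : R) (alpha_gt0 : 0 < alpha) (alpha_lt1 : alpha < 1)
    (Omega : set 'rV[R]_n)
    (Omega_domain : is_domain Omega) (Omega_bounded : bounded_set Omega)
    (Omega_C4 : C_holder_domain 4 alpha Omega)
    (phi : nat -> 'rV[R]_n -> R) (lambda : nat -> R)
    (phi_basis : neumann_eigenbasis Omega phi lambda)
    (f : R -> R) (f_C2 : C_holder_real 2 alpha f)
    (f_strict : strictly_convex f \/ strictly_concave f)
    (v : 'rV[R]_n -> R)
    (v_solution : half_laplacian_solution Omega phi lambda f v)
    (v_stable : stable Omega f v) :
  exists c : R, {ae lebesgue_rV R n, forall x, Omega x -> v x = c}.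
Proof.
have [oO _ _] := Omega_domain.
have mO := open_measurable_rV oO.
have finO : (lebesgue_rV R n Omega < +oo)%E by exact: bounded_lebesgue_rV.
have mean0 := solution_mean_zero oO finO phi_basis v_solution.
have [_ [mv [M0 vM0]] _] := v_solution.
have [dj _] := f_C2.
pose f1 : R -> R := derive1 (f : R -> R^o).
have df (x : R) : is_derive x 1 f (f1 x).
  by apply: DeriveDef; [exact: (dj 0 x isT)|rewrite /f1 derive1E].
have cf : continuous f.
  move=> x; apply: differentiable_continuous; apply/derivable1_diffP.
  by have [] := df x.
have cf1 : continuous f1.
  move=> x; apply: differentiable_continuous; apply/derivable1_diffP.
  exact: (dj 1 x isT).
have [u [G [[Hu eqn] stab]]] := v_stable.
have [[wG tr] GL2 vL2 _] := Hu.
case: f_strict => [sc|sc].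
  apply: (constant_of_convex (f := f) oO finO cf mv vM0 mean0) => c fc.
  apply: (le_of_truncated_energy oO finO sc df cf1 mv vM0 _ fc) => M M_ge0.
  exact: (@truncated_energy_ge0 R n Omega oO finO u G v f f1 c M).
(* For concave f the same argument applies to -v, -u and the convex function
   g. *)
pose g (x : R) := - f (- x); pose g1 (x : R) := f1 (- x).
have scg : strictly_convex g.
  move=> x y t xy t0 t1; rewrite /g.
  have := sc (- x) (- y) t; rewrite eqr_opp => /(_ xy t0 t1).
  by rewrite !mulrN -!opprD ltrN2.
have dg (x : R) : is_derive x 1 g (g1 x).
  have d1 : is_derive (- x) 1 f (f1 (- x)) by exact: df.
  have d2 := is_derive1_comp (f := f) (g := -%R) d1 (is_deriveNid x 1).
  have := is_deriveN d2; rewrite mulrN1 opprK; exact.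
have cg1 : continuous g1.
  move=> x; apply: (@continuous_comp _ _ _ -%R f1); last exact: cf1.
  exact: opp_continuous.
have cg : continuous g.
  move=> x; apply: differentiable_continuous; apply/derivable1_diffP.
  by have [] := dg x.
have mv' : measurable_fun Omega (fun x => - v x) by exact: measurableT_comp.
have vM0' : {ae lebesgue_rV R n, forall x, Omega x -> `|- v x| <= M0}.
  by apply: filterS vM0 => x vx Ox; rewrite normrN vx.
have mean0' : \int_(x in Omega) g (- v x) = 0.
  have mfv : (lebesgue_rV R n).-integrable Omega (EFin \o (fun x => f (v x))).
    have [K hK] := continuous_bounded_segment M0 cf.
    apply: (@integrable_ae_bounded _ _ _ _ _ _ K) => //.
      have mf : measurable_fun setT (f : R -> R) by exact: continuous_measurable_fun.
      exact: (measurableT_comp mf mv).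
    by apply: filterS vM0 => x vx Ox; rewrite hK// vx.
  transitivity (-1 * \int_(x in Omega) f (v x)); last by rewrite mean0 mulr0.
  rewrite -RintegralZl//; apply: eq_Rintegral => x _.
  by rewrite /g opprK mulN1r.
have [c hc] : exists c : R, {ae lebesgue_rV R n, forall x, Omega x -> - v x = c}.
  apply: (constant_of_convex (f := g) oO finO cg mv' vM0' mean0') => c gc.
  apply: (le_of_truncated_energy oO finO scg dg cg1 mv' vM0' _ gc) => M M_ge0.
  apply: (@truncated_energy_ge0 R n Omega oO finO (fun z => - u z) (fun i z => - G i z)
            (fun x => - v x) g g1 c M).
  - by apply: weak_gradientN => //; exact: open_cylinder.
  - exact: is_traceN.
  - by move=> i; exact: L2N.
  - move=> h H s hH; have := eqn _ _ _ (H_cylinderN oO hH).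
    move=> E; rewrite -[RHS]E; congr (_ - _); apply: eq_Rintegral => x _.
      by apply: eq_bigr => i _; rewrite mulrN mulNr.
    by rewrite /g opprK mulrN mulNr.
  - move=> h H s hs.
    have -> : \int_(x in Omega) (g1 (- v x) * s x ^+ 2) =
              \int_(x in Omega) (f1 (v x) * s x ^+ 2).
      by apply: eq_Rintegral => x _; rewrite /g1 opprK.
    exact: (stab _ _ _ hs).
  - exact: M_ge0.
exists (- c); apply: filterS hc => x hx Ox.
by rewrite -(hx Ox) opprK.
Qed.
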